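(* Let $\mathcal{X}$ be a real Banach space and let $g:[a,b]\to\mathcal{X}$ be Henstock–Dunford integrable, with $gχ_E$ Henstock–Dunford integrable for every $E\in\Sigma$. The following are equivalent: (i) the Henstock–Dunford integral of $g$ is countably additive, i.e. the set function $\Sigma\to\mathcal{X}^{**}$, $E\mapsto \mathcal{HD}\int_E g\,d\mu$, is countably additive; (ii) there is an $N$-function $\phi$ satisfying the $\Delta'$ condition such that $\{y^*g: y^*\in B_{\mathcal{X}^*}\}$ is relatively weakly compact in the Orlicz space $H^\phi(\mu)$.
   Context: $\mu$ is Lebesgue measure on $[a,b]$ and $\Sigma$ the $\sigma$-algebra of Lebesgue measurable subsets; $B_{\mathcal{X}^*}$ is the closed unit ball of $\mathcal{X}^*$. A function $h:[a,b]\to\mathbb{R}$ is Henstock integrable on $[a,b]$ if there is $A\in\mathbb{R}$ such that for every $\epsilon>0$ there is a gauge $\delta:[a,b]\to(0,\infty)$ such that for every tagged partition $\{([u_k,z_k],t_k)\}$ of $[a,b]$ with $t_k\in[u_k,z_k]\subset(t_k-\delta(t_k),t_k+\delta(t_k))$ one has $|\sum_k h(t_k)(z_k-u_k)-A|<\epsilon$; $A=\mathcal{H}\int_a^b h$, and $\mathcal{H}\int_E h:=\mathcal{H}\int_a^b h\chi_E$. A function $g:[a,b]\to\mathcal{X}$ is Henstock–Dunford integrable if $y^*g$ is Henstock integrable for every $y^*\in\mathcal{X}^*$ and for every interval $I\subset[a,b]$ there is $y_I^{**}\in\mathcal{X}^{**}$ with $y_I^{**}(y^* )=\mathcal{H}\int_I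 y^*g$ for all $y^*$; $\mathcal{HD}\int_E g$ denotes the element $y_E^{**}$ with $y_E^{**}(y^* )=\mathcal{H}\int_E y^*g$. An $N$-function is $\phi(u)=\int_0^{|u|}m(t)\,dt$ where $m:[0,\infty)\to[0,\infty)$ is nondecreasing, right continuous, $m(0)=0$, $m(t)>0$ for $t>0$, $m(t)\to\infty$. $\phi$ satisfies $\Delta'$ if there are $k>0$ and $u_0>0$ with $\phi(xy)\le k\phi(x)\phi(y)$ for all $x,y\ge u_0$. The Orlicz space $H^\phi(\mu)$ is the space of ($\mu$-a.e. classes of) measurable $f$ on $[a,b]$ such that $\phi(f/\lambda)$ is Henstock integrable for some $\lambda>0$, with norm $\|f\|_\phi=\inf\{\lambda>0:\mathcal{H}\int_a^b\phi(f/\lambda)\le1\}$. *)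

(* Defs.v *)
From Stdlib Require Import Reals Lra List ClassicalEpsilon.
Import ListNotations.
Open Scope R_scope.

Record Banach := {
  carrier :> Type;
  bzero : carrier;
  badd : carrier -> carrier -> carrier;
  bopp : carrier -> carrier;
  bscal : R -> carrier -> carrier;
  bnorm : carrier -> R;
  badd_assoc : forall x y z, badd x (badd y z) = badd (badd x y) z;
  badd_comm : forall x y, badd x y = badd y x;
  badd_zero : forall x, badd x bzero = x;
  badd_opp : forall x, badd x (bopp x) = bzero;
  bscal_one : forall x, bscal 1 x = x;
  bscal_assoc : forall c d x, bscal c (bscal d x) = bscal (c * d) x;
  bscal_distr_l : forall c x y, bscal c (badd x y) = badd (bscal c x) (bscal c y);
  bscal_distr_r : forall c d x, bscal (c + d) x = badd (bscal c x) (bscal d x);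
  bnorm_nonneg : forall x, 0 <= bnorm x;
  bnorm_eq0 : forall x, bnorm x = 0 -> x = bzero;
  bnorm_scal : forall c x, bnorm (bscal c x) = Rabs c * bnorm x;
  bnorm_triangle : forall x y, bnorm (badd x y) <= bnorm x + bnorm y;
  bcomplete : forall u : nat -> carrier,
    (forall eps, eps > 0 -> exists N, forall n m, (n >= N)%nat -> (m >= N)%nat ->
        bnorm (badd (u n) (bopp (u m))) < eps) ->
    exists l, forall eps, eps > 0 -> exists N, forall n, (n >= N)%nat ->
        bnorm (badd (u n) (bopp l)) < eps
}.

Definition is_dual (X : Banach) (y : X -> R) : Prop :=
  (forall x1 x2, y (badd X x1 x2) = y x1 + y x2) /\
  (forall c x, y (bscal X c x) = c * y x) /\
  (exists C, forall x, Rabs (y x) <= C * bnorm X x).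

Definition dual_ball (X : Banach) (y : X -> R) : Prop :=
  is_dual X y /\ forall x, Rabs (y x) <= bnorm X x.

Definition is_bidual (X : Banach) (Phi : (X -> R) -> R) : Prop :=
  (forall y1 y2, is_dual X y1 -> is_dual X y2 ->
      Phi (fun x => y1 x + y2 x) = Phi y1 + Phi y2) /\
  (forall c y, is_dual X y -> Phi (fun x => c * y x) = c * Phi y) /\
  (exists C, forall y M, is_dual X y -> 0 <= M ->
      (forall x, Rabs (y x) <= M * bnorm X x) -> Rabs (Phi y) <= C * M).

Definition indicator (E : R -> Prop) (t : R) : R :=
  if excluded_middle_informative (E t) then 1 else 0.

Fixpoint tagged_partition (c b : R) (P : list (R * R * R)) : Prop :=
  match P with
  | [] => c = b
  | ((u, z), t) :: P' => u = c /\ u < z /\ u <= t <= z /\ tagged_partition z b P'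
  end.

Definition delta_fine (delta : R -> R) (P : list (R * R * R)) : Prop :=
  Forall (fun p => match p with ((u, z), t) =>
            t - delta t < u /\ z < t + delta t end) P.

Fixpoint riemann_sum (h : R -> R) (P : list (R * R * R)) : R :=
  match P with
  | [] => 0
  | ((u, z), t) :: P' => h t * (z - u) + riemann_sum h P'
  end.

Definition Henstock_integral (h : R -> R) (a b A : R) : Prop :=
  forall eps, eps > 0 -> exists delta : R -> R,
    (forall t, a <= t <= b -> delta t > 0) /\
    forall P, tagged_partition a b P -> delta_fine delta P ->
      Rabs (riemann_sum h P - A) < eps.

Definition Henstock_integrable (h : R -> R) (a b : R) : Prop :=
  exists A, Henstock_integral h a b A.

Definition interval_cover (A : R -> Prop) (c d : nat -> R) (s : R) : Prop :=
  (forall n, c n <= d n) /\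
  (forall x, A x -> exists n, c n < x < d n) /\
  Un_cv (fun N => sum_f_R0 (fun n => d n - c n) N) s.

Definition outer_measure (A : R -> Prop) (m : R) : Prop :=
  (forall c d s, interval_cover A c d s -> m <= s) /\
  (forall m', (forall c d s, interval_cover A c d s -> m' <= s) -> m' <= m).

Definition subset_ab (a b : R) (A : R -> Prop) : Prop :=
  forall x, A x -> a <= x <= b.

Definition lebesgue_measurable (a b : R) (E : R -> Prop) : Prop :=
  subset_ab a b E /\
  forall A mA m1 m2, subset_ab a b A ->
    outer_measure A mA ->
    outer_measure (fun x => A x /\ E x) m1 ->
    outer_measure (fun x => A x /\ ~ E x) m2 ->
    mA = m1 + m2.

Definition measurable_fun (a b : R) (f : R -> R) : Prop :=
  forall c, lebesgue_measurable a b (fun t => a <= t <= b /\ f t > c).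

Definition is_interval (I : R -> Prop) : Prop :=
  forall x y z, I x -> I z -> x <= y <= z -> I y.

Definition HD_integrable (X : Banach) (a b : R) (g : R -> X) : Prop :=
  (forall y, is_dual X y -> Henstock_integrable (fun t => y (g t)) a b) /\
  (forall I, is_interval I -> subset_ab a b I ->
     exists Phi, is_bidual X Phi /\
       forall y, is_dual X y ->
         Henstock_integral (fun t => y (g t) * indicator I t) a b (Phi y)).

(* Phi = HD int_E g, an element of the bidual determined by its action on the dual *)
Definition is_HD_integral_on (X : Banach) (a b : R) (g : R -> X)
    (E : R -> Prop) (Phi : (X -> R) -> R) : Prop :=
  forall y, is_dual X y ->
    Henstock_integral (fun t => y (g t) * indicator E t) a b (Phi y).

(* E |-> HD \int_E g is countably additive (convergence in the norm of the bidual) *)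
Definition HD_countably_additive (X : Banach) (a b : R) (g : R -> X) : Prop :=
  forall (En : nat -> R -> Prop) (Phin : nat -> (X -> R) -> R) (PhiU : (X -> R) -> R),
    (forall n, lebesgue_measurable a b (En n)) ->
    (forall n m x, n <> m -> En n x -> En m x -> False) ->
    (forall n, is_HD_integral_on X a b g (En n) (Phin n)) ->
    is_HD_integral_on X a b g (fun x => exists n, En n x) PhiU ->
    forall eps, eps > 0 -> exists N0, forall N, (N >= N0)%nat ->
      forall y, dual_ball X y ->
        Rabs (sum_f_R0 (fun n => Phin n y) N - PhiU y) <= eps.

Definition N_function (phi : R -> R) : Prop :=
  exists m : R -> R,
    (forall s t, 0 <= s <= t -> m s <= m t) /\
    (forall t, 0 <= t -> forall eps, eps > 0 -> exists d, d > 0 /\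
        forall s, t <= s < t + d -> Rabs (m s - m t) < eps) /\
    m 0 = 0 /\
    (forall t, t > 0 -> m t > 0) /\
    (forall M, exists T, forall t, t >= T -> m t >= M) /\
    (forall u, Henstock_integral m 0 (Rabs u) (phi u)).

Definition Delta' (phi : R -> R) : Prop :=
  exists k u0, k > 0 /\ u0 > 0 /\
    forall x y, x >= u0 -> y >= u0 -> phi (x * y) <= k * phi x * phi y.

(* ---------- Orlicz space H^phi(mu) (functions; seminorm) ---------- *)
Definition in_Hphi (a b : R) (phi : R -> R) (f : R -> R) : Prop :=
  measurable_fun a b f /\
  exists lam, lam > 0 /\ Henstock_integrable (fun t => phi (f t / lam)) a b.

Definition orlicz_norm (a b : R) (phi : R -> R) (f : R -> R) (n : R) : Prop :=
  let S := fun lam => lam > 0 /\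
             exists A, Henstock_integral (fun t => phi (f t / lam)) a b A /\ A <= 1 in
  (forall lam, S lam -> n <= lam) /\
  (forall n', (forall lam, S lam -> n' <= lam) -> n' <= n).

Definition Hphi_dual (a b : R) (phi : R -> R) (L : (R -> R) -> R) : Prop :=
  (forall f h, in_Hphi a b phi f -> in_Hphi a b phi h ->
     L (fun t => f t + h t) = L f + L h) /\
  (forall c f, in_Hphi a b phi f -> L (fun t => c * f t) = c * L f) /\
  (exists C, forall f n, in_Hphi a b phi f -> orlicz_norm a b phi f n ->
     Rabs (L f) <= C * n).

Definition weak_nbhd (a b : R) (phi : R -> R) (f : R -> R)
    (Ls : list ((R -> R) -> R)) (eps : R) (h : R -> R) : Prop :=
  in_Hphi a b phi h /\ Forall (fun L => Rabs (L h - L f) < eps) Ls.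

Definition weak_open (a b : R) (phi : R -> R) (U : (R -> R) -> Prop) : Prop :=
  (forall h, U h -> in_Hphi a b phi h) /\
  forall f, U f -> exists Ls eps, eps > 0 /\ Forall (Hphi_dual a b phi) Ls /\
    forall h, weak_nbhd a b phi f Ls eps h -> U h.

Definition weak_closure (a b : R) (phi : R -> R) (S : (R -> R) -> Prop)
    (f : R -> R) : Prop :=
  in_Hphi a b phi f /\
  forall Ls eps, eps > 0 -> Forall (Hphi_dual a b phi) Ls ->
    exists h, S h /\ weak_nbhd a b phi f Ls eps h.

Definition weak_compact (a b : R) (phi : R -> R) (K : (R -> R) -> Prop) : Prop :=
  (forall f, K f -> in_Hphi a b phi f) /\
  forall (I : Type) (U : I -> (R -> R) -> Prop),
    (forall i, weak_open a b phi (U i)) ->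
    (forall f, K f -> exists i, U i f) ->
    exists l : list I, forall f, K f -> exists i, In i l /\ U i f.

Definition rel_weakly_compact (a b : R) (phi : R -> R) (S : (R -> R) -> Prop) : Prop :=
  (forall f, S f -> in_Hphi a b phi f) /\
  weak_compact a b phi (weak_closure a b phi S).

(* Main.v *)
(* Testing the Henstock-Dunford integrability of g and g chi_E on functionals y shows
   that every y g is measurable and Lebesgue integrable, so (i) says that the
   indefinite integrals of the functions y g, with y in the dual unit ball, are
   countably additive uniformly in y.

   (i) => (ii): uniform countable additivity gives uniform absolute continuity, hence
   uniform integrability: there are rapidly growing M_n with
   \int_{M_n <= |y g|} |y g| <= 2^-n for all y. An N-function phi whose derivative m
   grows by about 1 from M_n to M_(n+1) has phi(y g) uniformly absolutely continuous,
   and m(p^4) <= 4 m(p) for large p yields Delta'. Functionals on H^phi are then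
   uniformly approximated on the family by integrals against bounded functions, so a
   limit of the family along an ultrafilter, defined only on functionals, is
   represented by its density, which gives weak compactness.

   (ii) => (i): integrals against indicators are continuous functionals on H^phi, so
   every sequence in the family clusters setwise, and a gliding hump argument turns
   this into uniform countable additivity. *)
Require Import Defs.
From Stdlib Require Import Reals List ClassicalEpsilon.
From HB Require Import structures.
From mathcomp Require Import all_boot all_order all_algebra.
From mathcomp Require Import all_classical all_reals all_analysis.
From mathcomp Require Import measurable_realfun.
From mathcomp Require Import Rstruct Rstruct_topology.
From mathcomp Require Import ring lra zify.
Set Implicit Arguments.
Unset Strict Implicit.
Unset Printing Implicit Defensive.
Import Order.TTheory GRing.Theory Num.Theory numFieldNormedType.Exports.
Local Open Scope classical_set_scope.
Local Open Scope ring_scope.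

(** The dual of H^phi is never described. Delta' serves instead: with one factor frozen it bounds
    phi (x / lam) by k * phi x + k', so uniform absolute continuity of phi (y g) at scale 1 holds at
    every scale. Restrictions of the family to small sets then have small norm, and each functional
    is governed by its values on bounded functions, where Radon-Nikodym applies. The limit density f
    must be placed in H^phi before functionals can be evaluated at it. No almost everywhere
    convergence is at hand, so this is done by convexity, with the support lines of phi. The fourth
    power comes from Delta': for 4 <= x and 0 <= y <= x one has x * y <= x^2 <= (x/2)^4, hence m (x
    * y) <= 4 * m (x/2) for large x, while phi x >= x/2 * m (x/2). Thresholds with M_n^4 <= M_(n+1)
    give the bound on m, since taking a fourth power then passes at most one more threshold. *)

Notation R := Rdefinitions.R.
Bind Scope ring_scope with Rdefinitions.R.
HB.instance Definition _ := Measurable.copy R (Real.sort (R : realType)).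
Notation leb := (@completed_lebesgue_measure R).
Notation lout := ((@wlength R idfun)^*)%mu.
(** The line with its Lebesgue sigma-algebra; codomains keep the Borel one, so [measurable_fun] on
    [LT] is Lebesgue measurability. *)
Notation LT := (caratheodory_type lout).

(** * Interval covers and Lebesgue measurability *)

Lemma sum_wlength_itv (c d : nat -> R) N : (forall n, c n <= d n) ->
  (\sum_(0 <= k < N) wlength idfun (`]c k, d k[%classic : set R))%E =
  (\sum_(0 <= k < N) (d k - c k))%:E.
Proof.
move=> cd; rewrite -sumEFin; apply: eq_bigr => k _.
by rewrite wlength_itv_bnd.
Qed.

Lemma interval_cover_lout (A : set R) c d s :
  interval_cover A c d s -> (lout A <= s%:E)%E.
Proof.
move=> [cd [cov cv]].
have {}cd n : c n <= d n by exact/RleP/cd.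
rewrite outer_measure_open_itv_cover.
apply: ge_ereal_inf => /=.
exists (\sum_(0 <= k <oo) wlength idfun (`]c k, d k[%classic : set R))%E.
  exists (fun k => `]c k, d k[%classic) => //; split.
    by move=> k; exists (c k, d k).
  move=> x /cov[n [/RltP cx /RltP xd]]; exists n => //=.
  by rewrite in_itv/= cx xd.
apply: lime_le.
  by apply: is_cvg_nneseries => n _ _; exact: wlength_ge0.
near=> N.
rewrite sum_wlength_itv// lee_fin.
have grow : Un_growing (fun N => sum_f_R0 (fun n => Rminus (d n) (c n)) N).
  move=> n; apply/RleP; rewrite !sum_f_R0E [leRHS]big_nat_recr//= lerDl.
  by rewrite subr_ge0.
have := growing_ineq _ _ grow cv N.
move/RleP; apply: le_trans.
rewrite sum_f_R0E big_nat_recr//= lerDl.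
by rewrite subr_ge0.
Unshelve. all: by end_near. Qed.

(** The strict inequality provides a near-optimal cover; its lengths sum to at most [m], so the
    partial sums converge, as [interval_cover] demands. *)
Lemma lout_interval_cover (A : set R) (m : R) :
  (lout A < m%:E)%E -> exists c d s, interval_cover A c d s /\ s <= m.
Proof.
rewrite outer_measure_open_itv_cover => /ereal_inf_lt[_ [F [Fi AF] <-]] Fm.
have [ab Fab] := choice Fi.
pose c n := (ab n).1.
(* An interval with reversed endpoints is empty; raising its right end to the left one keeps it
   empty and gives [c n <= d n]. *)
pose d n := Num.max (ab n).1 (ab n).2.
have cd n : c n <= d n by rewrite le_max lexx.
have Fcd n : F n = `]c n, d n[%classic.
  rewrite Fab /c /d; case: leP => // h.
  have ge (x y : R) : y <= x -> `]x, y[%classic = set0 :> set R.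
    by move=> yx; apply: set_itv_ge; rewrite bnd_simp -leNgt.
  by rewrite !ge// ltW.
have bnd N : \sum_(0 <= k < N) (d k - c k) <= m.
  rewrite -lee_fin -sum_wlength_itv//.
  apply: le_trans (ltW Fm).
  under eq_bigr do rewrite -Fcd.
  by apply: nneseries_lim_ge => *; apply: wlength_ge0.
pose S := fun N => sum_f_R0 (fun n => Rminus (d n) (c n)) N.
have grow : Un_growing S.
  move=> n; apply/RleP; rewrite /S !sum_f_R0E [leRHS]big_nat_recr//= lerDl.
  by rewrite subr_ge0.
have ub : has_ub S.
  by exists m => _ [n ->]; apply/RleP; rewrite /S sum_f_R0E; exact: bnd.
have [s Ss] := growing_cv _ grow ub.
exists c, d, s; split.
  split; first by move=> n; exact/RleP/cd.
  split; last exact: Ss.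
  move=> x /AF[n _]; rewrite Fcd/= in_itv/= => /andP[/RltP ? /RltP ?].
  by exists n.
rewrite leNgt; apply/negP => ms.
have [|N] := Ss (s - m); first by apply/RltP; rewrite subr_gt0.

move=> SN; have := SN N (le_n N); rewrite /Rdist RabsE RminusE => /RltP.
rewrite /S sum_f_R0E; have := bnd N.+1.
set q := (\sum_(_ <= _ < _) _) => qm.
by rewrite ler0_norm; lra.
Qed.

Lemma outer_measure_fine (A : set R) :
  (lout A < +oo)%E -> Defs.outer_measure A (fine (lout A)).
Proof.
move=> Afin; have A0 : (0 <= lout A)%E by exact: outer_measure_ge0.
have Af : lout A \is a fin_num by rewrite ge0_fin_numE.
split=> [c d s|m' m'le].
  by move/interval_cover_lout => h; apply/RleP; rewrite -lee_fin fineK.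
apply/RleP/ler_addgt0Pr => e e0.
have : (lout A < (fine (lout A) + e)%:E)%E.
  by rewrite EFinD fineK// lteDl// lte_fin.
move=> /lout_interval_cover[c [d [s [/m'le/RleP m's sle]]]].
exact: le_trans sle.
Qed.

Lemma outer_measure_unique (A : set R) (m : R) :
  (lout A < +oo)%E -> Defs.outer_measure A m -> m = fine (lout A).
Proof.
move=> /outer_measure_fine[h1 h2] [k1 k2].
by apply/eqP; rewrite eq_le; apply/andP; split; apply/RleP; [exact: h2|exact: k2].
Qed.

Lemma lout_itv_lty (a b : R) (A : set R) : A `<=` `[a, b] -> (lout A < +oo)%E.
Proof.
move=> Aab; apply: (@le_lt_trans _ _ (lout (`[a, b]%classic : set R))).
  exact: le_outer_measure.
have := @lebesgue_measure_itv R `[a, b].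
rewrite [lebesgue_measure _](_ : _ = lout `[a, b]%classic)//= => ->.
by case: ifP => _; rewrite ?ltry// -EFinB ltry.
Qed.

Lemma borel_sub_LT (A : set R) : (@measurable _ (measurableTypeR R)) A ->
  measurable (A : set LT).
Proof. by move=> mA; apply: sub_caratheodory. Qed.

Lemma measurable_itv_LT (i : interval R) : measurable ([set` i] : set LT).
Proof. by apply: borel_sub_LT; exact: measurable_itv. Qed.

(** The Carathéodory test on subsets of [a, b] extends to every [X]: the interval is measurable and
    splits off the part of [X] outside it, which does not meet [E]. Inside [a, b] outer measures are
    finite, so the real-valued [outer_measure] agrees with [lout]. *)
Lemma lebesgue_measurableP (a b : R) (E : set R) :
  lebesgue_measurable a b E <->
  E `<=` `[a, b]%classic /\ measurable (E : set LT).
Proof.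
have sabE (A : set R) : subset_ab a b A <-> A `<=` `[a, b].
  split=> h x Ax; have := h x Ax; rewrite /= in_itv/=.
    by move=> [/RleP -> /RleP ->].
  by move=> /andP[/RleP ? /RleP ?].
split=> [[/sabE Eab cE]|[Eab mE]]; split => //.
- have {}cE X : X `<=` `[a, b]%classic ->
      lout X = (lout (X `&` E) + lout (X `&` ~` E))%E.
    move=> Xab; have finX Y : (lout (X `&` Y) < +oo)%E.
      by apply: (@lout_itv_lty a b) => x [/Xab].
    have finX0 := finX setT; rewrite setIT in finX0.
    have fX0 : lout X \is a fin_num.
      by rewrite ge0_fin_numE//; exact: outer_measure_ge0.
    have := cE X _ _ _ (proj2 (sabE X) Xab) (outer_measure_fine finX0)
      (outer_measure_fine (finX E)) (outer_measure_fine (finX (~` E))).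
    rewrite RplusE => h; apply/eqP; rewrite -(fineK (fX0)) h EFinD !fineK//.
    - by rewrite ge0_fin_numE//; exact: outer_measure_ge0.
    - by rewrite ge0_fin_numE//; exact: outer_measure_ge0.
  apply: le_caratheodory_measurable => X.
  pose D := (`[a, b]%classic : set R).
  have mD : measurable (D : set LT) by exact: measurable_itv_LT.
  rewrite [leRHS](mD X) [in leRHS]/= [X in (_ <= X + _)%E](cE (X `&` D)); last by move=> x [].
  rewrite -addeA (_ : X `&` D `&` E = X `&` E); last first.
    by rewrite -setIA; congr setI; exact: setIidr.
  rewrite leeD2l// (mD (X `&` ~` E)) leeD// le_outer_measure//.
    by move=> x [[]].
  by move=> x [[]].
- by apply/sabE.
- move=> A mA m1 m2 /sabE Aab o o1 o2.
  have finA B : (lout (A `&` B) < +oo)%E.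
    by apply: (@lout_itv_lty a b) => x [/Aab].
  have finA0 := finA setT; rewrite setIT in finA0.
  rewrite (outer_measure_unique finA0 o).
  rewrite (outer_measure_unique (finA E) o1).
  rewrite (outer_measure_unique (finA (~` E)) o2).
  have fA B : lout (A `&` B) \is a fin_num.
    by rewrite ge0_fin_numE//; exact: outer_measure_ge0.
  rewrite (mE A) fineD; [by []|exact: fA|exact: fA].
Qed.

(** * The Henstock integral and the Lebesgue integral *)

Lemma tagged_partition_cat (c d b : R) P Q :
  tagged_partition c d P -> tagged_partition d b Q ->
  tagged_partition c b (P ++ Q).
Proof.
elim: P c => [|[[u z] t] P IH] c /=; first by move=> ->.
by move=> [-> [? [? ?]]] ?; do 3 split => //; exact: IH.
Qed.

Lemma delta_fine_cat delta P Q :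
  delta_fine delta P -> delta_fine delta Q -> delta_fine delta (P ++ Q).
Proof. by move=> *; apply/Forall_app. Qed.

Lemma riemann_sum_cat f P Q :
  riemann_sum f (P ++ Q) = riemann_sum f P + riemann_sum f Q.
Proof.
elim: P => [|[[u z] t] P IH] /=; first by rewrite add0r.
by rewrite IH !RplusE addrA.
Qed.

Lemma delta_fineW (d1 d2 : R -> R) P :
  (forall t, d1 t <= d2 t) -> delta_fine d1 P -> delta_fine d2 P.
Proof.
move=> d12; apply: Forall_impl => -[[u z] t] [/RltP h1 /RltP h2].
have := d12 t; move: h1 h2; rewrite !RplusE !RminusE => h1 h2 h3.
by split; apply/RltP; rewrite ?RplusE ?RminusE; lra.
Qed.

Lemma tagged_partition_le (c b : R) P : tagged_partition c b P -> c <= b.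
Proof.
elim: P c => [|[[u z] t] P IH] c /=; first by move=> ->.
by move=> [<- [/RltP uz [_ /IH]]]; apply: le_trans; exact: ltW.
Qed.

(** The supremum of the points reachable from [a] by a fine partition is itself a usable tag: one
    interval tagged there joins a reachable point just below it to points beyond. Uniqueness and
    monotonicity of the Henstock integral rest on such partitions. *)
Lemma cousin (a b : R) (delta : R -> R) : a <= b ->
  (forall t, a <= t <= b -> 0 < delta t) ->
  exists P, tagged_partition a b P /\ delta_fine delta P.
Proof.
move=> ab dpos.
pose A := [set x : R | a <= x <= b /\
  exists P, tagged_partition a x P /\ delta_fine delta P].
have Aa : A a by split; [rewrite lexx|exists nil; split => //; exact: Forall_nil].
have supA : has_sup A by split; [exists a|exists b => x [/andP[]]].
have as_ : a <= sup A by apply: ub_le_sup => //; case: supA.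
have sb : sup A <= b by apply: ge_sup; [exists a|move=> x [/andP[]]].
have ds : 0 < delta (sup A) by apply: dpos; rewrite as_.
have [x [/andP[ax xb] [P [tP fP]]] sx] := sup_adherent ds supA.
have xs : x <= sup A by apply: ub_le_sup; [case: supA|split; [rewrite ax|exists P]].
have key z : sup A <= z -> z <= b -> x < z -> z < sup A + delta (sup A) ->
    exists Q, tagged_partition a z Q /\ delta_fine delta Q.
  move=> sz zb xz zd; exists (P ++ [:: ((x, z), sup A)]); split.
    apply: tagged_partition_cat tP _; split => //; split; first exact/RltP.
    by split => //; split; exact/RleP.
  apply: delta_fine_cat fP _; apply: Forall_cons; last exact: Forall_nil.
  by split; apply/RltP.
have [E|sb'] := eqVneq (sup A) b.
  have [E'|xs'] := eqVneq x (sup A); first by exists P; rewrite -E -E'.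
  apply: key => //; first by rewrite lt_neqAle -E xs' xs.
  by rewrite -[ltLHS]E ltrDl.
have sltb : sup A < b by rewrite lt_neqAle sb' sb.
pose z := Num.min b (sup A + delta (sup A) / 2).
have sz : sup A < z by rewrite lt_min sltb/= ltrDl divr_gt0.
have Az : A z.
  split; first by rewrite (le_trans as_ (ltW sz))/= ge_min lexx.
  apply: key; [exact: ltW|by rewrite ge_min lexx|exact: le_lt_trans xs sz|].
  by rewrite gt_min ltrD2l; apply/orP; right; lra.
have : z <= sup A by apply: ub_le_sup => //; case: supA.
by rewrite leNgt sz.
Qed.

Lemma Henstock_integralP (f : R -> R) (a b A : R) :
  Henstock_integral f a b A <->
  forall e, 0 < e -> exists delta : R -> R,
    (forall t, a <= t <= b -> 0 < delta t) /\
    forall P, tagged_partition a b P -> delta_fine delta P ->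
      `|riemann_sum f P - A| < e.
Proof.
split=> H e /RltP e0; have [delta [dpos dP]] := H e e0; exists delta; split.
- by move=> t /andP[? ?]; apply/RltP; apply: dpos; split; exact/RleP.
- by move=> P tP fP; apply/RltP; exact: dP.
- by move=> t [/RleP at_ /RleP tb]; apply/RltP; apply: dpos; rewrite at_.
- by move=> P tP fP; apply/RltP; exact: dP.
Qed.

Lemma eq_riemann_sum (f g : R -> R) (a b : R) P :
  (forall t, a <= t <= b -> f t = g t) -> tagged_partition a b P ->
  riemann_sum f P = riemann_sum g P.
Proof.
move=> fg; elim: P a fg => [//|[[u z] t] P IH] a fg /= [-> [/RltP az [[/RleP at_ /RleP tz]]]] tP.
have zb := tagged_partition_le tP.
congr (_ * _ + _); first by rewrite fg// at_ (le_trans tz).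
by apply: (IH z) => // x /andP[zx xb]; rewrite fg// xb andbT (le_trans _ zx)// ltW.
Qed.

Lemma le_riemann_sum (f g : R -> R) (a b : R) P :
  (forall t, a <= t <= b -> f t <= g t) -> tagged_partition a b P ->
  riemann_sum f P <= riemann_sum g P.
Proof.
move=> fg; elim: P a fg => [//|[[u z] t] P IH] a fg /= [-> [/RltP az [[/RleP at_ /RleP tz]]]] tP.
have zb := tagged_partition_le tP.
rewrite !RplusE !RmultE !RminusE; apply: lerD.
  by rewrite ler_wpM2r ?subr_ge0 ?(ltW az)// fg// at_ (le_trans tz).
by apply: (IH z) => // x /andP[zx xb]; rewrite fg// xb andbT (le_trans _ zx)// ltW.
Qed.

Lemma riemann_sumZ (k : R) (f : R -> R) P :
  riemann_sum (fun t => k * f t) P = k * riemann_sum f P.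
Proof.
elim: P => [|[[u z] t] P IH] /=; first by rewrite mulr0.
by rewrite IH !RplusE !RmultE !RminusE; ring.
Qed.

Lemma riemann_sumDc (k : R) (f : R -> R) (a b : R) P : tagged_partition a b P ->
  riemann_sum (fun t => f t + k) P = riemann_sum f P + k * (b - a).
Proof.
elim: P a => [|[[u z] t] P IH] a /=; first by move=> ->; rewrite subrr mulr0 addr0.
move=> [-> [_ [_ /IH->]]]; rewrite !RplusE !RmultE !RminusE; ring.
Qed.

Lemma Henstock_ext (f g : R -> R) (a b A : R) :
  (forall t, a <= t <= b -> f t = g t) ->
  Henstock_integral f a b A -> Henstock_integral g a b A.
Proof.
move=> fg /Henstock_integralP H; apply/Henstock_integralP => e /H[d [dp dP]].
exists d; split => // P tP fP; rewrite -(eq_riemann_sum fg tP); exact: dP.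
Qed.

Lemma Henstock_unique (f : R -> R) (a b A B : R) : a <= b ->
  Henstock_integral f a b A -> Henstock_integral f a b B -> A = B.
Proof.
move=> ab /Henstock_integralP HA /Henstock_integralP HB.
apply/eqP; rewrite -subr_eq0 -normr_le0; apply/ler_addgt0Pr => e e0; rewrite add0r.
have e2 : 0 < e / 2 by lra.
have [d1 [dp1 dP1]] := HA _ e2; have [d2 [dp2 dP2]] := HB _ e2.
have [|P [tP fP]] := @cousin a b (fun t => Num.min (d1 t) (d2 t)) ab.
  by move=> t tab; rewrite lt_min dp1// dp2.
have h1 : `|riemann_sum f P - A| < e / 2.
  by apply: dP1 => //; apply: delta_fineW fP => t; rewrite ge_min lexx.
have h2 : `|riemann_sum f P - B| < e / 2.
  by apply: dP2 => //; apply: delta_fineW fP => t; rewrite ge_min lexx orbT.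
rewrite (_ : A - B = (riemann_sum f P - B) - (riemann_sum f P - A)); last by ring.
by rewrite (le_trans (ler_normB _ _))//; lra.
Qed.

Lemma HenstockZ (k : R) (f : R -> R) (a b A : R) :
  Henstock_integral f a b A -> Henstock_integral (fun t => k * f t) a b (k * A).
Proof.
move=> /Henstock_integralP H; apply/Henstock_integralP => e e0.
have k1 : 0 < `|k| + 1 by have := normr_ge0 k; lra.
have [d [dp dP]] := H (e / (`|k| + 1)) (divr_gt0 e0 k1).
exists d; split => // P tP fP; rewrite riemann_sumZ -mulrBr normrM.
have := dP P tP fP; rewrite ltr_pdivlMr// => h.
apply: le_lt_trans h; rewrite mulrC ler_wpM2l//; lra.
Qed.

Lemma le_Henstock (f g : R -> R) (a b A B : R) : a <= b ->
  (forall t, a <= t <= b -> f t <= g t) ->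
  Henstock_integral f a b A -> Henstock_integral g a b B -> A <= B.
Proof.
move=> ab fg /Henstock_integralP HA /Henstock_integralP HB.
apply/ler_addgt0Pr => e e0.
have e2 : 0 < e / 2 by lra.
have [d1 [dp1 dP1]] := HA _ e2; have [d2 [dp2 dP2]] := HB _ e2.
have [|P [tP fP]] := @cousin a b (fun t => Num.min (d1 t) (d2 t)) ab.
  by move=> t tab; rewrite lt_min dp1// dp2.
have : `|riemann_sum f P - A| < e / 2.
  by apply: dP1 => //; apply: delta_fineW fP => t; rewrite ge_min lexx.
have : `|riemann_sum g P - B| < e / 2.
  by apply: dP2 => //; apply: delta_fineW fP => t; rewrite ge_min lexx orbT.
have := le_riemann_sum fg tP.
rewrite !ltr_norml => ? /andP[? ?] /andP[? ?]; lra.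
Qed.

(* Lebesgue integrable functions are Henstock integrable *)
#[local] Hint Extern 0 (measurable [set` _]) => solve [exact: measurable_itv_LT] : core.

Lemma leb_itv (i : interval R) : leb [set` i] = lebesgue_measure [set` i].
Proof. by []. Qed.

Lemma leb_itvoc (a b : R) : a <= b -> leb `]a, b]%classic = (b - a)%:E.
Proof.
rewrite leb_itv lebesgue_measure_itv/= lte_fin le_eqVlt => /predU1P[->|->].
  by rewrite ltxx subrr.
by rewrite EFinB.
Qed.

Lemma leb_itvcc (a b : R) : a <= b -> leb `[a, b]%classic = (b - a)%:E.
Proof.
rewrite leb_itv lebesgue_measure_itv/= lte_fin le_eqVlt => /predU1P[->|->].
  by rewrite ltxx subrr.
by rewrite EFinB.
Qed.

(** Layer cake: the levels [k * eta] below [t] recover [t] up to one step [eta]. *)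
Lemma layer_sum_le (K : realFieldType) (t eta : K) n : 0 <= t -> 0 < eta ->
  \sum_(0 <= k < n) (if k%:R * eta < t then eta else 0) <= t + eta.
Proof.
move=> t0 e0; elim: n => [|n IH].
  by rewrite big_nil addr_ge0// ltW.
have Sn : \sum_(0 <= k < n) (if k%:R * eta < t then eta else 0) <= n%:R * eta.
  have -> : n%:R * eta = \sum_(0 <= k < n) eta by rewrite sumr_const_nat subn0 mulr_natl.
  by apply: ler_sum => k _; case: ifP => // _; exact: ltW.
rewrite big_nat_recr//=; case: ltP => h; rewrite ?addr0//.
by rewrite lerD2r (le_trans Sn)// ltW.
Qed.

Lemma layer_sum_ge (K : realFieldType) (t eta : K) n : 0 < eta -> t <= n%:R * eta ->
  t <= \sum_(0 <= k < n) (if k%:R * eta < t then eta else 0).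
Proof.
move=> e0; elim: n => [|n IH] tn; first by rewrite big_nil; rewrite mul0r in tn.
case: (ltP (n%:R * eta) t) => h; last first.
  apply: (le_trans (IH h)); rewrite big_nat_recr//= lerDl.
  by case: ifP => // _; exact: ltW.
apply: (le_trans tn); rewrite le_eqVlt; apply/orP; left; apply/eqP.
rewrite (eq_big_nat _ _ (F2 := fun=> eta)).
  by rewrite sumr_const_nat subn0 mulr_natl.
move=> k /andP[_ kn]; rewrite (_ : _ < _ = true)//.
apply: le_lt_trans h; apply: ler_wpM2r; first exact: ltW.
by rewrite ler_nat -ltnS.
Qed.

(* U is a sum of indicators of open supersets of the level sets of f; the gauge keeps
   each tagged interval inside the open sets containing its tag. *)
Lemma riemann_sum_le_integral (a b c : R) (f delta : R -> R) (U : LT -> \bar R) P :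
  measurable_fun setT U -> (forall x, 0 <= U x)%E ->
  (forall t x, a <= t <= b -> `|x - t| < delta t -> ((f t)%:E <= U x)%E) ->
  a <= c -> tagged_partition c b P -> delta_fine delta P ->
  ((riemann_sum f P)%:E <= \int[leb]_(x in `]c, b]) U x)%E.
Proof.
move=> mU U0 fU; elim: P c => [|[[u z] t] P IH] c ac /=.
  by move=> _ _; exact: integral_ge0.
move=> [-> [/RltP cz [[/RleP ct /RleP tz] tP]]] fP.
have [[/RltP h1 /RltP h2] fP'] : ((t - delta t < c)%coqR /\ (z < t + delta t)%coqR) /\ delta_fine delta P.
  by split; [exact: Forall_inv fP|exact: Forall_inv_tail fP].
have zb := tagged_partition_le tP.
rewrite RminusE RplusE in h1 h2.
have -> : `]c, b]%classic = `]c, z]%classic `|` `]z, b]%classic :> set LT.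
  apply/seteqP; split=> x /=; rewrite !in_itv/=.
    by move=> /andP[cx xb]; case: (leP x z) => xz; [left|right]; rewrite ?cx ?xb.
  case=> /andP[h h']; first by rewrite h (le_trans h').
  by rewrite h' (lt_trans cz).
have mI i : measurable ([set` i] : set LT) := measurable_itv_LT i.
rewrite ge0_integral_setU//; last 2 first.
- exact: measurable_funTS.
- rewrite disj_set2E; apply/eqP/seteqP; split=> x //= []; rewrite !in_itv/=.
  by move=> /andP[_ xz] /andP[/lt_le_trans/(_ xz)]; rewrite ltxx.
rewrite EFinD leeD//; last by apply: IH => //; rewrite (le_trans ac)// ltW.
rewrite RmultE RminusE EFinM -(leb_itvoc (ltW cz)) -integral_cst//.
have [ft0|ft0] := leP (f t) 0.
  rewrite (@le_trans _ _ 0%E)//; last by apply: integral_ge0.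
  by rewrite integral_cst// mule_le0_ge0.
apply: ge0_le_integral => //.
- by move=> x _; rewrite lee_fin ltW.
- exact: measurable_funTS.
move=> x /=; rewrite in_itv/= => /andP[cx xz]; apply: (fU t).
  by rewrite (le_trans ac)//= (le_trans tz).
by rewrite ltr_norml; apply/andP; split; lra.
Qed.

Lemma finite_ball_radius (G : nat -> set R) (t : R) n :
  (forall k, (k < n)%N -> open (G k)) ->
  exists d, 0 < d /\ forall k, (k < n)%N -> G k t ->
    forall x, `|x - t| < d -> G k x.
Proof.
elim: n => [|n IH] oG; first by exists 1; split.
have [|d [d0 dG]] := IH; first by move=> k kn; apply: oG; exact: ltnW.
have [d' [d'0 d'G]] : exists d', 0 < d' /\ (G n t -> forall x, `|x - t| < d' -> G n x).
  have [Gt|nGt] := pselect (G n t); last by exists 1; split.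
  have := oG n (ltnSn n); rewrite openE => /(_ t Gt) /nbhs_ballP[d' d'0 h].
  exists d'; split => // _ x xt; apply: h.
  by rewrite /ball/= distrC.
exists (Num.min d d'); split; first by rewrite lt_min d0.
move=> k; rewrite ltnS leq_eqVlt => /predU1P[->|kn] Gt x; rewrite lt_min => /andP[h h'].
  exact: d'G.
exact: dG kn Gt x h.
Qed.

Lemma ge0_integralZ_indic d (T : measurableType d) (K : realType)
    (m : {measure set T -> \bar K}) (D G : set T) (k : K) :
  measurable D -> measurable G -> 0 <= k ->
  (\int[m]_(x in D) (k * \1_G x)%:E = k%:E * m (G `&` D))%E.
Proof.
move=> mD mG k0; under eq_integral do rewrite EFinM.
rewrite ge0_integralZl_EFin ?integral_indic//.
by apply/measurable_EFinP; exact: measurable_indic.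
Qed.

(** Each [G k] exceeds its level set by at most [e / 2 ^ (k + 1) / eta]; weighted by [eta] these
    excesses sum to [e], while the layers of the level sets sum to at most [f + eta]. *)
Lemma integral_layer_cover d (T : measurableType d) (K : realType)
    (m : {measure set T -> \bar K}) (D : set T) (f : T -> K) (eta e : K)
    (G : nat -> set T) : measurable D -> (m D < +oo)%E ->
  m.-integrable D (EFin \o f) -> (forall x, D x -> 0 <= f x) ->
  0 < eta -> 0 <= e -> (forall k, measurable (G k)) ->
  (forall k, m (G k) <= m (D `&` [set x | (k%:R * eta < f x)%R]) +
     (e / (2 ^ k.+1)%:R / eta)%:E)%E ->
  (\int[m]_(x in D) (\sum_(0 <= k <oo) (eta * \1_(G k) x)%:E) <=
    (\int[m]_(x in D) f x + eta * fine (m D) + e)%:E)%E.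
Proof.
move=> mD Dfin intf f0 eta0 e0 mG Gk.
pose E k : set T := D `&` [set x | k%:R * eta < f x].
have mf : measurable_fun D f by apply/measurable_EFinP; exact: measurable_int intf.
have mE k : measurable (E k).
  rewrite (_ : E k = D `&` f @^-1` `]k%:R * eta, +oo[)//; first exact: mf.
  by apply/seteqP; split=> x [Dx] /=; rewrite in_itv/= andbT.
have etaE0 : (0 <= eta%:E)%E by rewrite lee_fin ltW.
have term0 (A : set T) x : (0 <= (eta * \1_A x)%:E)%E.
  by rewrite lee_fin mulr_ge0// ltW.
have mterm (A : set T) : measurable A -> 
    measurable_fun D (fun x => (eta * \1_A x)%:E : \bar K).
  by move=> mA; apply/measurable_EFinP; apply: measurable_funM => //; exact: measurable_indic.
rewrite integral_nneseries => [||k|k x _]; [|exact: mD|exact: mterm|exact: term0].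
apply: (@le_trans _ _ (\sum_(0 <= k <oo) (eta%:E * m (E k) + (e / (2 ^ k.+1)%:R)%:E))%E).
  apply: lee_nneseries => [k _ _|k _]; first by apply: integral_ge0 => x _; exact: term0.
  rewrite ge0_integralZ_indic ?(ltW eta0)//.
  apply: (@le_trans _ _ (eta%:E * (m (E k) + (e / (2 ^ k.+1)%:R / eta)%:E))%E).
    rewrite lee_pmul2l//; apply: le_trans (Gk k); apply: le_measure; rewrite ?inE//.
    exact: measurableI.
  rewrite ge0_muleDr//; last by rewrite lee_fin !divr_ge0// ltW.
  rewrite leeD2l// -EFinM lee_fin.
  by rewrite mulrCA divff ?mulr1// gt_eqF.
apply: (le_trans (epsilon_trick _ _ e0)).
  by move=> k; apply: mule_ge0.
have mDf : m D \is a fin_num by rewrite ge0_fin_numE.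
have -> : (\int[m]_(x in D) f x + eta * fine (m D) + e)%:E =
    (\int[m]_(x in D) (f x)%:E + (eta%:E * m D) + e%:E)%E.
  rewrite 2!EFinD EFinM (fineK mDf) /Rintegral (fineK (integrable_fin_num mD intf)).
  by [].
apply: leeD; last by [].
rewrite -integral_cst// -ge0_integralD//; last first.
  exact/measurable_EFinP.
have -> : (\sum_(0 <= k <oo) eta%:E * m (E k) =
    \int[m]_(x in D) \sum_(0 <= k <oo) (eta * \1_(E k) x)%:E)%E.
  rewrite integral_nneseries => [||k|k x _]; [|exact: mD|exact: mterm|exact: term0].
  apply: eq_eseriesr => k _.
  rewrite ge0_integralZ_indic ?(ltW eta0)//; congr (_ * m _)%E.
  by apply/seteqP; split=> x [].
apply: ge0_le_integral => //.
- by move=> x _; exact: nneseries_ge0.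
- by apply: ge0_emeasurable_sum => [//|k _]; exact: mterm.
- by apply: emeasurable_funD => //; exact/measurable_EFinP.
move=> x Dx; rewrite /cst -EFinD; apply: lime_le; first exact: is_cvg_nneseries.
near=> n; rewrite sumEFin lee_fin.
apply: (le_trans _ (@layer_sum_le _ (f x) eta n (f0 _ Dx) eta0)).
apply: ler_sum => k _; rewrite indicE.
case: (boolP (x \in E k)); rewrite ?(mulr1, mulr0).
  by rewrite inE => -[_ /= ->].
by move=> _; case: ifP => // _; exact: ltW.
Unshelve. all: by end_near. Qed.

Lemma henstock_upper_ge0 (a b : R) (f : R -> R) (e : R) : a <= b ->
  leb.-integrable `[a, b] (EFin \o f) -> (forall x, a <= x <= b -> 0 <= f x) -> 0 < e ->
  exists delta, (forall t, a <= t <= b -> 0 < delta t) /\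
    forall P, tagged_partition a b P -> delta_fine delta P ->
      riemann_sum f P <= \int[leb]_(x in `[a, b]) f x + e.
Proof.
move=> ab intf f0 e0; pose D : set LT := `[a, b]%classic.
have mD : measurable D by exact: measurable_itv_LT.
have ba : 0 < b - a + 1 by lra.
(* Dividing by [b - a + 1] covers the case [a = b] and still gives [eta * (b - a) <= e / 2]; the
   other [e / 2] pays for the open supersets. *)
pose eta := e / 2 / (b - a + 1).
have eta0 : 0 < eta by rewrite !divr_gt0.
pose E k : set LT := D `&` [set x | k%:R * eta < f x].
pose ek k := e / 2 / (2 ^ k.+1)%:R / eta.
have ek0 k : 0 < ek k by rewrite !divr_gt0// ltr0n expn_gt0.
have [G GP] := choice (fun k => outer_measure_open_le (E k) (ek0 k)).
have oG k : open (G k) by case: (GP k).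
have EG k : E k `<=` G k by case: (GP k).
have Gk k : (leb (G k) <= leb (E k) + (ek k)%:E)%E by case: (GP k).
have mG k : measurable (G k : set LT).
  by apply: borel_sub_LT; exact: open_measurable.
have /choice[delta dP] : forall t, exists d, D t -> 0 < d /\
    forall k, (k%:R * eta < f t) -> forall x, `|x - t| < d -> G k x.
  move=> t; have [Dt|nDt] := pselect (D t); last by exists 1.
  (* Only the levels [k < f t / eta] concern [t]; they are finite in number, so one radius serves
     them all. *)
  have [d [d0 dG]] := @finite_ball_radius G t (Num.bound (f t / eta)) (fun k _ => oG k).
  exists d => _; split => // k kf x; apply: dG; last by apply: EG; split.
  rewrite -(ltr_nat R); apply: (@lt_trans _ _ (f t / eta)).
    by rewrite ltr_pdivlMr.
  by apply: archi_boundP; rewrite divr_ge0 ?f0// ltW.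
exists delta; split; first by move=> t tab; have [] := dP t tab.
move=> P tP fP.
pose U (x : LT) := (\sum_(0 <= k <oo) (eta * \1_(G k) x)%:E)%E.
have term0 k x : (0 <= (eta * \1_(G k) x)%:E)%E by rewrite lee_fin mulr_ge0// ltW.
have mterm k : measurable_fun setT (fun x : LT => (eta * \1_(G k) x)%:E : \bar R).
  by apply/measurable_EFinP; apply: measurable_funM => //; exact: measurable_indic.
have mU : measurable_fun setT U by apply: ge0_emeasurable_sum.
have U0 x : (0 <= U x)%E by exact: nneseries_ge0.
have fU t x : a <= t <= b -> `|x - t| < delta t -> ((f t)%:E <= U x)%E.
  move=> tab xt; have [_ dG] := dP t tab.
  pose n := Num.bound (f t / eta).
  have fn : f t <= n%:R * eta.
    rewrite -ler_pdivrMr// ltW//; apply: archi_boundP.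
    by rewrite divr_ge0 ?f0// ltW.
  apply: (@le_trans _ _ (\sum_(0 <= k < n) (eta * \1_(G k) x)%:E)%E); last first.
    by apply: nneseries_lim_ge => k *; exact: term0.
  rewrite sumEFin lee_fin; apply: (le_trans (layer_sum_ge eta0 fn)).
  apply: ler_sum => k _; case: ifP => kf; last by rewrite mulr_ge0// ltW.
  by rewrite indicE mem_set ?mulr1//; exact: dG xt.
have main : (\int[leb]_(x in `]a, b]) U x <= (\int[leb]_(x in D) f x + e)%:E)%E.
  apply: (@le_trans _ _ (\int[leb]_(x in D) U x)%E).
    apply: ge0_subset_integral => //.
    - exact: measurable_funTS.
    - by apply: subset_itv; rewrite bnd_simp.
  apply: le_trans (integral_layer_cover mD _ intf _ eta0 _ mG Gk) _.
  - by rewrite [ltLHS](leb_itvcc ab) ltry.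
  - by move=> x; rewrite /D/= in_itv; exact: f0.
  - by rewrite divr_ge0// ltW.
  rewrite lee_fin [X in eta * X](congr1 fine (leb_itvcc ab)) /= -addrA lerD2l.
  have : eta * (b - a) <= e / 2.
    rewrite /eta -mulrA ler_piMr ?divr_ge0 ?(ltW e0)//.
    by rewrite mulrC ler_pdivrMr// mul1r lerDl.
  by lra.
rewrite -lee_fin; apply: le_trans main.
by apply: (riemann_sum_le_integral mU U0 fU) tP fP.
Qed.

Lemma dominated_Rintegral d (T : measurableType d) (K : realType)
    (m : {measure set T -> \bar K}) (D : set T) (fn : nat -> T -> K)
    (f g : T -> K) : measurable D ->
  (forall n, measurable_fun D (fn n)) ->
  measurable_fun D f ->
  (forall x, D x -> fn ^~ x @ \oo --> f x) ->
  m.-integrable D (EFin \o g) ->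
  (forall n x, D x -> `|fn n x| <= g x) ->
  forall e, 0 < e -> exists N, forall n, (N <= n)%N ->
    `|\int[m]_(x in D) fn n x - \int[m]_(x in D) f x| <= e.
Proof.
move=> mD mfn mf fnf intg fng e e0.
have fnf' : {ae m, forall x, D x ->
    ((fun n : nat => (fn n x)%:E : \bar K) @ \oo --> (f x)%:E)}.
  by apply/aeW => x Dx; apply: cvg_EFin; [exact: nearW|exact: fnf].
have fng' : {ae m, forall x (n : nat), D x -> (`|(fn n x)%:E| <= (EFin \o g) x)%E}.
  by apply/aeW => x n Dx; rewrite lee_fin; exact: fng.
have mfn' n : measurable_fun D (fun x => (fn n x)%:E) by exact/measurable_EFinP.
have mf' : measurable_fun D (EFin \o f) by exact/measurable_EFinP.
have [intf _ cv] := dominated_convergence mD mfn' mf' fnf' intg fng'.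
have {}cv : (fun n => \int[m]_(x in D) fn n x) @ \oo --> \int[m]_(x in D) f x.
  apply: fine_cvg; rewrite /Rintegral fineK; last exact: integrable_fin_num intf.
  exact: cv.
have [N _ NP] := (cvgr_dist_le _ _ cv) e e0.
exists N => n Nn; rewrite distrC; exact: NP.
Qed.

(** A function bounded below becomes nonnegative after adding a constant, which is why the
    truncation is from below. Applied to [-|f|], it truncates [|f|] from above. *)
Lemma truncation_Rintegral d (T : measurableType d) (K : realType)
    (m : {measure set T -> \bar K}) (D : set T) (f : T -> K) :
  measurable D -> m.-integrable D (EFin \o f) -> forall e, 0 < e ->
  exists n : nat, m.-integrable D (EFin \o (fun x => Num.max (f x) (- n%:R))) /\
    \int[m]_(x in D) Num.max (f x) (- n%:R) <= \int[m]_(x in D) f x + e.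
Proof.
move=> mD intf e e0.
have mf : measurable_fun D f by apply/measurable_EFinP; exact: measurable_int intf.
have mfn n : measurable_fun D (fun x => Num.max (f x) (- n%:R)).
  by apply: measurable_maxr.
have bnd (n : nat) x : `|Num.max (f x) (- n%:R)| <= `|f x|.
  case: (leP (f x) (- n%:R)) => // h; have n0 : 0 <= n%:R :> K by exact: ler0n.
  rewrite ler0_norm ?opprK; last by lra.
  by rewrite ler0_norm; lra.
have [|||||N NP] := @dominated_Rintegral _ _ _ m D (fun n x => Num.max (f x) (- n%:R)) f (fun x => `|f x|) mD _ _ _ _ _ e e0.
- exact: mfn.
- exact: mf.
- move=> x Dx; apply: cvg_near_cst; exists (Num.bound `|f x|) => // n /= h.
  rewrite /eqfun/=; apply/max_idPl; rewrite lerNl.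
  have := archi_boundP (normr_ge0 (f x)).
  rewrite -(ler_nat K) in h; have := ler_norm (- f x); rewrite normrN; lra.
- exact: integrable_norm.
- by [].
exists N; split; last by have := NP N (leqnn N); rewrite ler_norml => /andP[_]; lra.
apply: le_integrable intf => //; first exact/measurable_EFinP.
by move=> x _; rewrite /= lee_fin.
Qed.

Lemma leb_itvcc_lty (a b : R) : (leb `[a, b]%classic < +oo)%E.
Proof. exact: (@lout_itv_lty a b _ (fun x h => h)). Qed.

Lemma bounded_integrable_itv (a b M : R) (f : R -> R) :
  measurable_fun (`[a, b]%classic : set LT) f ->
  (forall x, a <= x <= b -> `|f x| <= M) ->
  leb.-integrable `[a, b] (EFin \o f).
Proof.
move=> mf fM; apply: measurable_bounded_integrable.
- exact: measurable_itv_LT.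
- exact: leb_itvcc_lty.
- exact: mf.
- exists M; split; first exact: num_real.
  move=> N MN x xab; rewrite /= (le_trans _ (ltW MN))// fM//.
Qed.

(** Riemann sums of [f] are below those of [max(f, -n)], and the shift by [n] adds [n * (b - a)] to
    sum and integral alike, so the nonnegative case applies. *)
Lemma henstock_upper (a b : R) (f : R -> R) (e : R) : a <= b ->
  leb.-integrable `[a, b] (EFin \o f) -> 0 < e ->
  exists delta, (forall t, a <= t <= b -> 0 < delta t) /\
    forall P, tagged_partition a b P -> delta_fine delta P ->
      riemann_sum f P <= \int[leb]_(x in `[a, b]) f x + e.
Proof.
move=> ab intf e0; have e2 : 0 < e / 2 by lra.
have mD : measurable (`[a, b]%classic : set LT) by [].
have [n [intg gle]] := truncation_Rintegral mD intf e2.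
have intn : leb.-integrable `[a, b] (EFin \o cst (n%:R : R)).
  by apply: (@bounded_integrable_itv a b n%:R) => // x _; rewrite /= normr_nat.
have intgn : leb.-integrable `[a, b] (EFin \o (fun x => Num.max (f x) (- n%:R) + n%:R)).
  exact: integrableD intg intn.
have [] := henstock_upper_ge0 ab intgn _ e2.
  by move=> x _; rewrite -lerBlDr sub0r le_max lexx orbT.
move=> delta [dp dP]; exists delta; split => // P tP fP.
have := dP P tP fP.
rewrite (riemann_sumDc n%:R (fun x => Num.max (f x) (- n%:R)) tP).
rewrite RintegralD// Rintegral_cst// [fine _](congr1 fine (leb_itvcc ab))/=.
have : riemann_sum f P <= riemann_sum (fun x => Num.max (f x) (- n%:R)) P.
  by apply: le_riemann_sum tP => t _; rewrite le_max lexx.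
move: gle; set I := (\int[_]_(x in _) _); set J := (\int[_]_(x in _) _).
set S := riemann_sum f P; set S' := riemann_sum _ P => gle h1 h2; clear -gle h1 h2 e2.
by lra.
Qed.

(** The upper estimate suffices: for [-f] it becomes the lower one. *)
Theorem Lebesgue_Henstock (a b : R) (f : R -> R) : a <= b ->
  leb.-integrable `[a, b] (EFin \o f) ->
  Henstock_integral f a b (\int[leb]_(x in `[a, b]) f x).
Proof.
move=> ab intf; apply/Henstock_integralP => e e0; have e2 : 0 < e / 2 by lra.
have [d1 [dp1 dP1]] := henstock_upper ab intf e2.
have intNf : leb.-integrable `[a, b] (EFin \o (fun x => -1 * f x)).
  by apply: (integrableZl _ (-1) intf).
have [d2 [dp2 dP2]] := henstock_upper ab intNf e2.
exists (fun t => Num.min (d1 t) (d2 t)); split => [t tab|P tP fP].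
  by rewrite lt_min dp1// dp2.
have h1 : riemann_sum f P <= \int[leb]_(x in `[a, b]) f x + e / 2.
  by apply: dP1 => //; apply: delta_fineW fP => t; rewrite ge_min lexx.
have : riemann_sum (fun x => -1 * f x) P <= \int[leb]_(x in `[a, b]) (-1 * f x) + e / 2.
  by apply: dP2 => //; apply: delta_fineW fP => t; rewrite ge_min lexx orbT.
have mD : measurable (`[a, b]%classic : set LT) by exact: measurable_itv_LT.
rewrite riemann_sumZ (RintegralZl _ mD intf).
move: h1; set I := (\int[_]_(x in _) _); set S := riemann_sum f P => h1 h2.
clear -h1 h2 e0.
by rewrite ltr_norml; apply/andP; split; lra.
Qed.

(** * From Henstock to Lebesgue integrability *)

Lemma ge0_integrable_truncations d (T : measurableType d) (K : realType)
    (m : {measure set T -> \bar K}) (D : set T) (f : T -> K) (A : K) :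
  measurable D -> measurable_fun D f -> (forall x, D x -> 0 <= f x) ->
  (forall n, \int[m]_(x in D) (Num.min (f x) n%:R)%:E <= A%:E)%E ->
  m.-integrable D (EFin \o f).
Proof.
move=> mD mf f0 bnd.
apply/integrableP; split; first exact/measurable_EFinP.
apply: (@le_lt_trans _ _ A%:E); last exact: ltry.
have mfn n : measurable_fun D (fun x => Num.min (f x) n%:R).
  by apply: measurable_minr.
have cv x : D x -> (fun n => (Num.min (f x) n%:R)%:E : \bar K) @ \oo --> (f x)%:E.
  move=> Dx; apply: cvg_near_cst; exists (Num.bound (f x)) => // n /= h.
  rewrite /eqfun/=; congr EFin; apply/min_idPl.
  have := archi_boundP (f0 _ Dx); rewrite -(ler_nat K) in h; lra.
have -> : (\int[m]_(x in D) `|(EFin \o f) x| =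
    \int[m]_(x in D) limn (fun n => (Num.min (f x) n%:R)%:E))%E.
  apply: eq_integral => x; rewrite inE => Dx; have /cvg_lim-> // := cv x Dx.
  by rewrite /= ger0_norm// f0.
rewrite monotone_convergence//.
- apply: lime_le; last by apply: nearW => n; exact: bnd.
  apply: ereal_nondecreasing_is_cvgn => n k nk; apply: ge0_le_integral => //.
  + by move=> x /f0 fx0; rewrite lee_fin le_min fx0 ler0n.
  + exact/measurable_EFinP.
  + exact/measurable_EFinP.
  + move=> x _; rewrite lee_fin le_min !ge_min lexx/=.
    by rewrite ler_nat nk orbT.
- by move=> n; exact/measurable_EFinP.
- by move=> n x /f0 fx0; rewrite lee_fin le_min fx0 ler0n.
- move=> x _ n k nk; rewrite lee_fin le_min !ge_min lexx/=.
  by rewrite ler_nat nk orbT.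
Qed.

(** The truncations [min(f, n)] are bounded, hence integrable in both senses with equal values, and
    these values are at most [A] by monotonicity of the Henstock integral; monotone convergence
    concludes. *)
Lemma Henstock_ge0_integrable (a b A : R) (f : R -> R) : a <= b ->
  measurable_fun (`[a, b]%classic : set LT) f ->
  (forall x, a <= x <= b -> 0 <= f x) -> Henstock_integral f a b A ->
  leb.-integrable `[a, b] (EFin \o f).
Proof.
move=> ab mf f0 HA; pose D : set LT := `[a, b]%classic.
have mD : measurable D by exact: measurable_itv_LT.
have Dab x : D x -> a <= x <= b by rewrite /D/= in_itv.
have mfn n : measurable_fun D (fun x => Num.min (f x) n%:R).
  by apply: measurable_minr.
have intn n : leb.-integrable D (EFin \o (fun x => Num.min (f x) n%:R)).
  apply: (@bounded_integrable_itv a b n%:R); first exact: mfn.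
  move=> x /f0 fx0; rewrite ger0_norm ?le_min ?fx0 ?ler0n//.
  by rewrite ge_min lexx orbT.
apply: (@ge0_integrable_truncations _ _ _ _ _ _ A) => // n.
rewrite -(fineK (integrable_fin_num mD (intn n))) lee_fin.
apply: le_Henstock ab _ (Lebesgue_Henstock ab (intn n)) HA => t tab.
by rewrite ge_min lexx.
Qed.

Lemma indicatorE (E : set R) t : indicator E t = \1_E t.
Proof.
rewrite /indicator indicE; case: excluded_middle_informative => h.
  by rewrite mem_set.
by rewrite memNset.
Qed.

(** The Henstock integral is not absolute; integrability over the sets where [f] is positive and
    nonpositive yields two functions of constant sign, to which the nonnegative case applies. *)
Lemma Henstock_indic_integrable (a b : R) (f : R -> R) : a <= b ->
  measurable_fun (`[a, b]%classic : set LT) f ->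
  (forall E, lebesgue_measurable a b E ->
    Henstock_integrable (fun t => f t * indicator E t) a b) ->
  leb.-integrable `[a, b] (EFin \o f).
Proof.
move=> ab mf Hf; pose D : set LT := `[a, b]%classic.
have mD : measurable D by exact: measurable_itv_LT.
pose E : set LT := D `&` f @^-1` `]0, +oo[%classic.
pose E' : set LT := D `&` f @^-1` `]-oo, 0]%classic.
have mE : measurable E by exact: mf.
have mE' : measurable E' by exact: mf.
have ED : lebesgue_measurable a b E by apply/lebesgue_measurableP; split => // x [].
have ED' : lebesgue_measurable a b E' by apply/lebesgue_measurableP; split => // x [].
have [A HA] := Hf _ ED; have [B HB] := Hf _ ED'.
have Df x : a <= x <= b -> D x by rewrite /D/= in_itv.
have int1 : leb.-integrable D (EFin \o (fun t => f t * \1_E t)).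
  apply: (@Henstock_ge0_integrable a b A); first exact: ab.
  - by apply: measurable_funM; [exact: mf|exact: measurable_indic].
  - move=> x _; rewrite indicE; case: (boolP (x \in E)); rewrite ?mulr0// inE => -[_].
    by rewrite /= in_itv/= andbT mulr1 => /ltW.
  - by apply: Henstock_ext HA => t _; rewrite indicatorE.
have int2 : leb.-integrable D (EFin \o (fun t => -1 * (f t * \1_E' t))).
  apply: (@Henstock_ge0_integrable a b (-1 * B)); first exact: ab.
  - apply: measurable_funM; first exact: measurable_cst.
    by apply: measurable_funM; [exact: mf|exact: measurable_indic].
  - move=> x _; rewrite indicE; case: (boolP (x \in E')); rewrite ?mulr0// inE => -[_].
    by rewrite /= in_itv/= mulr1 mulN1r oppr_ge0.
  - by apply: HenstockZ; apply: Henstock_ext HB => t _; rewrite indicatorE.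
apply: eq_integrable (integrableB mD int1 int2) => // x; rewrite inE => Dx /=.
rewrite -EFinB; congr EFin; rewrite !indicE.
have [h|h] := ltP 0 (f x).
  rewrite mem_set ?memNset; first by rewrite mulr1 mulr0 mulr0 subr0.
    by move=> [_]; rewrite /= in_itv/= leNgt h.
  by split => //; rewrite /= in_itv/= h.
rewrite memNset ?mem_set; first by rewrite mulr1 mulr0 mulN1r opprK add0r.
  by split => //; rewrite /= in_itv.
by move=> [_]; rewrite /= in_itv/= andbT ltNge h.
Qed.

(** * Henstock integrable functions are measurable *)

Lemma measurable_hull (A : set R) : exists G : set LT,
  [/\ measurable G, A `<=` G & leb G = lout A].
Proof.
have [G [oG AG GA]] := outer_measure_Gdelta A.
exists (\bigcap_i G i); split => //.
by apply: borel_sub_LT; apply: bigcapT_measurable => i; exact: open_measurable.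
Qed.

(** A set fills every measurable part of its hull: [M] splits both [A] and [G], the part of [A]
    outside [M] weighs no more than that of [G], and the totals agree. *)
Lemma hull_setI (A : set R) (G M : set LT) : measurable G -> measurable M ->
  A `<=` G -> leb G = lout A -> (lout A < +oo)%E -> M `<=` G ->
  lout (A `&` M) = leb M.
Proof.
move=> mG mM AG GA Afin MG; apply/eqP; rewrite eq_le; apply/andP; split.
  by apply: le_outer_measure => x [].
have mGM : measurable (G `\` M) by exact: measurableD.
have fGM : leb (G `\` M) \is a fin_num.
  rewrite ge0_fin_numE//; apply: le_lt_trans Afin; rewrite -GA.
  by apply: le_measure; rewrite ?inE// => x [].
have GE : leb G = (leb M + leb (G `\` M))%E.
  rewrite -measureU//; last by rewrite setDIK.
  by rewrite setDUK.
have AE : lout A = (lout (A `&` M) + lout (A `&` ~` M))%E by exact: mM.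
rewrite -(leeD2rE _ _ fGM) -GE GA AE leeD2l//.
by apply: le_outer_measure => x [Ax nMx]; split => //; exact: AG.
Qed.

(** Continuity from below for sets that need not be measurable, by passing to measurable hulls. *)
Lemma lout_nondecreasing_bigcup (a b : R) (E : nat -> set R) (e : R) :
  (forall n, E n `<=` `[a, b]%classic) -> nondecreasing_seq E -> 0 < e ->
  exists n, (lout (\bigcup_n E n) <= lout (E n) + e%:E)%E.
Proof.
move=> Eab ndE e0.
have [G /all_and3[mG EG GE]] := choice (fun n => measurable_hull (E n)).
pose D : set LT := `[a, b]%classic.
have mD : measurable D by exact: measurable_itv_LT.
(* Hulls of an increasing sequence need not increase; intersecting all later ones repairs this and
   still contains [E n], which lies in every later [E k]. *)
pose H n : set LT := \bigcap_(k in [set k | (n <= k)%N]) (D `&` G k).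
have mH n : measurable (H n).
  by apply: bigcap_measurable => [|k _]; [exists n => /=|exact: measurableI].
have HG n : H n `<=` G n by move=> x /(_ n (leqnn n))[].
have HD n : H n `<=` D by move=> x /(_ n (leqnn n))[].
have EH n : E n `<=` H n.
  move=> x Ex k /= nk; split; first exact: Eab Ex.
  by apply: EG; have /subsetPset := ndE _ _ nk; exact.
have ndH : nondecreasing_seq H.
  move=> n k nk; apply/subsetPset => x Hx j /= kj; apply: Hx => /=.
  exact: leq_trans kj.
have mUH : measurable (\bigcup_n H n) by exact: bigcupT_measurable.
have UHfin : leb (\bigcup_n H n) \is a fin_num.
  rewrite ge0_fin_numE; last exact: measure_ge0.
  by apply: (@lout_itv_lty a b) => x [n _ /HD].
have cv := nondecreasing_cvg_mu mH mUH ndH (mu := leb).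
apply: contrapT => /forallNP nE.
have : (leb (\bigcup_n H n) <= leb (\bigcup_n H n) - e%:E)%E.
  rewrite -[X in (X <= _)%E](cvg_lim _ cv)//; apply: lime_le.
    by apply/cvg_ex; exists (leb (\bigcup_n H n)).
  apply: nearW => n; rewrite leeBrDr//; apply: ltW.
  have := nE n; rewrite leNgt => /negP; rewrite negbK => /lt_le_trans.
  have h : (lout (\bigcup_n E n) <= leb (\bigcup_n H n))%E.
    by apply: le_outer_measure => x [k _ /EH Hx]; exists k.
  move=> /(_ _ h); apply: le_lt_trans; rewrite leeD2r//.
  by rewrite -GE; apply: le_measure; rewrite ?inE.
by rewrite leNgt lteBlDr// lteDl// lte_fin e0.
Qed.

(* On each cell of a grid of mesh less than r, P uses a tag in A and Q a tag in B when
   the cell meets both; V is the union of these cells, and WA, WB cover the others. *)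
Lemma Henstock_grid (a b r al be : R) (f delta : R -> R) (A B : set R) :
  (forall t, a <= t <= b -> 0 < delta t) -> 0 < r -> al <= be ->
  (forall t, A t -> be <= f t /\ r < delta t) ->
  (forall t, B t -> f t <= al /\ r < delta t) ->
  forall n c, a <= c -> c <= b -> b - c <= n%:R * r ->
  exists P Q (V WA WB : set LT) v, [/\
    [/\ tagged_partition c b P, delta_fine delta P,
       tagged_partition c b Q & delta_fine delta Q],
    [/\ measurable V, measurable WA & measurable WB],
    `[c, b]%classic `<=` V `|` WA `|` WB,
    WA `&` A = set0 /\ WB `&` B = set0 &
    (leb V <= v%:E)%E /\ (be - al) * v <= riemann_sum f P - riemann_sum f Q].
Proof.
move=> dpos r0 ab fA fB.
have base : exists P Q (V WA WB : set LT) v, [/\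
    [/\ tagged_partition b b P, delta_fine delta P,
       tagged_partition b b Q & delta_fine delta Q],
    [/\ measurable V, measurable WA & measurable WB],
    `[b, b]%classic `<=` V `|` WA `|` WB,
    WA `&` A = set0 /\ WB `&` B = set0 &
    (leb V <= v%:E)%E /\ (be - al) * v <= riemann_sum f P - riemann_sum f Q].
  exists nil, nil, `[b, b]%classic, set0, set0, 0; split.
  - by split => //; exact: Forall_nil.
  - by split => //; exact: measurable_itv_LT.
  - by move=> x; left; left.
  - by rewrite !set0I.
  - by rewrite leb_itvcc// subrr mulr0 /= subrr.
elim=> [|n IH] c ac cb bc.
  have -> : c = b by apply/eqP; rewrite eq_le cb/=; move: bc; rewrite mul0r; lra.
  exact: base.
have [->|cnb] := eqVneq c b; first exact: base.
pose z := Num.min b (c + r).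
have cz : c < z by rewrite lt_min lt_neqAle cnb cb/= ltrDl.
have zb : z <= b by rewrite ge_min lexx.
have zr : z <= c + r by rewrite ge_min lexx orbT.
have bz : b - z <= n%:R * r.
  rewrite /z; case: (leP b (c + r)) => _; first by rewrite subrr mulr_ge0// ltW.
  by move: bc; rewrite -natr1 mulrDl mul1r; lra.
have [P [Q [V [WA [WB [v [[tP fP tQ fQ] [mV mWA mWB] cov [WA0 WB0] [Vv vPQ]]]]]]]] :=
  IH z (le_trans ac (ltW cz)) zb bz.
have mI : measurable (`[c, z]%classic : set LT) by exact: measurable_itv_LT.
have covI (V' WA' WB' : set LT) : V `<=` V' -> WA `<=` WA' -> WB `<=` WB' ->
    `[c, z]%classic `<=` V' `|` WA' `|` WB' -> `[c, b]%classic `<=` V' `|` WA' `|` WB'.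
  move=> VV AA BB II x; rewrite /= in_itv/= => /andP[cx xb].
  have [xz|zx] := leP x z; first by apply: II; rewrite /= in_itv/= cx.
  have [|[/VV h|/AA h]|/BB h] := cov x; first by rewrite /= in_itv/= (ltW zx).
  - by left; left.
  - by left; right.
  - by right.
have [P1 [tP1 fP1]] : exists P1, tagged_partition c z P1 /\ delta_fine delta P1.
  apply: cousin (ltW cz) _ => t /andP[ct tz]; apply: dpos.
  by rewrite (le_trans ac ct) (le_trans tz).
have one t : r < delta t -> c <= t <= z -> t - delta t < c /\ z < t + delta t.
  by move=> rd /andP[ct tz]; split; lra.
have [[t [At tcz]]|nA] := pselect (exists t, A t /\ c <= t <= z).
  have [[t' [Bt tcz']]|nB] := pselect (exists t, B t /\ c <= t <= z).
    have [ft dt] := fA _ At; have [ft' dt'] := fB _ Bt.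
    exists ((c, z, t) :: P), ((c, z, t') :: Q), (`[c, z]%classic `|` V), WA, WB, ((z - c) + v).
    split.
    - split.
      + move: tcz => /andP[h h']; split => //; split; first exact/RltP.
        by split => //; split; exact/RleP.
      + have [h h'] := one _ dt tcz.
        by apply: Forall_cons => //; split; apply/RltP.
      + move: tcz' => /andP[h h']; split => //; split; first exact/RltP.
        by split => //; split; exact/RleP.
      + have [h h'] := one _ dt' tcz'.
        by apply: Forall_cons => //; split; apply/RltP.
    - by split => //; exact: measurableU.
    - by apply: covI; [exact: subsetUr|exact: subset_refl|exact: subset_refl|move=> x h; left; left; left].
    - by [].
    - split; first by rewrite (le_trans (measureU2 _ mI mV))// EFinD -(leb_itvcc (ltW cz)) leeD2l.
      rewrite /= !RplusE !RmultE RminusE mulrDr.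
      have : (be - al) * (z - c) <= (f t - f t') * (z - c).
        by rewrite ler_wpM2r//; lra.
      by lra.
  exists (P1 ++ P), (P1 ++ Q), V, WA, (`[c, z]%classic `|` WB), v; split.
  - split; [exact: tagged_partition_cat tP1 tP|exact: delta_fine_cat|
      exact: tagged_partition_cat tP1 tQ|exact: delta_fine_cat].
  - by split => //; exact: measurableU.
  - by apply: covI; [exact: subset_refl|exact: subset_refl|exact: subsetUr|move=> x h; right; left].
  - split => //; rewrite setIUl WB0 setU0; apply/seteqP; split=> x //= [].
    by rewrite in_itv/= => h Bx; apply: nB; exists x.
  - by split => //; rewrite !riemann_sum_cat; lra.
exists (P1 ++ P), (P1 ++ Q), V, (`[c, z]%classic `|` WA), WB, v; split.
- split; [exact: tagged_partition_cat tP1 tP|exact: delta_fine_cat|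
    exact: tagged_partition_cat tP1 tQ|exact: delta_fine_cat].
- by split => //; exact: measurableU.
- by apply: covI; [exact: subset_refl|exact: subsetUr|exact: subset_refl|move=> x h; left; right; left].
- split => //; rewrite setIUl WA0 setU0; apply/seteqP; split=> x //= [].
  by rewrite in_itv/= => h Ax; apply: nA; exists x.
- by split => //; rewrite !riemann_sum_cat; lra.
Qed.

(** On cells meeting both level sets, two Riemann sums can differ by [be - al] per unit length, so
    integrability forces these cells to be short in total. The other cells miss one of two sets of
    nearly full outer measure in [M], so together they take little of [M]. *)
Lemma Henstock_level_null (a b A al be : R) (f : R -> R) (M : set LT) : a <= b ->
  Henstock_integral f a b A -> al < be -> measurable M -> M `<=` `[a, b]%classic ->
  lout ([set t | be <= f t] `&` M) = leb M ->
  lout ([set t | f t <= al] `&` M) = leb M -> leb M = 0%E.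
Proof.
move=> ab /Henstock_integralP HA albe mM Mab MA MB.
have fM : leb M \is a fin_num.
  by rewrite ge0_fin_numE; [exact: lout_itv_lty Mab|exact: measure_ge0].
apply/eqP; rewrite eq_le; apply/andP; split; last exact: measure_ge0.
rewrite -(fineK fM) lee_fin; apply/ler_addgt0Pr => e e0; rewrite add0r.
have ba : 0 < be - al by lra.
(* Two fine sums then differ by at most [e * (be - al) / 2], which bounds the mixed cells by
   [e / 2]; the cells missing one level set get [e / 4] for each of the two sets. *)
have e1 : 0 < e * (be - al) / 4 by rewrite divr_gt0// mulr_gt0.
have [delta [dp dP]] := HA _ e1.
(* The gauge may have no positive lower bound. On [L S n] it exceeds [1 / (n + 1)], and these sets
   increase to the part of [S] in [M], so a uniform mesh works up to [e / 4]. *)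
pose L (S : set R) n := S `&` M `&` [set t | n.+1%:R^-1 < delta t].
have L_lim S : exists n, (lout (S `&` M) <= lout (L S n) + (e / 4)%:E)%E.
  have e4 : 0 < e / 4 by rewrite divr_gt0.
  have [||n nP] := @lout_nondecreasing_bigcup a b (L S) _ _ _ e4.
  - by move=> n x [[_ /Mab]].
  - move=> n k nk; apply/subsetPset => x [SMx /= nx]; split => //=.
    apply: le_lt_trans nx; rewrite lef_pV2 ?posrE ?ltr0n//.
    by rewrite ler_nat ltnS.
  exists n; apply: le_trans nP; apply: le_outer_measure => x [Sx Mx].
  have dx : 0 < delta x by apply: dp; have := Mab _ Mx; rewrite /= in_itv.
  have [k kd] : exists k : nat, k.+1%:R^-1 < delta x.
    exists (Num.bound (delta x)^-1).
    rewrite invf_plt ?posrE ?ltr0n//.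
    apply: lt_trans (archi_boundP _) _; first by rewrite invr_ge0 ltW.
    by rewrite ltr_nat.
  by exists k.
have [nA LA] := L_lim [set t | be <= f t].
have [nB LB] := L_lim [set t | f t <= al].
pose r := Num.min nA.+1%:R^-1 nB.+1%:R^-1 : R.
have r0 : 0 < r by rewrite lt_min !invr_gt0 !ltr0n.
have [|||P [Q [V [WA [WB [v [[tP fP tQ fQ] [mV mWA mWB] cov [WA0 WB0] [Vv vPQ]]]]]]]] :=
  @Henstock_grid a b r al be f delta (L [set t | be <= f t] nA) (L [set t | f t <= al] nB)
  dp r0 (ltW albe) _ _ (Num.bound ((b - a) / r)) a (lexx a) ab.
- move=> t [[bt _] /= dt]; split => //; apply: le_lt_trans dt.
  by rewrite ge_min lexx.
- move=> t [[bt _] /= dt]; split => //; apply: le_lt_trans dt.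
  by rewrite ge_min lexx orbT.
- by rewrite -ler_pdivrMr// ltW// archi_boundP// divr_ge0 ?subr_ge0// ltW.
have ve : v <= e / 2.
  have h1 := dP P tP fP; have h2 := dP Q tQ fQ.
  have : riemann_sum f P - riemann_sum f Q <= 2 * (e * (be - al) / 4).
    move: h1 h2; rewrite !ltr_norml; move=> /andP[_ h1] /andP[h2 _].
    by move: h1 h2; clear; move=> h1 h2; lra.
  move=> /(le_trans vPQ); rewrite mulrC => h.
  by rewrite -(ler_pM2r ba) (le_trans h)//; clear; lra.
have WM (W : set LT) S : measurable W -> W `&` S = set0 -> S `<=` M ->
    (leb M <= lout S + (e / 4)%:E)%E -> (leb (M `&` W) <= (e / 4)%:E)%E.
  move=> mW WS SM MS.
  have mMW : measurable (M `\` W) by exact: measurableD.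
  have mMIW : measurable (M `&` W) by exact: measurableI.
  have fMW : leb (M `\` W) \is a fin_num.
    rewrite ge0_fin_numE; last exact: measure_ge0.
    by apply: (@lout_itv_lty a b) => x [/Mab].
  rewrite -(leeD2rE _ _ fMW) (_ : leb (M `&` W) + _ = leb M)%E.
    apply: (le_trans MS); rewrite addeC leeD2l//.
    apply: le_outer_measure => x Sx; split; first exact: SM.
    by move=> Wx; have : (W `&` S) x by []; rewrite WS.
  rewrite -measureU//; first congr leb.
    apply/seteqP; split=> [x [[]|[]]//|x Mx].
    by case: (pselect (W x)) => h; [left|right].
  by apply/seteqP; split=> x // [[_ ?] []].
have hA := WM _ _ mWA WA0 _ _; have hB := WM _ _ mWB WB0 _ _.
have {}hA : (leb (M `&` WA) <= (e / 4)%:E)%E.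
  by apply: hA; [move=> x [[]]|rewrite -MA].
have {}hB : (leb (M `&` WB) <= (e / 4)%:E)%E.
  by apply: hB; [move=> x [[]]|rewrite -MB].
rewrite -lee_fin (fineK fM).
have mMWA : measurable (M `&` WA) by exact: measurableI.
have mMWB : measurable (M `&` WB) by exact: measurableI.
apply: (@le_trans _ _ (leb (V `|` (M `&` WA) `|` (M `&` WB)))).
  apply: le_outer_measure => x Mx.
  case: (cov x (Mab x Mx)) => [[?|?]|?]; [by left; left|by left; right|by right].
have mVW : measurable (V `|` (M `&` WA)) by exact: measurableU.
apply: (le_trans (measureU2 _ mVW mMWB)).
rewrite (_ : e%:E = (e / 2)%:E + (e / 4)%:E + (e / 4)%:E)%E; last first.
  by rewrite -!EFinD; congr EFin; field.
apply: leeD => //; apply: (le_trans (measureU2 _ mV mMWA)).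
by apply: leeD => //; apply: (le_trans Vv); rewrite lee_fin.
Qed.

(* Were {f > c} not measurable, measurable hulls of {c + 1/k <= f} and {f <= c} would
   overlap in a set of positive measure, for some k. *)
Theorem Henstock_measurable (a b A : R) (f : R -> R) : a <= b ->
  Henstock_integral f a b A -> measurable_fun (`[a, b]%classic : set LT) f.
Proof.
move=> ab HA; pose D : set LT := `[a, b]%classic.
have mD : measurable D by exact: measurable_itv_LT.
apply: (measurability _ (RGenOInfty.measurableE R)) => _ [_ [c ->] <-].
pose A_ (k : nat) : set R := D `&` [set t | c + k.+1%:R^-1 <= f t].
pose B : set R := D `&` [set t | f t <= c].
have [G /all_and3[mG AG GA]] := choice (fun k => measurable_hull (A_ k)).
have [GB [mGB BG GBE]] := measurable_hull B.
have Afin k : (lout (A_ k) < +oo)%E by apply: (@lout_itv_lty a b) => x [].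
have Bfin : (lout B < +oo)%E by apply: (@lout_itv_lty a b) => x [].
pose M k : set LT := D `&` (G k `&` GB).
have mM k : measurable (M k) by apply: measurableI => //; exact: measurableI.
have M0 k : leb (M k) = 0%E.
  apply: (@Henstock_level_null a b A c (c + k.+1%:R^-1) f) => //.
  - by rewrite ltrDl invr_gt0.
  - by move=> x [].
  - rewrite -(hull_setI (mG k) (mM k) (AG k) (GA k)) => [|//|x [_ []]//].
    by congr lout; apply/seteqP; split=> x [] => [? [? ?]|[? ?] ?].
  - rewrite -(hull_setI mGB (mM k) BG GBE) => [|//|x [_ []]//].
    by congr lout; apply/seteqP; split=> x [] => [? [? ?]|[? ?] ?].
pose U : set LT := D `&` \bigcup_k G k.
have mU : measurable U by apply: measurableI => //; exact: bigcupT_measurable.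
have nullUB : leb.-negligible (U `&` B).
  exists (\bigcup_k M k); split; first exact: bigcupT_measurable.
    apply/eqP; rewrite eq_le measure_ge0 andbT.
    apply: (@le_trans _ _ (\sum_(0 <= k <oo) leb (M k))%E).
      exact: outer_measure_sigma_subadditive.
    by rewrite eseries0// => k _ _; exact: M0.
  move=> x [[Dx [k _ Gx]] Bx]; exists k => //; split => //; split => //; exact: BG.
(* [U] and the set where [f] exceeds [c] differ only by a null set, which is measurable by
   completeness of [leb]. *)
have -> : D `&` f @^-1` `]c, +oo[%classic = U `\` (U `&` B).
  apply/seteqP; split=> x /=; rewrite in_itv/= andbT => -[].
    move=> Dx cf; split; last by move=> [_ [_ /=]]; rewrite leNgt cf.
    split => //.
    have fc : 0 < f x - c by rewrite subr_gt0.
    exists (Num.bound (f x - c)^-1) => //; apply: AG; split => //=.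
    rewrite -lerBrDl invf_ple ?posrE ?ltr0n//.
    apply: ltW; apply: lt_trans (archi_boundP _) _; first by rewrite invr_ge0 ltW.
    by rewrite ltr_nat.
  move=> Ux nB; split; first by case: Ux.
  by rewrite ltNge; apply/negP => fc; apply: nB; split => //; split => //; case: Ux.
apply: measurableD => //; exact: completed_lebesgue_measure_is_complete.
Qed.

(** * Functionals on bounded measurable functions *)

Section bounded_functionals.
Context d (T : measurableType d) (K : realType).
Context (m : {sigma_finite_measure set T -> \bar K}).
Implicit Types (D E : set T) (h w f : T -> K).

Definition bounded_mfun D h :=
  measurable_fun D h /\ exists B, forall x, D x -> `|h x| <= B.

Lemma bounded_mfun_indic D E : measurable E -> bounded_mfun D \1_E.
Proof.
move=> mE; split; first exact: measurable_indic.
by exists 1 => x _; rewrite indicE ger0_norm// lern1 leq_b1.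
Qed.

Lemma bounded_mfunD D f h : bounded_mfun D f -> bounded_mfun D h ->
  bounded_mfun D (fun x => f x + h x).
Proof.
move=> [mf [B fB]] [mh [C hC]]; split; first exact: measurable_funD.
by exists (B + C) => x Dx; rewrite (le_trans (ler_normD _ _))// lerD// ?fB// hC.
Qed.

Lemma bounded_mfunM D f h : bounded_mfun D f -> bounded_mfun D h ->
  bounded_mfun D (fun x => f x * h x).
Proof.
move=> [mf [B fB]] [mh [C hC]]; split; first exact: measurable_funM.
by exists (B * C) => x Dx; rewrite normrM ler_pM// ?fB// hC.
Qed.

Lemma bounded_mfun_cst D k : bounded_mfun D (fun=> k).
Proof. by split; [exact: measurable_cst|exists `|k|]. Qed.

Lemma bounded_mfunZ D k h : bounded_mfun D h -> bounded_mfun D (fun x => k * h x).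
Proof. by move=> bh; apply: bounded_mfunM => //; exact: bounded_mfun_cst. Qed.

Lemma integrable_bounded_mul D h w : measurable D -> bounded_mfun D h ->
  m.-integrable D (EFin \o w) -> m.-integrable D (EFin \o (fun x => h x * w x)).
Proof.
move=> mD [mh [B hB]] iw.
have := @integrableMr _ _ _ m D mD h (EFin \o w) mh _ iw; apply.
exists B; split; first exact: num_real.
by move=> N BN x Dx; rewrite /= (le_trans _ (ltW BN))// hB.
Qed.

Lemma le_normr_Rintegral_mul D h w B : measurable D -> measurable_fun D h ->
  (forall x, D x -> `|h x| <= B) -> m.-integrable D (EFin \o w) ->
  `|\int[m]_(x in D) (h x * w x)| <= B * \int[m]_(x in D) `|w x|.
Proof.
move=> mD mh hB iw.
have bh : bounded_mfun D h by split => //; exists B.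
have ihw := integrable_bounded_mul mD bh iw.
apply: (le_trans (le_normr_Rintegral mD ihw)).
rewrite -RintegralZl//; last exact: integrable_norm.
apply: le_Rintegral => //.
- exact: integrable_norm.
- exact: (integrableZl mD B (integrable_norm iw)).
- by move=> x Dx; rewrite normrM ler_wpM2r// hB.
Qed.

(* Lam is linear on bounded measurable functions, continuous for the sup norm,
   and small on indicators of sets of small measure. *)
Definition abs_continuous_functional D (Lam : (T -> K) -> K) :=
  [/\ forall f h, bounded_mfun D f -> bounded_mfun D h ->
        Lam (fun x => f x + h x) = Lam f + Lam h,
      forall k f, bounded_mfun D f -> Lam (fun x => k * f x) = k * Lam f,
      exists C, forall h B, measurable_fun D h -> (forall x, D x -> `|h x| <= B) ->
        `|Lam h| <= C * B &
      forall e, 0 < e -> exists del, 0 < del /\ forall E, measurable E ->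
        E `<=` D -> (m E <= del%:E)%E -> `|Lam \1_E| <= e].

(** Linearity makes [Lam] finitely additive on indicators; smallness on sets of small measure
    upgrades this to countable additivity, because the remainders of a disjoint union decrease to
    the empty set in finite measure. It also gives domination by [m], hence a Radon-Nikodym
    density. *)
Lemma abs_continuous_functional_density D Lam : measurable D -> (m D < +oo)%E ->
  abs_continuous_functional D Lam -> exists w, m.-integrable D (EFin \o w) /\
  forall E, measurable E -> E `<=` D -> Lam \1_E = \int[m]_(x in E) w x.
Proof.
move=> mD Dfin [Ladd Lhom [C Lbd] Lac].
have Lam0 : Lam (\1_set0) = 0.
  have := Lhom 0 \1_set0 (bounded_mfun_indic _ measurable0).
  rewrite mul0r => <-; congr Lam; apply/funext => x.
  by rewrite mul0r indicE memNset.
have LamU A B : measurable A -> measurable B -> A `&` B = set0 ->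
    Lam \1_(A `|` B) = Lam \1_A + Lam \1_B.
  move=> mA mB AB; rewrite -Ladd; [|exact: bounded_mfun_indic..].
  congr Lam; apply/funext => x; rewrite !indicE in_setU.
  case: (boolP (x \in A)) => xA; case: (boolP (x \in B)) => xB //=;
    rewrite ?addr0 ?add0r//.
  by have : (A `&` B) x; [split; exact/set_mem|rewrite AB].
pose nu (A : set T) : \bar K := (Lam \1_(A `&` D))%:E.
have nu0 : nu set0 = 0%E by rewrite /nu set0I Lam0.
have nufin A : measurable A -> nu A \is a fin_num by [].
have nusig : semi_sigma_additive nu.
  move=> F mF tF mUF; rewrite /nu.
  have mU n : measurable (\big[setU/set0]_(0 <= i < n) F i).
    by apply: bigsetU_measurable.
  have SE n : (\sum_(0 <= i < n) nu (F i) =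
      (Lam \1_((\big[setU/set0]_(0 <= i < n) F i) `&` D))%:E)%E.
    elim: n => [|n IH]; first by rewrite !big_nil set0I Lam0.
    rewrite !big_nat_recr//= IH setIUl LamU -?EFinD//.
    - exact: measurableI.
    - exact: measurableI.
    - have /trivIsetP tF' := tF; apply/seteqP; split=> x // [[Ux _] [Fx _]].
      move: Ux; rewrite big_mkord -bigcup_mkord => -[k /= kn Fkx].
      have := tF' k n I I; rewrite neq_ltn kn => /(_ erefl) FF.
      by have : (F k `&` F n) x by []; rewrite FF.
  under eq_fun do rewrite SE.
  apply: cvg_EFin; first exact: nearW.
  pose Rm n := (\bigcup_i F i `&` D) `\` (\big[setU/set0]_(0 <= i < n) F i).
  have mUFD : measurable (\bigcup_i F i `&` D) by exact: measurableI.
  have mRm n : measurable (Rm n) by exact: measurableD.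
  have RmE n : Lam \1_(\bigcup_i F i `&` D) =
      Lam \1_((\big[setU/set0]_(0 <= i < n) F i) `&` D) + Lam \1_(Rm n).
    rewrite -LamU//; last 2 first.
    - exact: measurableI.
    - by apply/seteqP; split=> x // [[Ux _] [_ nUx]].
    congr (Lam \1_ _); apply/seteqP; split=> x.
      move=> [Fx Dx]; case: (pselect ((\big[setU/set0]_(0 <= i < n) F i) x)) => h.
        by left.
      by right.
    case=> [[Ux Dx]|[]//]; split => //.
    by move: Ux; rewrite big_mkord -bigcup_mkord => -[k _ Fkx]; exists k.
  have cRm : m \o Rm @ \oo --> 0%E.
    rewrite -(measure0 m); have -> : set0 = \bigcap_n Rm n.
      apply/seteqP; split=> x // h.
      have [[[k _ Fkx] _] _] := h 0%N I.
      have [_ []] := h k.+1 I.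
      by rewrite big_mkord -bigcup_mkord; exists k => /=.
    apply: nonincreasing_cvg_mu => //.
    - apply: le_lt_trans Dfin; apply: le_measure; rewrite ?inE//.
      by move=> x [[]].
    - exact: bigcapT_measurable.
    - move=> n k nk; apply/subsetPset => x [h nU]; split => // Ux; apply: nU.
      move: Ux; rewrite !big_mkord -!bigcup_mkord => -[i /= im Fix].
      by exists i => //=; exact: leq_trans nk.
  apply/cvgrPdist_le => e e0; have [del [del0 Ldel]] := Lac e e0.
  have : \forall n \near \oo, (m (Rm n) <= del%:E)%E.
    have Rmf n : m (Rm n) \is a fin_num.
      rewrite ge0_fin_numE//; apply: le_lt_trans Dfin.
      by apply: le_measure; rewrite ?inE// => x [[]].
    have cF : (fun n => fine (m (Rm n))) @ \oo --> (0 : K) by exact: fine_cvg cRm.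
    move/cvgrPdist_le : cF => /(_ del del0).
    apply: filterS => n; rewrite sub0r normrN ger0_norm ?fine_ge0//.
    by rewrite -lee_fin fineK.
  apply: filterS => n mn; rewrite (RmE n) addrAC subrr add0r.
  by apply: Ldel => // x [[]].
pose nuC : {charge set T -> \bar K} := HB.pack nu (isCharge.Build _ _ _ nu nu0 nufin nusig).
have dom : nuC `<< m.
  apply/null_content_dominatesP => A mA mA0.
  rewrite /nuC/= /nu; congr EFin; apply/eqP; rewrite -normr_le0.
  apply/ler_addgt0Pr => e e0; rewrite add0r.
  have [del [del0 Ldel]] := Lac e e0; apply: Ldel; first exact: measurableI.
    by move=> x [].
  have mAD : measurable (A `&` D) by exact: measurableI.
  apply: (@le_trans _ _ (m A)); first by apply: le_measure; rewrite ?inE.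
  by rewrite mA0 lee_fin ltW.
pose f := Radon_Nikodym nuC m; have intf : m.-integrable setT f by exact: Radon_Nikodym_integrable.
have ff x : (fine (f x))%:E = f x by rewrite fineK// Radon_Nikodym_fin_num.
exists (fine \o f); split.
  apply: eq_integrable (integrableS measurableT mD (@subsetT _ D) intf) => // x _.
  by rewrite /= ff.
move=> E mE ED; have : (nuC E = \int[m]_(x in E) f x)%E by exact: Radon_Nikodym_integral.
rewrite /nuC/= /nu setIidl// => h.
rewrite /Rintegral; under eq_integral do rewrite /= ff.
by rewrite -h.
Qed.

(** Layer sums approximate [h] uniformly within [eta], and both sides are continuous for the sup
    norm. *)
Lemma abs_continuous_functional_ge0 D Lam w : measurable D -> (m D < +oo)%E ->
  abs_continuous_functional D Lam -> m.-integrable D (EFin \o w) ->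
  (forall E, measurable E -> E `<=` D -> Lam \1_E = \int[m]_(x in E) w x) ->
  forall h, bounded_mfun D h -> (forall x, D x -> 0 <= h x) ->
  Lam h = \int[m]_(x in D) (h x * w x).
Proof.
move=> mD Dfin [Ladd Lhom [C Lbd] _] iw LE h bh h0.
have [mh [B hB]] := bh.
apply/eqP; rewrite -subr_eq0 -normr_le0; apply/ler_addgt0Pr => e e0; rewrite add0r.
pose W := \int[m]_(x in D) `|w x|.
have W0 : 0 <= W by apply: Rintegral_ge0.
have CW : 0 < `|C| + W + 1 by rewrite addrC ltr_wpDr ?addr_ge0.
(* The errors are at most [C * eta] for [Lam] and [W * eta] for the integral; the added 1 keeps the
   denominator positive. *)
pose eta := e / (`|C| + W + 1).
have eta0 : 0 < eta by rewrite divr_gt0.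
pose E k := D `&` [set x | k%:R * eta < h x].
have mE k : measurable (E k).
  rewrite (_ : E k = D `&` h @^-1` `]k%:R * eta, +oo[)//; first exact: mh.
  by apply/seteqP; split=> x [Dx] /=; rewrite in_itv/= andbT.
pose hn n x := \sum_(0 <= k < n) eta * \1_(E k) x.
have bhn n : bounded_mfun D (hn n).
  elim: n => [|n IH].
    rewrite (_ : hn 0%N = fun=> 0); first exact: bounded_mfun_cst.
    by apply/funext => x; rewrite /hn big_nil.
  rewrite (_ : hn n.+1 = fun x => hn n x + eta * \1_(E n) x).
    by apply: bounded_mfunD => //; apply: bounded_mfunZ; exact: bounded_mfun_indic.
  by apply/funext => x; rewrite /hn big_nat_recr.
have bE k : bounded_mfun D (fun x => eta * \1_(E k) x).
  by apply: bounded_mfunZ; exact: bounded_mfun_indic.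
have Lhn n : Lam (hn n) = \int[m]_(x in D) (hn n x * w x).
  elim: n => [|n IH].
    have -> : hn 0%N = fun x => 0 * \1_set0 x.
      by apply/funext => x; rewrite /hn big_nil mul0r.
    rewrite Lhom; last exact: bounded_mfun_indic.
    rewrite mul0r; under eq_Rintegral do rewrite !mul0r.
    by rewrite Rintegral_cst// mul0r.
  have -> : hn n.+1 = fun x => hn n x + eta * \1_(E n) x.
    by apply/funext => x; rewrite /hn big_nat_recr.
  rewrite Ladd// Lhom; last exact: bounded_mfun_indic.
  under eq_Rintegral do rewrite mulrDl.
  rewrite RintegralD//; last 2 first.
  - exact: integrable_bounded_mul.
  - exact: integrable_bounded_mul.
  rewrite IH; congr +%R; rewrite LE//; last by move=> x [].
  under [in RHS]eq_Rintegral do rewrite -mulrA.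
  rewrite RintegralZl//; last first.
    by apply: integrable_bounded_mul => //; exact: bounded_mfun_indic.
  congr *%R; rewrite -{1}(setIidr (_ : E n `<=` D)); last by move=> x [].
  rewrite Rintegral_mkcondr; apply: eq_Rintegral => x xD.
  by rewrite patchE indicE; case: ifPn => _; rewrite ?mul1r ?mul0r.
pose n := Num.bound (B / eta).
have hnh x : D x -> `|h x - hn n x| <= eta.
  move=> Dx.
  have -> : hn n x = \sum_(0 <= k < n) (if k%:R * eta < h x then eta else 0).
    apply: eq_bigr => k _; rewrite indicE.
    case: ifPn => kh; first by rewrite mem_set ?mulr1.
    by rewrite memNset ?mulr0// => -[_ /=]; rewrite (negbTE kh).
  have hB' := le_trans (ler_norm _) (hB x Dx).
  have B0 := le_trans (normr_ge0 _) (hB x Dx).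
  have hn_ : h x <= n%:R * eta.
    rewrite (le_trans hB')// -ler_pdivrMr// ltW// archi_boundP// divr_ge0//.
    exact: ltW.
  have := layer_sum_ge eta0 hn_; have := @layer_sum_le _ _ _ n (h0 x Dx) eta0.
  set s := \sum_(_ <= _ < _) _ => s1 s2.
  by rewrite ler0_norm; lra.
have bNhn : bounded_mfun D (fun x => -1 * hn n x) by exact: bounded_mfunZ.
have bd : bounded_mfun D (fun x => h x + -1 * hn n x) by exact: bounded_mfunD.
have -> : Lam h - \int[m]_(x in D) (h x * w x) =
   Lam (fun x => h x + -1 * hn n x) - \int[m]_(x in D) ((h x + -1 * hn n x) * w x).
  rewrite Ladd// Lhom//.
  under [in RHS]eq_Rintegral do rewrite mulrDl.
  rewrite RintegralD//; last 2 first.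
  - exact: integrable_bounded_mul.
  - exact: integrable_bounded_mul.
  under [X in _ - (_ + X)]eq_Rintegral do rewrite -mulrA.
  rewrite RintegralZl//; last exact: integrable_bounded_mul.
  by rewrite Lhn; ring.
have dB x : D x -> `|h x + -1 * hn n x| <= eta.
  by move=> Dx; rewrite mulN1r; exact: hnh.
have := Lbd _ _ (proj1 bd) dB.
have := le_normr_Rintegral_mul mD (proj1 bd) dB iw; rewrite -/W => h1 h2.
apply: (le_trans (ler_normB _ _)); apply: (le_trans (lerD h2 h1)).
have : C * eta <= `|C| * eta by rewrite ler_wpM2r ?ler_norm// ltW.
have : `|C| * eta + eta * W + eta = e.
  by rewrite /eta; field; rewrite gt_eqF.
by lra.
Qed.

(** Adding the constant [|B|] makes a function bounded by [B] nonnegative, and the constant is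
    nonnegative too. *)
Theorem abs_continuous_functional_repr D Lam : measurable D -> (m D < +oo)%E ->
  abs_continuous_functional D Lam -> exists w, m.-integrable D (EFin \o w) /\
  forall h, bounded_mfun D h -> Lam h = \int[m]_(x in D) (h x * w x).
Proof.
move=> mD Dfin LamD; have [w [iw LE]] := abs_continuous_functional_density mD Dfin LamD.
exists w; split => // h bh; have [mh [B hB]] := bh.
have pos := abs_continuous_functional_ge0 mD Dfin LamD iw LE.
have [Ladd Lhom _ _] := LamD.
have bB := bounded_mfun_cst D `|B|.
have bB' : bounded_mfun D (fun=> -1 * `|B|) by exact: bounded_mfun_cst.
have bhB := bounded_mfunD bh bB.
have -> : h = fun x => (h x + `|B|) + -1 * `|B|.
  by apply/funext => x; rewrite mulN1r addrK.
rewrite Ladd// Lhom// pos//; last first.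
  move=> x Dx; have := hB x Dx; rewrite ler_norml => /andP[h1 _].
  by have := ler_norm B; lra.
rewrite (pos (fun=> `|B|))//.
under [in RHS]eq_Rintegral do rewrite mulrDl.
rewrite RintegralD//; last 2 first.
- exact: integrable_bounded_mul.
- exact: integrable_bounded_mul.
congr +%R; under [in RHS]eq_Rintegral do rewrite -mulrA.
by rewrite [in RHS]RintegralZl//; exact: (integrable_bounded_mul mD bB iw).
Qed.

End bounded_functionals.

(** * Uniform countable additivity and uniform absolute continuity *)

Section uniform_integrability.
Context d (T : measurableType d) (K : realType).
Context (m : {measure set T -> \bar K}).
Implicit Types (D E A B : set T) (f : T -> K) (S : set (T -> K)).

Lemma le_Rintegral_subset A B f : measurable A -> measurable B -> A `<=` B ->
  m.-integrable B (EFin \o f) -> (forall x, B x -> 0 <= f x) ->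
  \int[m]_(x in A) f x <= \int[m]_(x in B) f x.
Proof.
move=> mA mB AB intf f0; apply: fine_le.
- by apply: integrable_fin_num => //; exact: integrableS intf.
- exact: integrable_fin_num.
- apply: ge0_subset_integral => //; exact: measurable_int intf.
Qed.

Lemma Rintegral_setD A B f : measurable A -> measurable B ->
  m.-integrable A (EFin \o f) ->
  \int[m]_(x in A) f x = \int[m]_(x in A `&` B) f x + \int[m]_(x in A `\` B) f x.
Proof.
move=> mA mB intf.
have mAB : measurable (A `&` B) by exact: measurableI.
have mADB : measurable (A `\` B) by exact: measurableD.
have AE : A = (A `&` B) `|` (A `\` B).
  by apply/seteqP; split=> [x Ax|x [[]|[]]//]; case: (pselect (B x)); [left|right].
rewrite {1}AE Rintegral_setU//; first by rewrite -AE.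
by rewrite disj_set2E; apply/eqP/seteqP; split=> x // [[_ ?] []].
Qed.

(** [|f|] is its excess over a level [n], of small integral by truncation, plus a part bounded by
    [n], whose integral is at most [n * m E]. *)
Lemma integral_abs_continuous D f : measurable D -> m.-integrable D (EFin \o f) ->
  forall e, 0 < e -> exists del, 0 < del /\ forall E, measurable E -> E `<=` D ->
    (m E <= del%:E)%E -> \int[m]_(x in E) `|f x| <= e.
Proof.
move=> mD intf e e0; have e2 : 0 < e / 2 by rewrite divr_gt0.
have intNf : m.-integrable D (EFin \o (fun x => -1 * `|f x|)).
  exact: (integrableZl mD (-1) (integrable_norm intf)).
have [n [intn]] := truncation_Rintegral mD intNf e2.
rewrite RintegralZl//; last exact: integrable_norm.
(* [g] is minus the minimum of [|f|] and [n], so [|f| + g] is the excess of [|f|] over [n]. *)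
set g := fun x => Num.max (-1 * `|f x|) (- n%:R) => gle.
have g0 x : 0 <= `|f x| + g x by rewrite -lerBlDl sub0r le_max mulN1r lexx.
have gn x : `|f x| <= (`|f x| + g x) + n%:R.
  by rewrite -lerBlDl opprD addrA subrr add0r lerNl /g le_max lexx orbT.
have intg : m.-integrable D (EFin \o (fun x => `|f x| + g x)).
  exact: (integrableD mD (integrable_norm intf) intn).
exists (e / 2 / (n%:R + 1)); split; first by rewrite divr_gt0// ltr_wpDl.
move=> E mE ED mEd.
have intfE : m.-integrable E (EFin \o (fun x => `|f x|)).
  by apply: integrableS mD mE ED _; exact: integrable_norm.
have Efin : (m E < +oo)%E by apply: le_lt_trans mEd _; exact: ltry.
have intc : m.-integrable E (EFin \o (cst (n%:R : K))).
  apply: measurable_bounded_integrable => //.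
  by exists n%:R; split; [exact: num_real|move=> M nM x _; rewrite /= normr_nat ltW].
have intgE : m.-integrable E (EFin \o (fun x => `|f x| + g x)).
  exact: integrableS intg.
apply: (@le_trans _ _ (\int[m]_(x in E) (`|f x| + g x + n%:R))).
  by apply: le_Rintegral => //; exact: (integrableD mE intgE intc).
rewrite RintegralD// Rintegral_cst//.
have h1 : \int[m]_(x in E) (`|f x| + g x) <= e / 2.
  apply: (@le_trans _ _ (\int[m]_(x in D) (`|f x| + g x))).
    by apply: le_Rintegral_subset.
  rewrite RintegralD//; last exact: integrable_norm.
  by lra.
have h2 : n%:R * fine (m E) <= e / 2.
  have Ef : m E \is a fin_num by rewrite ge0_fin_numE.
  have {}mEd : fine (m E) <= e / 2 / (n%:R + 1) by rewrite -lee_fin fineK.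
  apply: (@le_trans _ _ (n%:R * (e / 2 / (n%:R + 1)))); first by rewrite ler_wpM2l.
  rewrite mulrA ler_pdivrMr; last by rewrite ltr_wpDl.
  by rewrite mulrC ler_pM2l// lerDl.
by lra.
Qed.

(** The positive and the nonpositive set share the integral of [|f|], so one of them carries at
    least half. *)
Lemma exists_signed_part E f : measurable E -> m.-integrable E (EFin \o f) ->
  exists G, [/\ measurable G, G `<=` E &
    \int[m]_(x in E) `|f x| <= 2 * `|\int[m]_(x in G) f x|].
Proof.
move=> mE intf; have mf : measurable_fun E f by apply/measurable_EFinP; exact: measurable_int intf.
pose P := E `&` f @^-1` `]0, +oo[%classic.
pose N := E `\` P.
have mP : measurable P by exact: mf.
have mN : measurable N by exact: measurableD.
have PE : P `<=` E by move=> x [].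
have NE : N `<=` E by move=> x [].
have intP := integrableS mE mP PE intf; have intN := integrableS mE mN NE intf.
have EPN : \int[m]_(x in E) `|f x| = \int[m]_(x in P) f x - \int[m]_(x in N) f x.
  rewrite (Rintegral_setD mE mP (integrable_norm intf)) (setIidr PE) -/N.
  congr +%R.
    apply: eq_Rintegral => x; rewrite inE => -[_] /=; rewrite in_itv/= andbT => h.
    by rewrite gtr0_norm.
  rewrite -[RHS]mulN1r -RintegralZl//; apply: eq_Rintegral => x; rewrite inE => -[Ex nP].
  rewrite /= ler0_norm ?mulN1r// leNgt; apply/negP => fx; apply: nP; split => //=.
  by rewrite in_itv/= fx.
have [h|h] := leP `|\int[m]_(x in N) f x| `|\int[m]_(x in P) f x|.
  exists P; split => //; rewrite EPN.
  have := ler_norm (\int[m]_(x in P) f x); have := ler_norm (- \int[m]_(x in N) f x).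
  by rewrite normrN; lra.
exists N; split => //; rewrite EPN.
have := ler_norm (\int[m]_(x in P) f x); have := ler_norm (- \int[m]_(x in N) f x).
by rewrite normrN; lra.
Qed.

(** The sum has [N.+1] terms to match [sum_f_R0]. *)
Definition uniformly_countably_additive D S :=
  forall F : nat -> set T, (forall n, measurable (F n)) -> (forall n, F n `<=` D) ->
  trivIset setT F -> forall e, 0 < e -> exists N0, forall N, (N0 <= N)%N ->
  forall s, S s ->
  `|\sum_(0 <= n < N.+1) \int[m]_(x in F n) s x - \int[m]_(x in \bigcup_n F n) s x| <= e.

Definition uniformly_abs_continuous D S :=
  forall e, 0 < e -> exists del, 0 < del /\ forall s, S s ->
  forall E, measurable E -> E `<=` D -> (m E <= del%:E)%E ->
  \int[m]_(x in E) `|s x| <= e.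

(* If uniform absolute continuity failed along sets E n of measure 2^-n and
   functions s n, then peeling off the tails of the E n along a subsequence would
   give disjoint sets G k on which the integrals of s (j k) do not tend to 0. *)
Theorem countably_additive_abs_continuous D S : measurable D ->
  (forall s, S s -> m.-integrable D (EFin \o s)) ->
  uniformly_countably_additive D S -> uniformly_abs_continuous D S.
Proof.
move=> mD intS uca e e0; apply: contrapT => nac.
have {nac} /choice[sE sEP] : forall n : nat, exists sE : (T -> K) * set T,
    [/\ S sE.1, measurable sE.2, sE.2 `<=` D, (m sE.2 <= (1 / (2 ^ n.+1)%:R)%:E)%E &
      e < \int[m]_(x in sE.2) `|sE.1 x|].
  move=> n; apply: contrapT => nP; apply: nac; exists (1 / (2 ^ n.+1)%:R); split.
    by rewrite divr_gt0// ltr0n expn_gt0.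
  move=> s Ss E mE ED mEn; rewrite leNgt; apply/negP => h; apply: nP.
  by exists (s, E).
pose s n := (sE n).1; pose E n := (sE n).2.
have Ss n : S (s n) by case: (sEP n).
have mE n : measurable (E n) by case: (sEP n).
have ED n : E n `<=` D by case: (sEP n).
(* The bounds [2^-(n+1)] on the measures of the [E n] sum to [2^-n] on this tail. *)
pose F n := \bigcup_k E (n + k)%N.
have mF n : measurable (F n) by exact: bigcupT_measurable.
have FD n : F n `<=` D by move=> x [k _ /ED].
have mFn n : (m (F n) <= (1 / (2 ^ n)%:R)%:E)%E.
  apply: (le_trans (measure_sigma_subadditive _ (fun k => mE (n + k)%N) (mF n) (@subset_refl _ _))).
  apply: (@le_trans _ _ (\sum_(0 <= k <oo) ((1 / (2 ^ n)%:R) / (2 ^ k.+1)%:R)%:E)%E).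
    apply: lee_nneseries => [k _ _|k _]; first exact: measure_ge0.
    have [_ _ _ h _] := sEP (n + k)%N; apply: (le_trans h).
    rewrite lee_fin -addnS expnD natrM -mulrA -invfM.
    by rewrite [X in _ / X]mulrC.
  by apply: epsilon_trick0; rewrite divr_ge0.
(* A single function is absolutely continuous, so a far enough tail [F n'] takes at most [e / 2]
   from [s n]; the part of [E n] outside it keeps at least [e / 2]. *)
have /choice[nxt nxtP] : forall n, exists n', (n < n')%N /\
    \int[m]_(x in F n') `|s n x| <= e / 2.
  move=> n; have e2 : 0 < e / 2 by rewrite divr_gt0.
  have [del [del0 ac]] := integral_abs_continuous mD (intS _ (Ss n)) e2.
  pose k := (n + Num.bound del^-1).+1.
  exists k; split; first by rewrite /k ltnS leq_addr.
  apply: ac => //; apply: (le_trans (mFn k)); rewrite lee_fin mul1r.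
  rewrite invf_ple ?posrE// ?ltr0n ?expn_gt0//.
  apply: (le_trans (ltW (archi_boundP _))); first by rewrite invr_ge0 ltW.
  rewrite ler_nat; apply: (@leq_trans k); last exact/ltnW/ltn_expl.
  by rewrite /k leqW// leq_addl.
pose j k := iter k nxt 0%N.
have jS k : (j k < j k.+1)%N by case: (nxtP (j k)).
have jmono i k : (i <= k)%N -> (j i <= j k)%N.
  move=> /subnK <-; elim: (k - i)%N => [//|n IH]; rewrite addSn.
  exact: leq_trans (ltnW (jS _)).
pose Dk k := E (j k) `\` F (j k.+1).
have mDk k : measurable (Dk k) by exact: measurableD.
have DkD k : Dk k `<=` D by move=> x [/ED].
have intk k : m.-integrable (Dk k) (EFin \o s (j k)).
  exact: integrableS (intS _ (Ss _)).
have big k : e / 2 <= \int[m]_(x in Dk k) `|s (j k) x|.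
  have intE : m.-integrable (E (j k)) (EFin \o (fun x => `|s (j k) x|)).
    by apply: integrable_norm; exact: integrableS (intS _ (Ss _)).
  have intF : m.-integrable (F (j k.+1)) (EFin \o (fun x => `|s (j k) x|)).
    by apply: integrable_norm; exact: integrableS (intS _ (Ss _)).
  have [_ _ _ _] := sEP (j k); rewrite -/(s _) -/(E _).
  rewrite (Rintegral_setD (mE _) (mF (j k.+1)) intE) -/(Dk k) => h.
  have [_ h2] := nxtP (j k); rewrite -/(j k.+1) in h2.
  have : \int[m]_(x in E (j k) `&` F (j k.+1)) `|s (j k) x| <=
      \int[m]_(x in F (j k.+1)) `|s (j k) x|.
    by apply: le_Rintegral_subset => //; exact: measurableI.
  by lra.
have /choice[G GP] : forall k, exists G, [/\ measurable G, G `<=` Dk k &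
    \int[m]_(x in Dk k) `|s (j k) x| <= 2 * `|\int[m]_(x in G) s (j k) x|].
  by move=> k; exact: exists_signed_part.
have mG k : measurable (G k) by case: (GP k).
have GDk k : G k `<=` Dk k by case: (GP k).
have GD k : G k `<=` D by move=> x /GDk/DkD.
have tG : trivIset setT G.
  have lt i k : (i < k)%N -> G i `&` G k = set0.
    move=> ik; apply/seteqP; split=> x // [/GDk[_ nF] /GDk[Ex _]]; apply: nF.
    by exists (j k - j i.+1)%N; rewrite ?subnKC//; exact: jmono ik.
  apply/trivIsetP => i k _ _; rewrite neq_ltn => /orP[/lt//|/lt].
  by rewrite setIC.
have e16 : 0 < e / 16 by rewrite divr_gt0.
have [N0 N0P] := uca G mG GD tG _ e16.
have h1 := N0P N0 (leqnn _) _ (Ss (j N0.+1)).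
have h2 := N0P N0.+1 (leqnSn _) _ (Ss (j N0.+1)).
move: h2; rewrite big_nat_recr//=.
have [_ _ h3] := GP N0.+1; have h4 := big N0.+1.
move: h1 h3 h4; set a := \sum_(_ <= _ < _) _; set b := \int[m]_(x in \bigcup_n _) _.
set c := \int[m]_(x in G _) _; set c' := \int[m]_(x in Dk _) _.
move=> h1 h3 h4 h2.
have : `|c| <= e / 8.
  have -> : c = (a + c - b) - (a - b) by ring.
  by apply: (le_trans (ler_normB _ _)); lra.
by lra.
Qed.

End uniform_integrability.

(** * A slowly growing N-function *)

Section slow_growth.
Context (K : realType).
Context (M : nat -> K) (M0 : 2 <= M 0%N) (MS : forall n, M n ^+ 4 <= M n.+1).
Implicit Types (t p : K).

(* A concave function with n <= slow (M n) <= n + 1. *)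
Definition slow t := inf (range (fun n => n%:R + t / M n)).

Lemma thr_ge2 n : 2 <= M n.
Proof.
elim: n => [//|n IH]; apply: le_trans (MS n).
by apply: (le_trans IH); rewrite -[leLHS]expr1 ler_weXn2l//; lra.
Qed.

Lemma thr_gt0 n : 0 < M n. Proof. by have := thr_ge2 n; lra. Qed.

Lemma thr_double n : 2 * M n <= M n.+1.
Proof.
apply: le_trans (MS n); have h := thr_ge2 n.
rewrite (_ : M n ^+ 4 = M n * M n ^+ 2 * M n); last by ring.
rewrite ler_wpM2r//; first lra.
rewrite -[leLHS]mulr1 ler_pM//; try lra.
by rewrite expr_ge1//; lra.
Qed.

Lemma thr_geom n k : 2 ^+ k * M n <= M (n + k)%N.
Proof.
elim: k => [|k IH]; first by rewrite mul1r addn0.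
rewrite addnS exprS -mulrA; apply: le_trans (thr_double _).
by rewrite ler_pM2l.
Qed.

Lemma thr_mono : {homo M : i j / (i <= j)%N >-> i <= j}.
Proof.
move=> i j /subnKC <-; apply: le_trans (thr_geom _ _).
by rewrite ler_peMl ?(ltW (thr_gt0 _))// exprn_ege1//; lra.
Qed.

Lemma thr_unbounded t : exists n, t < M n.
Proof.
have [t0|t0] := leP t 0; first by exists 0%N; have := thr_gt0 0; lra.
exists (Num.bound t); apply: lt_le_trans (archi_boundP (ltW t0)) _.
have := thr_geom 0 (Num.bound t); rewrite add0n; apply: le_trans.
have h1 : (Num.bound t)%:R <= 2 ^+ Num.bound t :> K.
  by rewrite -natrX ler_nat ltnW// ltn_expl.
by apply: (le_trans h1); rewrite ler_peMr ?exprn_ge0//; have := M0; lra.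
Qed.

Lemma slow_le n t : 0 <= t -> slow t <= n%:R + t / M n.
Proof.
move=> t0; apply: ge_inf; last by exists n.
by exists 0 => _ [k _ <-]; rewrite addr_ge0// divr_ge0// ltW// thr_gt0.
Qed.

Lemma le_slow c t : (forall n, c <= n%:R + t / M n) -> c <= slow t.
Proof.
move=> h; apply: lb_le_inf; first by exists (0%:R + t / M 0), 0%N.
by move=> _ [n _ <-].
Qed.

Lemma slow_mono s t : 0 <= s <= t -> slow s <= slow t.
Proof.
move=> /andP[s0 st]; apply: le_slow => n; apply: (le_trans (slow_le n s0)).
by rewrite lerD2l ler_wpM2r// invr_ge0 ltW// thr_gt0.
Qed.

(** An infimum of affine functions with slopes [1 / M n <= 1]. It supplies the right continuity
    required of the derivative of an N-function. *)
Lemma slow_lip s t : 0 <= s -> s <= t -> slow t <= slow s + (t - s).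
Proof.
move=> s0 st; rewrite -lerBlDr; apply: le_slow => n.
rewrite lerBlDr; apply: (le_trans (slow_le n (le_trans s0 st))).
have -> : t / M n = s / M n + (t - s) / M n by rewrite -mulrDl addrC subrK.
rewrite addrA lerD2l.
rewrite ler_pdivrMr ?thr_gt0// ler_peMr ?subr_ge0//.
by have := thr_ge2 n; lra.
Qed.

Lemma slow0 : slow 0 = 0.
Proof.
apply/eqP; rewrite eq_le; apply/andP; split.
  by have := slow_le 0 (lexx 0); rewrite mul0r addr0.
by apply: le_slow => n; rewrite mul0r addr0.
Qed.

Lemma slow_gt0 t : 0 < t -> 0 < slow t.
Proof.
move=> t0; apply: (@lt_le_trans _ _ (Num.min (t / M 0) 1)).
  by rewrite lt_min ltr01 divr_gt0// thr_gt0.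
apply: le_slow => -[|n]; first by rewrite add0r ge_min lexx.
rewrite ge_min; apply/orP; right; rewrite -natr1 -addrA addrCA.
by rewrite lerDl addr_ge0// divr_ge0// ltW// thr_gt0.
Qed.

Lemma slow_le_index n t : 0 <= t -> t <= M n -> slow t <= n.+1%:R.
Proof.
move=> t0 tM; apply: (le_trans (slow_le n t0)); rewrite -natr1 lerD2l.
by rewrite ler_pdivrMr ?thr_gt0// mul1r.
Qed.

(** The thresholds at least double, so for [n < j] one has [t / M n >= 2 ^ (j - n) >= j - n]. *)
Lemma index_le_slow j t : M j <= t -> j%:R <= slow t.
Proof.
move=> Mt; have t0 : 0 <= t by apply: le_trans Mt; exact/ltW/thr_gt0.
apply: le_slow => n; have [jn|nj] := leqP j n.
  by rewrite (@le_trans _ _ n%:R) ?ler_nat// lerDl divr_ge0// ltW// thr_gt0.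
rewrite -(subnKC (ltnW nj)) natrD lerD2l ler_pdivlMr ?thr_gt0//.
apply: le_trans Mt; rewrite -{2}(subnKC (ltnW nj)).
apply: le_trans (thr_geom _ _); rewrite ler_wpM2r ?(ltW (thr_gt0 _))//.
by rewrite -natrX ler_nat ltnW// ltn_expl.
Qed.

(** If [M k.+1 <= p < M k.+2], the fourth power of [p] is at most [M k.+3], so
    [slow t <= k + 4 <= 4 * (k + 1)]. *)
Lemma slow_pow4 p t : M 1 <= p -> 0 <= t -> t <= p ^+ 4 -> slow t <= 4 * slow p.
Proof.
move=> Mp t0 tp.
have [k Mk pM] : exists2 k, M k.+1 <= p & p < M k.+2.
  have [n pn] := thr_unbounded p.
  elim: n pn => [|n IH] pn.
    by have := thr_mono (leq0n 1); lra.
  have [pn'|pn'] := ltP p (M n); first exact: IH.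
  case: n pn pn' {IH} => [|n] pn pn'; last by exists n.
  by move: Mp pn; lra.
have h1 := index_le_slow Mk.
have h2 : slow t <= k.+4%:R.
  apply: slow_le_index => //; apply: (le_trans tp); apply: le_trans (MS _).
  rewrite lerXn2r// ?nnegrE ?(ltW (thr_gt0 _)) ?(ltW pM)//.
  exact: le_trans (ltW (thr_gt0 _)) Mp.
apply: (le_trans h2); apply: (@le_trans _ _ (4 * k.+1%:R)); last by rewrite ler_pM2l.
by rewrite -natrM ler_nat; lia.
Qed.

(** Counting the thresholds passed from [M k] on turns [t * slow t] into tails of [t], whose
    integrals the thresholds control; the free [k] makes their sum small. *)
Lemma slow_count k n t : 0 <= t -> t <= M (k + n)%N ->
  slow t <= k.+1%:R + \sum_(0 <= i < n) (if M (k + i)%N <= t then 1 else 0).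
Proof.
move=> t0; elim: n => [|n IH] tM.
  by rewrite big_nil addr0; apply: slow_le_index => //; rewrite -[k]addn0.
rewrite big_nat_recr//=; case: ifPn => [Mt|]; last first.
  by rewrite -ltNge => /ltW /IH; rewrite addr0.
have -> : \sum_(0 <= i < n) (if M (k + i)%N <= t then 1 else 0) = n%:R :> K.
  rewrite (eq_big_nat _ _ (F2 := fun=> 1)) ?sumr_const_nat ?subn0//.
  move=> i /andP[_ ni]; rewrite ifT//; apply: le_trans Mt.
  by apply: thr_mono; rewrite leq_add2l ltnW.
by rewrite natr1 -natrD; apply: slow_le_index => //; rewrite addSn -addnS.
Qed.

End slow_growth.

(* m plays the role of the derivative of phi, through the support lines it provides. *)
Definition young_pair (phi m : R -> R) :=
  [/\ [/\ forall s t, 0 <= s <= t -> m s <= m t, m 0 = 0 &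
       forall C, exists T, 0 <= T /\ C <= m T],
      forall u v, 0 <= u -> 0 <= v -> phi u + m u * (v - u) <= phi v,
      forall u, phi `|u| = phi u & phi 0 = 0].

Lemma nondecreasing_integrable_itv (m : R -> R) (u : R) :
  (forall s t, 0 <= s <= t -> m s <= m t) ->
  leb.-integrable `[0, u] (EFin \o m).
Proof.
move=> mm; apply: (@bounded_integrable_itv 0 u (`|m 0| + `|m u|)).
  move=> mD; apply: (measurability _ (RGenOInfty.measurableE R)) => // _ [_ [c ->] <-].
  apply: borel_sub_LT; apply: is_interval_measurable => x z /= [xu cx] [zu cz] y.
  move=> /andP[xy yz]; rewrite !in_itv/= in xu zu cx cz *.
  move: xu zu cx => /andP[x0 _] /andP[_ zu]; rewrite !andbT => cx.
  rewrite (le_trans x0 xy) (le_trans yz zu); split => //.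
  by apply: (lt_le_trans cx); apply: mm; rewrite x0.
move=> x /andP[x0 xu]; have h1 : m 0 <= m x by apply: mm; rewrite lexx.
have h2 : m x <= m u by apply: mm; rewrite x0.
have h3 := ler_norm (m u); have h4 := ler_norm (- m 0); rewrite normrN in h4.
have h5 := normr_ge0 (m u); have h6 := normr_ge0 (m 0).
move: h1 h2 h3 h4 h5 h6; move: (m 0) (m u) (m x) => p q z *.
by rewrite ler_norml; apply/andP; split; lra.
Qed.

Definition primitive0 (m : R -> R) (u : R) := \int[leb]_(t in `[0, u]) m t.

Lemma primitive0_diff_bounds (m : R -> R) u v :
  (forall s t, 0 <= s <= t -> m s <= m t) -> 0 <= u -> u <= v ->
  m u * (v - u) <= primitive0 m v - primitive0 m u <= m v * (v - u).
Proof.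
move=> mm u0 uv; have mU : measurable (`[0, u]%classic : set LT) by exact: measurable_itv_LT.
have mV : measurable (`[0, v]%classic : set LT) by exact: measurable_itv_LT.
have mUV : measurable (`]u, v]%classic : set LT) by exact: measurable_itv_LT.
have intV := nondecreasing_integrable_itv v mm.
have intUV : leb.-integrable `]u, v] (EFin \o m).
  apply: integrableS mV mUV _ intV => x; rewrite /= !in_itv/= => /andP[ux ->].
  by rewrite (le_trans u0)// ltW.
have -> : primitive0 m v - primitive0 m u = \int[leb]_(t in `]u, v]) m t.
  rewrite /primitive0 (Rintegral_setD mV mU intV).
  have -> : (`[0, v] `&` `[0, u] = `[0, u] :> set LT)%classic.
    apply/seteqP; split=> x; rewrite /= !in_itv/=; first by case.
    by move=> /andP[-> xu]; rewrite xu (le_trans xu).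
  have -> : (`[0, v] `\` `[0, u] = `]u, v] :> set LT)%classic.
    apply/seteqP; split=> x; rewrite /= !in_itv/=.
      by move=> [/andP[-> ->]] /= /negP; rewrite -ltNge => ->.
    move=> /andP[ux ->]; rewrite (le_trans u0 (ltW ux)); split => //=.
    by apply/negP; rewrite -ltNge.
  by rewrite addrAC subrr add0r.
have intc (k : R) : leb.-integrable `]u, v] (EFin \o cst k).
  apply: integrableS mV mUV _ (@bounded_integrable_itv 0 v `|k| (cst k) _ _) => //.
  move=> x; rewrite /= !in_itv/= => /andP[ux ->].
  by rewrite (le_trans u0)// ltW.
have E (k : R) : k * (v - u) = \int[leb]_(t in `]u, v]) k.
  by rewrite Rintegral_cst// [X in k * X = _](_ : _ = fine (leb `]u, v]%classic))// leb_itvoc.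
rewrite !E; apply/andP; split; apply: le_Rintegral => //.
- exact: intc.
- by move=> x; rewrite /= in_itv/= => /andP[ux _]; apply: mm; rewrite u0 ltW.
- exact: intc.
- by move=> x; rewrite /= in_itv/= => /andP[ux xv]; apply: mm; rewrite xv (le_trans u0)// ltW.
Qed.

Lemma primitive0_young_pair (m : R -> R) :
  (forall s t, 0 <= s <= t -> m s <= m t) -> m 0 = 0 ->
  (forall C, exists T, 0 <= T /\ C <= m T) ->
  young_pair (fun u => primitive0 m `|u|) m.
Proof.
move=> mm m0 mC; split => //.
- move=> u v u0 v0; rewrite !ger0_norm//; have [uv|vu] := leP u v.
    by have /andP[+ _] := primitive0_diff_bounds mm u0 uv; lra.
  by have /andP[_ +] := primitive0_diff_bounds mm v0 (ltW vu); lra.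
- by move=> u; rewrite normr_id.
- have mI : measurable (`[0, 0]%classic : set LT) by exact: measurable_itv_LT.
  have mf := measurable_int _ (nondecreasing_integrable_itv 0 mm).
  have N0 : leb `[0, 0]%classic = 0%E by rewrite leb_itvcc// subrr.
  by rewrite normr0 /primitive0 /Rintegral (null_set_integral mI mf N0).
Qed.

(** A monotone derivative is bounded on compact intervals, so its Henstock primitive is the Lebesgue
    one, whose support lines are known. *)
Lemma N_function_young_pair phi : N_function phi -> exists m, young_pair phi m.
Proof.
move=> [m [mono [_ [m0 [_ [minf mint]]]]]].
have mm s t : 0 <= s <= t -> m s <= m t.
  by move=> /andP[/RleP s0 /RleP st]; apply/RleP; exact: mono.
exists m; have -> : phi = fun u => primitive0 m `|u|.
  apply/funext => u; have u0 : 0 <= `|u| by exact: normr_ge0.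
  apply: (Henstock_unique u0 (mint u)); apply: (Lebesgue_Henstock u0).
  exact: nondecreasing_integrable_itv.
apply: primitive0_young_pair => // C; have [T TP] := minf C.
exists (Num.max T 0); rewrite le_max lexx orbT; split => //.
by apply/RleP/Rge_le/TP/Rle_ge/RleP; rewrite le_max lexx.
Qed.

(** * Inequalities between a Young function and its derivative *)

Section young_pair_theory.
Context (phi m : R -> R) (ym : young_pair phi m).

Let mm s t : 0 <= s <= t -> m s <= m t. Proof. by case: ym => -[h _ _] _ _ _; exact: h. Qed.
Let m0 : m 0 = 0. Proof. by case: ym => -[]. Qed.
Let phi0 : phi 0 = 0. Proof. by case: ym. Qed.
Let phiN u : phi `|u| = phi u. Proof. by case: ym. Qed.

Lemma young_support u v : 0 <= u -> 0 <= v -> phi u + m u * (v - u) <= phi v.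
Proof. by case: ym => _ h _ _; exact: h. Qed.

Lemma young_deriv_ge0 u : 0 <= u -> 0 <= m u.
Proof. by move=> u0; rewrite -m0; apply: mm; rewrite lexx. Qed.

Lemma young_ge0 u : 0 <= phi u.
Proof.
rewrite -phiN; have := young_support (lexx 0) (normr_ge0 u).
by rewrite phi0 m0 mul0r addr0.
Qed.

Lemma young_mono u v : 0 <= u -> u <= v -> phi u <= phi v.
Proof.
move=> u0 uv; apply: le_trans (young_support u0 (le_trans u0 uv)).
by rewrite lerDl mulr_ge0 ?subr_ge0// young_deriv_ge0.
Qed.

Lemma young_norm_le u v : `|u| <= v -> phi u <= phi v.
Proof. by move=> uv; rewrite -phiN; apply: young_mono. Qed.

(** Beyond [T] the slope is at least 1. This inequality embeds the Orlicz space in L1. *)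
Lemma young_superlinear : exists c, 0 <= c /\ forall u, `|u| <= phi u + c.
Proof.
have [T [T0 mT]] : exists T, 0 <= T /\ 1 <= m T by case: ym => -[_ _ h] _ _ _; exact: h.
exists T; split => // u; rewrite -phiN; have [uT|Tu] := leP `|u| T.
  by have := young_ge0 `|u|; lra.
have h1 := young_support T0 (normr_ge0 u); have h2 := young_ge0 T.
have : 1 * (`|u| - T) <= m T * (`|u| - T) by rewrite ler_wpM2r// subr_ge0 ltW.
by lra.
Qed.

Lemma young_le v : 0 <= v -> phi v <= v * m v.
Proof.
by move=> v0; have := young_support v0 (lexx 0); rewrite phi0 sub0r mulrN mulrC; lra.
Qed.

(** The support line at [v / 2], read at [v]. Together with [young_le] it traps [phi] between
    expressions in its derivative, which is how Delta' is checked. *)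
Lemma young_ge v : 0 <= v -> v / 2 * m (v / 2) <= phi v.
Proof.
move=> v0; have v2 : 0 <= v / 2 by rewrite divr_ge0.
have := young_support v2 v0; have := young_ge0 (v / 2).
rewrite (_ : v - v / 2 = v / 2); last by field.
by rewrite mulrC; lra.
Qed.

(** For [t <= 1] one has [phi t <= t * m 1]. With [L] the length of [a, b] this bounds the modular
    of a constant. *)
Lemma young_small L : 0 <= L -> exists t, 0 < t /\ phi t * L <= 1.
Proof.
move=> L0; have m1 : 0 <= m 1 by exact: young_deriv_ge0.
have q0 : 0 < m 1 * L + 1 by rewrite ltr_wpDl// mulr_ge0.
exists (Num.min 1 (m 1 * L + 1)^-1); set t := Num.min _ _.
have t0 : 0 < t by rewrite lt_min ltr01 invr_gt0.
have t1 : t <= 1 by rewrite ge_min lexx.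
split => //; apply: (@le_trans _ _ (t * m 1 * L)).
  rewrite ler_wpM2r// (le_trans (young_le (ltW t0)))// ler_wpM2l ?(ltW t0)//.
  by apply: mm; rewrite (ltW t0).
apply: (@le_trans _ _ ((m 1 * L + 1)^-1 * (m 1 * L))).
  by rewrite -mulrA ler_wpM2r ?mulr_ge0// ge_min lexx orbT.
by rewrite mulrC ler_pdivrMr// mul1r lerDl.
Qed.

Lemma young_measurable d (T : measurableType d) (D : set T) (f : T -> R) :
  measurable_fun D f -> measurable_fun D (phi \o f).
Proof.
move=> mf; have -> : phi \o f = (fun x => phi (Num.max x 0)) \o (fun x => `|f x|).
  by apply/funext => x /=; rewrite max_l// phiN.
apply: measurableT_comp; last exact: measurableT_comp.
apply: (@nondecreasing_measurable R) => // x y xy.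
apply: young_mono; first by rewrite le_max lexx orbT.
by rewrite ge_max !le_max xy lexx orbT.
Qed.

(** One factor of Delta' is frozen at [c], which is at least [1 / lam] and [u0]; where [|x| <= u0],
    monotonicity leaves the constant [k']. *)
Lemma young_dilation : Delta' phi -> forall lam, 0 < lam ->
  exists k k', [/\ 0 <= k, 0 <= k' & forall x, phi (x / lam) <= k * phi x + k'].
Proof.
move=> [k [u0 [/RltP k0 [/RltP u00 H]]]] lam lam0.
pose c := Num.max lam^-1 u0.
have c0 : 0 < c by rewrite lt_max u00 orbT.
exists (k * phi c), (phi (u0 / lam)); split; rewrite ?young_ge0 ?mulr_ge0 ?young_ge0 ?ltW//.
move=> x; rewrite -(phiN (x / lam)) -(phiN x) normrM (gtr0_norm (x := lam^-1)) ?invr_gt0//.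
have [xu|ux] := leP `|x| u0.
  rewrite (@le_trans _ _ (phi (u0 / lam)))//.
    by apply: young_mono; rewrite ?divr_ge0 ?(ltW lam0)// ler_wpM2r// invr_ge0 ltW.
  by rewrite lerDr !mulr_ge0 ?young_ge0// ltW.
apply: (@le_trans _ _ (phi (c * `|x|))).
  apply: young_mono; first by rewrite divr_ge0// ltW.
  by rewrite mulrC ler_wpM2r// le_max lexx.
have := H c `|x|; rewrite !RmultE => /(_ _ _)/RleP h.
apply: (@le_trans _ _ (k * phi c * phi `|x|)).
  by apply: h; apply/Rle_ge/RleP; [rewrite le_max lexx orbT|exact: ltW].
by rewrite lerDl young_ge0.
Qed.

End young_pair_theory.

(** * The N-function with derivative [slow] *)

Section slow_N_function.
Context (M : nat -> R) (M0 : 2 <= M 0%N) (MS : forall n, M n ^+ 4 <= M n.+1).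

Definition slow_phi (u : R) := primitive0 (slow M) `|u|.

Lemma slow_phi_young_pair : young_pair slow_phi (slow M).
Proof.
apply: primitive0_young_pair; first exact: slow_mono.
  exact: slow0.
move=> C; exists (M (Num.bound `|C|)); split; first exact/ltW/thr_gt0.
apply: le_trans (index_le_slow M0 MS (lexx _)).
apply: le_trans (ler_norm _) _; exact/ltW/archi_boundP.
Qed.

Lemma slow_N_function : N_function slow_phi.
Proof.
have mm := slow_mono M0 MS.
exists (slow M); split.
  by move=> s t [/RleP s0 /RleP st]; apply/RleP; apply: mm; rewrite s0.
split.
  move=> t /RleP t0 eps /RltP eps0; exists eps; split; first exact/RltP.
  move=> s [/RleP ts /RltP]; rewrite RplusE => st; apply/RltP.
  rewrite RabsE RminusE ger0_norm; last by rewrite subr_ge0 mm// t0.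
  by have := slow_lip M0 MS t0 ts; lra.
split; first exact: slow0.
split.
  by move=> t /RltP t0; apply/RltP; exact: slow_gt0.
split.
  move=> C; exists (M (Num.bound `|C|)) => t /Rge_le/RleP tM; apply/Rle_ge/RleP.
  apply: le_trans (index_le_slow M0 MS tM).
  by apply: le_trans (ler_norm _) _; exact/ltW/archi_boundP.
move=> u; have u0 : 0 <= `|u| by exact: normr_ge0.
apply: (Lebesgue_Henstock u0); exact: nondecreasing_integrable_itv.
Qed.

(** The bound [2 * M 1] puts [x / 2] and [y / 2] above [M 1 >= 2]. For [y <= x] this gives
    [slow (x * y) <= 4 * slow (x / 2)] and [slow (y / 2) >= 1]; in 16 = 4 * 2 * 2 the last factors
    absorb the two halvings. *)
Lemma slow_Delta' : Delta' slow_phi.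
Proof.
have ym := slow_phi_young_pair.
have M1 := thr_ge2 M0 MS 1.
exists 16, (2 * M 1%N); split; first by apply/RltP.
have M1p := thr_gt0 M0 MS 1.
split; first by apply/RltP; exact: mulr_gt0.
have key x y : 2 * M 1%N <= y -> y <= x -> slow_phi (x * y) <= 16 * slow_phi x * slow_phi y.
  move=> My yx; have x0 : 0 <= x by lra.
  have y0 : 0 <= y by lra.
  apply: (le_trans (young_le ym (mulr_ge0 x0 y0))).
  have hx := young_ge ym x0; have hy := young_ge ym y0.
  have h1 : slow M (x * y) <= 4 * slow M (x / 2).
    apply: (slow_pow4 M0 MS); [lra|exact: mulr_ge0|].
    apply: (@le_trans _ _ (x * x)); first by rewrite ler_wpM2l.
    have -> : (x / 2) ^+ 4 = (x * x) * ((x * x) / 16) by field.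
    rewrite ler_peMr ?mulr_ge0// ler_pdivlMr// mul1r.
    have : 4 * 4 <= x * x by apply: ler_pM => //; lra.
    by move: (x * x) => xx; lra.
  have h2 : 1 <= slow M (y / 2) by apply: (index_le_slow M0 MS (j := 1)); lra.
  have s0 : 0 <= slow M (x / 2) by apply: (young_deriv_ge0 ym); rewrite divr_ge0.
  apply: (@le_trans _ _ (16 * (x / 2 * slow M (x / 2)) * (y / 2 * slow M (y / 2)))).
    have -> : 16 * (x / 2 * slow M (x / 2)) * (y / 2 * slow M (y / 2)) =
      (x * y) * (4 * slow M (x / 2) * slow M (y / 2)) by field.
    rewrite ler_wpM2l ?mulr_ge0//; apply: (le_trans h1).
    by rewrite ler_peMr// mulr_ge0.
  rewrite -[leRHS]mulrA -[leLHS]mulrA ler_pM2l//; apply: ler_pM => //.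
    by apply: mulr_ge0 => //; exact: divr_ge0.
  by apply: mulr_ge0; [exact: divr_ge0|exact: le_trans ler01 h2].
move=> x y /Rge_le/RleP xM /Rge_le/RleP yM; apply/RleP.
rewrite ?RmultE in xM yM *; have [xy|yx] := leP x y; last by apply: key => //; exact: ltW.
by rewrite mulrC -mulrA (mulrC (slow_phi x)) mulrA; exact: key.
Qed.

End slow_N_function.

(** * Orlicz spaces *)

Lemma measurable_funP (a b : R) (f : R -> R) :
  Defs.measurable_fun a b f <-> measurable_fun (`[a, b]%classic : set LT) f.
Proof.
have E c : (fun t => (a <= t <= b)%coqR /\ (f t > c)%coqR) =
    (`[a, b] `&` f @^-1` `]c, +oo[)%classic.
  apply/seteqP; split=> t /=; rewrite !in_itv/= andbT.
    by move=> [[/RleP -> /RleP ->] /RltP ->].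
  by move=> [/andP[/RleP ? /RleP ?] /RltP].
split=> [H|mf c].
- apply: (measurability _ (RGenOInfty.measurableE R)) => _ [_ [c ->] <-].
  by have := H c; rewrite E => /lebesgue_measurableP[].
- rewrite E; apply/lebesgue_measurableP; split; first by move=> t [].
  by apply: mf; [exact: measurable_itv_LT|exact: measurable_itv].
Qed.

Section orlicz.
Context (a b : R) (ab : a <= b) (phi m : R -> R) (ym : young_pair phi m).
Notation D := (`[a, b]%classic : set LT).
Implicit Types (f h w : R -> R) (L : (R -> R) -> R).

Let mD : measurable D. Proof. exact: measurable_itv_LT. Qed.

Definition modular_integrable (lam : R) f :=
  leb.-integrable D (EFin \o (fun t => phi (f t / lam))).

Definition modular (lam : R) f := \int[leb]_(t in D) phi (f t / lam).

Lemma measurable_modular lam f : measurable_fun D f ->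
  measurable_fun D (fun t => phi (f t / lam)).
Proof.
move=> mf; have mf' : measurable_fun D (fun t => f t / lam).
  by apply: measurable_funM; [exact: mf|exact: measurable_cst].
exact: (young_measurable ym mf').
Qed.

Lemma modular_Henstock lam f A : measurable_fun D f ->
  Henstock_integral (fun t => phi (f t / lam)%coqR) a b A <->
  modular_integrable lam f /\ modular lam f = A.
Proof.
move=> mf.
have -> : (fun t => phi (f t / lam)%coqR) = fun t => phi (f t / lam).
  by apply/funext => t; rewrite RdivE.
split=> [H|[intf <-]]; last exact: Lebesgue_Henstock.
have intf : modular_integrable lam f.
  apply: (Henstock_ge0_integrable ab (measurable_modular lam mf) _ H).
  by move=> t _; exact: (young_ge0 ym).
split => //; exact: Henstock_unique ab (Lebesgue_Henstock ab intf) H.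
Qed.

Lemma in_HphiP f : in_Hphi a b phi f <->
  measurable_fun D f /\ exists lam, 0 < lam /\ modular_integrable lam f.
Proof.
split=> [[/measurable_funP mf [lam [/RltP lam0 [A HA]]]]|[mf [lam [lam0 intf]]]].
  split => //; exists lam; split => //.
  by have [] := (modular_Henstock lam A mf).1 HA.
split; first exact/measurable_funP.
exists lam; split; first exact/RltP.
by exists (modular lam f); apply/modular_Henstock.
Qed.

(** [young_superlinear] at [f / lam], integrated; the 1 added to the constant makes it positive. *)
Lemma modular_integrable_L1 : exists c, 0 < c /\ forall f lam, measurable_fun D f ->
  0 < lam -> modular_integrable lam f -> leb.-integrable D (EFin \o f) /\
  \int[leb]_(t in D) `|f t| <= lam * (modular lam f + c).
Proof.
have [c [c0 cP]] := young_superlinear ym.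
exists (c * (b - a) + 1); split.
  by rewrite ltr_wpDl// mulr_ge0// subr_ge0.
move=> f lam mf lam0 intf.
have intc : leb.-integrable D (EFin \o cst c).
  by apply: (@bounded_integrable_itv a b `|c|); first exact: measurable_cst.
have ineq t : `|f t| <= lam * (phi (f t / lam) + c).
  have := cP (f t / lam); rewrite normrM (gtr0_norm (x := lam^-1)) ?invr_gt0//.
  by rewrite ler_pdivrMr// mulrC.
have intg : leb.-integrable D (EFin \o (fun t => phi (f t / lam) + c)).
  exact: (integrableD mD intf intc).
have intlg : leb.-integrable D (EFin \o (fun t => lam * (phi (f t / lam) + c))).
  exact: (integrableZl mD lam intg).
have int1 : leb.-integrable D (EFin \o f).
  apply: (le_integrable mD _ _ intlg); first exact/measurable_EFinP.
  by move=> t _ /=; rewrite lee_fin (le_trans (ineq t))// ler_norm.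
split => //.
apply: (@le_trans _ _ (\int[leb]_(t in D) (lam * (phi (f t / lam) + c)))).
  by apply: le_Rintegral => //; exact: integrable_norm.
rewrite (RintegralZl lam mD intg) (RintegralD mD intf intc) (Rintegral_cst _ mD).
rewrite [fine _](congr1 fine (leb_itvcc ab)) [fine (_%:E)]/=.
by rewrite ler_pM2l// lerD2l lerDl.
Qed.

Lemma in_Hphi_integrable f : in_Hphi a b phi f -> leb.-integrable D (EFin \o f).
Proof.
move=> /in_HphiP[mf [lam [lam0 intf]]].
by have [c [_ cP]] := modular_integrable_L1; have [] := cP f lam mf lam0 intf.
Qed.

(** The norm is a relation, so the infimum of the admissible scales is exhibited as its value.
    Continuity of functionals is used afterwards in this modular form. *)
Lemma Hphi_dual_modular L : Hphi_dual a b phi L ->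
  exists C, 0 < C /\ forall f lam, measurable_fun D f -> 0 < lam ->
  modular_integrable lam f -> modular lam f <= 1 -> `|L f| <= C * lam.
Proof.
move=> [_ [_ [C CP]]]; exists (`|C| + 1); split; first by rewrite ltr_wpDl.
move=> f lam mf lam0 intf mod1.
pose S := [set l : R | 0 < l /\ modular_integrable l f /\ modular l f <= 1].
have Slam : S lam by [].
have Slb : lbound S 0 by move=> l [/ltW].
have n0 : 0 <= inf S by apply: lb_le_inf => //; exists lam.
have nlam : inf S <= lam by apply: ge_inf => //; exists 0.
have : orlicz_norm a b phi f (inf S).
  split.
    move=> l [/RltP l0 [A [HA /RleP A1]]]; apply/RleP; apply: ge_inf; first by exists 0.
    by have [? AE] := (modular_Henstock l A mf).1 HA; split => //; split => //; rewrite AE.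
  move=> n' h; apply/RleP; apply: lb_le_inf; first by exists lam.
  move=> l [l0 [il ml]]; apply/RleP; apply: h; split; first exact/RltP.
  by exists (modular l f); split; [apply/modular_Henstock|apply/RleP].
have fH : in_Hphi a b phi f by apply/in_HphiP; split => //; exists lam.
move=> /(CP f _ fH)/RleP; rewrite RabsE RmultE => /le_trans; apply.
apply: (@le_trans _ _ (`|C| * inf S)); first by rewrite ler_wpM2r// ler_norm.
by apply: ler_pM => //; rewrite lerDl.
Qed.

Definition pairing w f := \int[leb]_(t in D) (f t * w t).

(** The L1 bound, divided by its constant, is a lower bound of all admissible scales, hence of the
    norm by the greatest-lower-bound clause of [orlicz_norm]. *)
Lemma pairing_dual w : bounded_mfun D w -> Hphi_dual a b phi (pairing w).
Proof.
move=> bw; have [mw [B0 wB0]] := bw.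
have intfw f : in_Hphi a b phi f -> leb.-integrable D (EFin \o (fun t => f t * w t)).
  move=> /in_Hphi_integrable intf.
  have := integrable_bounded_mul mD bw intf; congr (_.-integrable _ _).
  by apply/funext => t /=; rewrite mulrC.
split; [|split].
- move=> f h fH hH; rewrite /pairing RplusE -(RintegralD mD (intfw _ fH) (intfw _ hH)).
  by apply: eq_Rintegral => t _; rewrite RplusE mulrDl.
- move=> c f fH; rewrite /pairing RmultE -[RHS](RintegralZl c mD (intfw _ fH)).
  by apply: eq_Rintegral => t _; rewrite RmultE mulrA.
have [c [c0 cP]] := modular_integrable_L1.
pose B := `|B0| + 1; have Bgt0 : 0 < B by rewrite ltr_wpDl.
have C0 : 0 < B * (1 + c) by rewrite mulr_gt0// addr_gt0.
exists (B * (1 + c)) => f n fH [_ nlub]; have [mf _] := (in_HphiP f).1 fH.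
apply/RleP; rewrite RabsE RmultE -ler_pdivrMl//; apply/RleP/nlub.
move=> lam [/RltP lam0 [A [HA /RleP A1]]]; apply/RleP; rewrite ler_pdivrMl//.
have [il ml] := (modular_Henstock lam A mf).1 HA.
have [intf fle] := cP f lam mf lam0 il.
have -> : pairing w f = \int[leb]_(t in D) (w t * f t).
  by apply: eq_Rintegral => t _; rewrite mulrC.
have wB t : D t -> `|w t| <= B.
  by move=> /wB0 /le_trans; apply; rewrite (le_trans (ler_norm _))// lerDl.
apply: (le_trans (le_normr_Rintegral_mul mD mw wB intf)).
rewrite -mulrA ler_pM2l//; apply: (le_trans fle).
by rewrite mulrC ler_pM2r// lerD2r ml.
Qed.

Lemma weak_nbhd_open f (Ls : list ((R -> R) -> R)) (eps : R) :
  Forall (Hphi_dual a b phi) Ls ->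
  weak_open a b phi (weak_nbhd a b phi f Ls eps).
Proof.
move=> LsD; split=> [h []//|h [hH hLs]].
have [e' [e'0 e'P]] : exists e' : R, 0 < e' /\
    Forall (fun L => `|L h - L f| + e' <= eps) Ls.
  elim: Ls hLs {LsD} => [|L Ls IH] hLs; first by exists 1.
  have [e1 [e10 e1P]] := IH (Forall_inv_tail hLs).
  have /RltP := Forall_inv hLs; rewrite RabsE RminusE => Lh.
  exists (Num.min e1 (eps - `|L h - L f|)); split.
    by rewrite lt_min e10 subr_gt0.
  apply: Forall_cons.
    by rewrite -lerBrDl ge_min lexx orbT.
  by apply: Forall_impl e1P => L'; apply: le_trans; rewrite lerD2l ge_min lexx.
exists Ls, e'; split; first exact/RltP.
split => // g [gH gLs]; split => //.
apply: Forall_impl (Forall_and gLs e'P) => L [/RltP]; rewrite !RabsE !RminusE.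
move=> h1 h2; apply/RltP; rewrite (_ : L g - L f = (L g - L h) + (L h - L f)); last by ring.
by apply: (le_lt_trans (ler_normD _ _)); apply: lt_le_trans h2; rewrite addrC ltrD2l.
Qed.

(** Otherwise the neighbourhoods that the sequence eventually leaves would cover [Q]; a finite
    subcover is left altogether from its largest index on. *)
Lemma weak_compact_cluster (Q : (R -> R) -> Prop) (s : nat -> R -> R) :
  weak_compact a b phi Q -> (forall n, Q (s n)) ->
  exists f, Q f /\ forall Ls (eps : R) N, 0 < eps -> Forall (Hphi_dual a b phi) Ls ->
    exists n, (N <= n)%N /\ Forall (fun L => `|L (s n) - L f| < eps) Ls.
Proof.
move=> [QH Qc] Qs; apply: contrapT => nf.
pose I := {i : (R -> R) * list ((R -> R) -> R) * R * nat |
  [/\ 0 < i.1.2, Forall (Hphi_dual a b phi) i.1.1.2 &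
   forall n, (i.2 <= n)%N -> ~ weak_nbhd a b phi i.1.1.1 i.1.1.2 i.1.2 (s n)]}.
pose U (i : I) := weak_nbhd a b phi (sval i).1.1.1 (sval i).1.1.2 (sval i).1.2.
have [||l lP] := Qc I U.
- by case=> -[[[f Ls] e] N] [e0 LsD h]; exact: weak_nbhd_open.
- move=> f Qf; apply: contrapT => nU; apply: nf; exists f; split => // Ls eps N e0 LsD.
  apply: contrapT => nn; apply: nU.
  have iP : [/\ 0 < (f, Ls, eps, N).1.2, Forall (Hphi_dual a b phi) (f, Ls, eps, N).1.1.2 &
     forall n, ((f, Ls, eps, N).2 <= n)%N ->
     ~ weak_nbhd a b phi (f, Ls, eps, N).1.1.1 (f, Ls, eps, N).1.1.2 (f, Ls, eps, N).1.2 (s n)].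
    split => // n Nn [_ h]; apply: nn; exists n; split => //.
    by apply: Forall_impl h => L /RltP.
  exists (exist _ (f, Ls, eps, N) iP); split; first exact: QH.
  apply/Forall_forall => L _; apply/RltP.
  by rewrite RabsE RminusE subrr normr0.
pose N := (\max_(i <- l) (sval i).2)%N.
have [i [il Ui]] := lP (s N) (Qs N).
have iN : ((sval i).2 <= N)%N.
  have : forall l' : list I, In i l' -> ((sval i).2 <= \max_(i <- l') (sval i).2)%N.
    elim=> [//|j l' IH] /= [->|/IH h]; rewrite big_cons leq_max ?leqnn//.
    by rewrite h orbT.
  exact.
by case: i il Ui iN => -[[[f Ls] e] N'] [? ? h] /= _ Ui /h; exact.
Qed.

End orlicz.

(** * Gliding hump: setwise clustering implies uniform countable additivity *)

Section gliding_hump.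
Context d (T : measurableType d) (K : realType).
Context (m : {measure set T -> \bar K}).
Implicit Types (D A : set T) (f s : T -> K) (S : set (T -> K)) (F B : nat -> set T).

Definition tail F n : set T := \bigcup_k F (n + k)%N.

Lemma measurable_tail F n : (forall n, measurable (F n)) -> measurable (tail F n).
Proof. by move=> mF; exact: bigcupT_measurable. Qed.

Lemma tailS F n : tail F n = F n `|` tail F n.+1.
Proof.
apply/seteqP; split=> x.
  move=> [[|k] _]; first by rewrite addn0; left.
  by rewrite addnS -addSn => Fx; right; exists k.
by case=> [Fx|[k _ Fx]]; [exists 0%N; rewrite ?addn0|exists k.+1; rewrite ?addnS].
Qed.

Lemma subset_tail F i n : (n <= i)%N -> F i `<=` tail F n.
Proof. by move=> ni x Fx; exists (i - n)%N => //; rewrite subnKC. Qed.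

Lemma tail_mono F i n : (n <= i)%N -> tail F i `<=` tail F n.
Proof. by move=> ni x [k _]; apply: subset_tail; rewrite (leq_trans ni)// leq_addr. Qed.

Lemma tail_sub D F n : (forall n, F n `<=` D) -> tail F n `<=` D.
Proof. by move=> FD x [k _ /FD]. Qed.

Lemma integral_tail_split D F f N : measurable D -> m.-integrable D (EFin \o f) ->
  (forall n, measurable (F n)) -> (forall n, F n `<=` D) -> trivIset setT F ->
  \int[m]_(x in \bigcup_n F n) f x =
  \sum_(0 <= n < N) \int[m]_(x in F n) f x + \int[m]_(x in tail F N) f x.
Proof.
move=> mD intf mF FD tF.
have mT n := measurable_tail n mF.
elim: N => [|N ->]; first by rewrite big_nil add0r.
rewrite big_nat_recr//= -addrA tailS Rintegral_setU//.
- exact: integrableS mD (measurableU _ _ (mF N) (mT N.+1)) (fun x h =>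
    match h with or_introl h => FD N x h | or_intror h => tail_sub FD h end) intf.
- rewrite disj_set2E; apply/eqP/seteqP; split=> x // [Fx [k _ Fkx]].
  have /trivIsetP tF' := tF; have := tF' N (N.+1 + k)%N I I.
  rewrite neq_ltn ltnS leq_addr => /(_ erefl) FF.
  by have : (F N `&` F (N.+1 + k)%N) x by []; rewrite FF.
Qed.

(** Tails of a disjoint sequence decrease to the empty set, and [|f|] dominates. *)
Lemma integral_tail_small D F f e : measurable D -> m.-integrable D (EFin \o f) ->
  (forall n, measurable (F n)) -> (forall n, F n `<=` D) -> trivIset setT F ->
  0 < e -> exists N, forall n, (N <= n)%N -> \int[m]_(x in tail F n) `|f x| <= e.
Proof.
move=> mD intf mF FD tF e0.
have mf : measurable_fun D f by apply/measurable_EFinP; exact: measurable_int intf.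
have mT n := measurable_tail n mF.
have intn := integrable_norm intf.
pose fn n x := `|f x| * \1_(tail F n) x.
have [||||N NP] := @dominated_Rintegral _ _ _ m D fn (cst 0) (fun x => `|f x|) mD _ _ _ intn _ e e0.
- move=> n; apply: measurable_funM; first exact: measurableT_comp.
  exact: measurable_indic.
- exact: measurable_cst.
- move=> x Dx; apply: cvg_near_cst.
  have [[k Fkx]|nF] := pselect (exists k, F k x).
    exists k.+1 => // n /= kn; rewrite /eqfun /fn indicE memNset ?mulr0// => -[i _ Fx].
    have /trivIsetP tF' := tF; have := tF' k (n + i)%N I I.
    rewrite neq_ltn (leq_trans kn (leq_addr _ _)) => /(_ erefl) FF.
    by have : (F k `&` F (n + i)%N) x by []; rewrite FF.
  exists 0%N => // n _ /=; rewrite /eqfun /fn indicE memNset ?mulr0// => -[i _ Fx].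
  by apply: nF; exists (n + i)%N.
- move=> n x Dx; rewrite /fn normrM normr_id ler_piMr//.
  by rewrite indicE ger0_norm// lern1 leq_b1.
exists N => n Nn; have := NP n Nn.
rewrite Rintegral_cst// mul0r subr0; apply: le_trans.
rewrite ger0_norm; last by apply: Rintegral_ge0 => x _; rewrite mulr_ge0.
rewrite -{1}(setIidr (tail_sub (n := n) FD)) Rintegral_mkcondr.
rewrite le_eqVlt; apply/orP; left; apply/eqP; apply: eq_Rintegral => x _.
by rewrite patchE /fn indicE; case: ifPn => _; rewrite ?mulr1 ?mulr0.
Qed.

Lemma le_normr_Rintegral_sub D A f : measurable D -> measurable A -> A `<=` D ->
  m.-integrable D (EFin \o f) ->
  `|\int[m]_(x in A) f x| <= \int[m]_(x in A) `|f x|.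
Proof. by move=> mD mA AD intf; apply: le_normr_Rintegral => //; exact: integrableS intf. Qed.

(** Finitely many sets are tested at once and [k] is arbitrarily late: [f] is a cluster point for
    the topology of setwise convergence. *)
Definition setwise_clustering D S := forall s : nat -> T -> K, (forall n, S (s n)) ->
  exists f, m.-integrable D (EFin \o f) /\
  forall (A : nat -> set T) (n N : nat) e, (forall i, measurable (A i)) ->
    (forall i, A i `<=` D) -> 0 < e -> exists k, (N <= k)%N /\
    forall i, (i < n)%N -> `|\int[m]_(x in A i) s k x - \int[m]_(x in A i) f x| < e.

(** Failure gives arbitrarily late tails with an integral above [e]. Cutting each tail where its own
    function has at most [e / 2] left gives blocks, disjoint once each starts after the previous
    cut. *)
Lemma not_countably_additive_blocks D S : measurable D ->
  (forall s, S s -> m.-integrable D (EFin \o s)) ->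
  ~ uniformly_countably_additive m D S -> exists e (s : nat -> T -> K) B,
  [/\ 0 < e, forall n, S (s n), forall n, measurable (B n) /\ B n `<=` D,
     trivIset setT B & forall n, e <= `|\int[m]_(x in B n) s n x|].
Proof.
move=> mD intS nuca.
have [F [e [mF FD tF e0 Fe]]] : exists F e, [/\ forall n, measurable (F n),
    forall n, F n `<=` D, trivIset setT F, 0 < e &
    forall N0, exists Ns : nat * (T -> K), [/\ (N0 <= Ns.1)%N, S Ns.2 &
      e < `|\int[m]_(x in tail F Ns.1) Ns.2 x|]].
  apply: contrapT => nF; apply: nuca => F mF FD tF e e0.
  apply: contrapT => nN; apply: nF; exists F, e; split => // N0.
  apply: contrapT => nNs; apply: nN; exists N0 => N N0N s Ss.
  rewrite (integral_tail_split N.+1 mD (intS _ Ss) mF FD tF) opprD addrA subrr add0r normrN.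
  rewrite leNgt; apply/negP => h; apply: nNs; exists (N.+1, s); split => //=.
  exact: leq_trans (leqnSn _).
have [Ns NsP] := choice Fe.
pose N n := (Ns n).1; pose s n := (Ns n).2.
have Ss n : S (s n) by case: (NsP n).
have mT n := measurable_tail n mF.
have TD n : tail F n `<=` D by exact: tail_sub.
have e2 : 0 < e / 2 by rewrite divr_gt0.
have /choice[P PP] : forall n, exists P, (N n <= P)%N /\
    \int[m]_(x in tail F P) `|s n x| <= e / 2.
  move=> n; have [P PP] := integral_tail_small mD (intS _ (Ss n)) mF FD tF e2.
  by exists (maxn (N n) P); rewrite leq_maxl; split => //; apply: PP; rewrite leq_maxr.
pose j k := iter k P 0%N.
pose B k := tail F (N (j k)) `\` tail F (P (j k)).
have Nj n : (n <= N n)%N by case: (NsP n).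
have jmono i k : (i < k)%N -> (P (j i) <= j k)%N.
  move=> /subnKC <-; elim: (k - i.+1)%N => [|l IH]; first by rewrite addn0.
  rewrite addnS; apply: (leq_trans IH); apply: leq_trans (Nj _) _.
  by case: (PP (j (i.+1 + l)%N)).
exists (e / 2), (s \o j), B; split => //.
- by move=> n; exact: Ss.
- by move=> n; split; [exact: measurableD|move=> x [/TD]].
- have lt i k : (i < k)%N -> B i `&` B k = set0.
    move=> ik; apply/seteqP; split=> x // [[_ nT] [Tx _]]; apply: nT.
    by apply: tail_mono Tx; apply: leq_trans (jmono _ _ ik) (Nj _).
  apply/trivIsetP => i k _ _; rewrite neq_ltn => /orP[/lt//|/lt].
  by rewrite setIC.
- move=> n; have [NP h2] := PP (j n); have [_ _ h1] := NsP (j n).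
  have intT : m.-integrable (tail F (N (j n))) (EFin \o s (j n)).
    exact: integrableS mD _ (TD _) (intS _ (Ss _)).
  move: h1; rewrite -/(s _) -/(N _) (Rintegral_setD (mT _) (mT (P (j n))) intT) -/(B n).
  rewrite setIidr; last exact: tail_mono.
  have := le_normr_Rintegral_sub mD (mT (P (j n))) (TD _) (intS _ (Ss (j n))).
  move: h2; set x := \int[m]_(_ in tail F _) `|_|; set y := \int[m]_(_ in tail F _) _.
  set z := \int[m]_(_ in B n) _ => h2 h1 h3.
  by have := ler_normD y z; rewrite /= -/z; lra.
Qed.

(* Gliding hump: along a subsequence j of disjoint blocks B i, the integral of s (j k)
   over the union of the selected blocks stays away from that of f. *)
Theorem clustering_countably_additive D S : measurable D ->
  (forall s, S s -> m.-integrable D (EFin \o s)) ->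
  setwise_clustering D S -> uniformly_countably_additive m D S.
Proof.
move=> mD intS clus; apply: contrapT => nuca.
have [e [s [B [e0 Ss mBD tB Be]]]] := not_countably_additive_blocks mD intS nuca.
have mB n : measurable (B n) by case: (mBD n).
have BD n : B n `<=` D by case: (mBD n).
have mT n := measurable_tail n mB.
have TD n : tail B n `<=` D by exact: tail_sub.
have [f [intf fclus]] := clus s Ss.
have e32 : 0 < e / 32 by rewrite divr_gt0.
have [i0 fT] := integral_tail_small mD intf mB BD tB e32.
(* A later function must match [f] within [eta j / (j + 1)] on each block up to [j]: at most [j + 1]
   selected blocks add up to [eta j <= e / 32]. Moreover [eta j] tends to 0, so the subsequence
   converges to [f] on each selected block. *)
pose eta (j : nat) : K := e / 32 / j.+1%:R.
have eta0 j : 0 < eta j by rewrite divr_gt0.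
have /choice[nxt nxtP] : forall j, exists j', [/\ (j < j')%N,
    \int[m]_(x in tail B j') `|s j x| <= e / 32 &
    forall i, (i <= j)%N ->
    `|\int[m]_(x in B i) s j' x - \int[m]_(x in B i) f x| <= eta j / j.+1%:R].
  move=> j; have [N NP] := integral_tail_small mD (intS _ (Ss j)) mB BD tB e32.
  have [k [kN kP]] := fclus B j.+1 (maxn N j.+1) _ mB BD (divr_gt0 (eta0 j) (ltr0Sn K j)).
  exists k; split.
  - exact: leq_trans (leq_maxr _ _) kN.
  - by apply: NP; exact: leq_trans (leq_maxl _ _) kN.
  - by move=> i ij; apply/ltW/kP.
pose j k := iter k nxt i0.
have jS k : (j k < j k.+1)%N by case: (nxtP (j k)).
have jmono i k : (i <= k)%N -> (j i <= j k)%N.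
  move=> /subnKC <-; elim: (k - i)%N => [|l IH]; first by rewrite addn0.
  by rewrite addnS; apply: (leq_trans IH); exact: ltnW.
have jk k : (k <= j k)%N.
  by elim: k => [//|k IH]; exact: leq_ltn_trans (jS k).
have i0j k : (i0 <= j k)%N by exact: (jmono 0%N).
pose G k := B (j k).
have mG k : measurable (G k) by exact: mB.
have GD k : G k `<=` D by exact: BD.
have jinj i k : (i < k)%N -> (j i < j k)%N by move=> ik; exact: leq_trans (jS i) (jmono _ _ ik).
have tG : trivIset setT G.
  have /trivIsetP tB' := tB; apply/trivIsetP => i k _ _; rewrite neq_ltn => ik.
  by apply: tB' => //; rewrite neq_ltn; case/orP: ik => /jinj ->; rewrite ?orbT.
pose A := \bigcup_k G k.
have mA : measurable A by exact: bigcupT_measurable.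
have AD : A `<=` D by move=> x [k _ /GD].
have Gtail k : tail G k `<=` tail B (j k).
  move=> x [i _ Gx]; apply: (subset_tail (n := j k) (i := j (k + i)%N)) => //.
  by apply: jmono; rewrite leq_addr.
have mtG k := measurable_tail k mG.
have tGD k : tail G k `<=` D by exact: tail_sub.
(* The block of index [k + 1] contributes at least [e]; the earlier differences, [f] on that block
   and the two later tails cost at most [e / 32] each. *)
have low k : e / 2 <= `|\int[m]_(x in A) s (j k.+1) x - \int[m]_(x in A) f x|.
  have intsk := intS _ (Ss (j k.+1)).
  rewrite (integral_tail_split k.+2 mD intsk mG GD tG).
  rewrite (integral_tail_split k.+2 mD intf mG GD tG).
  rewrite !(big_nat_recr k.+1)//=.
  set s1 := \sum_(0 <= _ < k.+1) _; set s2 := \int[m]_(_ in _) _; set s3 := \int[m]_(_ in _) _.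
  set f1 := \sum_(0 <= _ < k.+1) _; set f2 := \int[m]_(_ in _) _; set f3 := \int[m]_(_ in _) _.
  have h1 : `|s1 - f1| <= e / 32.
    rewrite -sumrB; apply: (le_trans (ler_norm_sum _ _ _)).
    have [_ _ nP] := nxtP (j k).
    apply: (@le_trans _ _ (\sum_(0 <= i < k.+1) (eta (j k) / (j k).+1%:R))).
      rewrite !big_nat; apply: ler_sum => i /andP[_ ik]; apply: nP.
      exact: jmono.
    rewrite sumr_const_nat subn0 -[leLHS]mulr_natl mulrCA.
    apply: (@le_trans _ _ (eta (j k))).
      rewrite ler_piMr ?(ltW (eta0 _))// ler_pdivrMr// mul1r ler_nat ltnS.
      exact: jk.
    by rewrite /eta ler_pdivrMr// ler_peMr ?(ltW e32)// ler1n.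
  have h2 : e <= `|s2| by exact: Be.
  have h3 : `|f2| <= e / 32.
    apply: (le_trans (le_normr_Rintegral_sub mD (mG _) (GD _) intf)).
    apply: le_trans (fT i0 (leqnn _)); apply: le_Rintegral_subset => //.
    - exact: (subset_tail (i0j k.+1)).
    - by apply: integrable_norm; exact: integrableS intf.
  have h4 : `|s3| <= e / 32.
    apply: (le_trans (le_normr_Rintegral_sub mD (mtG _) (tGD _) intsk)).
    have [_ h _] := nxtP (j k.+1); apply: le_trans h; apply: le_Rintegral_subset => //.
      by apply: integrable_norm; exact: integrableS intsk.
  have h5 : `|f3| <= e / 32.
    apply: (le_trans (le_normr_Rintegral_sub mD (mtG _) (tGD _) intf)).
    apply: le_trans (fT _ (i0j k.+2)); apply: le_Rintegral_subset => //.
      by apply: integrable_norm; exact: integrableS intf.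
  have -> : s1 + s2 + s3 - (f1 + f2 + f3) = s2 - (f2 - (s1 - f1) - (s3 - f3)) by ring.
  apply: le_trans (lerB_dist _ _).
  have := ler_normB (f2 - (s1 - f1)) (s3 - f3).
  have := ler_normB f2 (s1 - f1); have := ler_normB s3 f3.
  by lra.
(* [f] need not be a cluster point of the selected subsequence, so a second one [g] is taken; it
   agrees with [f] on every [G i], hence on [A], which contradicts [low]. *)
have [g [intg gclus]] := clus (s \o j \o succn) (fun n => Ss _).
have Ggf i : \int[m]_(x in G i) g x = \int[m]_(x in G i) f x.
  apply/eqP; rewrite -subr_eq0 -normr_le0; apply/ler_addgt0Pr => c c0; rewrite add0r.
  have c2 : 0 < c / 2 by rewrite divr_gt0.
  have [k [kN kP]] := gclus G i.+1 (maxn i (Num.bound (e / 32 / (c / 2)))) _ mG GD c2.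
  have := kP i (leqnn _).
  have [_ _ nP] := nxtP (j k).
  have := nP (j i) (jmono _ _ (leq_trans (leq_maxl _ _) kN)); rewrite -/(G i) => h1 h2.
  have h3 : eta (j k) / (j k).+1%:R <= c / 2.
    apply: (@le_trans _ _ (eta (j k))).
      by rewrite ler_pdivrMr// ler_peMr ?(ltW (eta0 _))// ler1n.
    rewrite /eta ler_pdivrMr// [leRHS]mulrC -ler_pdivrMr//.
    apply: (@le_trans _ _ (Num.bound (e / 32 / (c / 2)))%:R).
      by apply/ltW/archi_boundP; rewrite !divr_ge0// ltW.
    rewrite ler_nat; apply: leqW; apply: leq_trans (jk k).
    exact: leq_trans (leq_maxr _ _) kN.
  apply: (le_trans (ler_distD (\int[m]_(x in G i) s (j k.+1) x) _ _)).
  rewrite [leRHS]splitr; apply: lerD; first by rewrite distrC; exact: ltW h2.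
  exact: le_trans h1 h3.
have Agf : \int[m]_(x in A) g x = \int[m]_(x in A) f x.
  apply/eqP; rewrite -subr_eq0 -normr_le0; apply/ler_addgt0Pr => c c0; rewrite add0r.
  have c2 : 0 < c / 2 by rewrite divr_gt0.
  have [N1 N1P] := integral_tail_small mD intg mG GD tG c2.
  have [N2 N2P] := integral_tail_small mD intf mG GD tG c2.
  pose N := maxn N1 N2.
  rewrite (integral_tail_split N mD intg mG GD tG) (integral_tail_split N mD intf mG GD tG).
  under eq_bigr do rewrite Ggf.
  rewrite opprD addrACA subrr add0r; apply: (le_trans (ler_normB _ _)).
  rewrite [leRHS]splitr; apply: lerD.
    apply: (le_trans (le_normr_Rintegral_sub mD (mtG _) (tGD _) intg)).
    by apply: N1P; rewrite leq_maxl.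
  apply: (le_trans (le_normr_Rintegral_sub mD (mtG _) (tGD _) intf)).
  by apply: N2P; rewrite leq_maxr.
have e2 : 0 < e / 2 by rewrite divr_gt0.
have [k [_ kP]] := gclus (fun=> A) 1%N 0%N _ (fun=> mA) (fun=> AD) e2.
have := kP 0%N isT; rewrite Agf /= => h.
by have := low k; rewrite leNgt h.
Qed.

End gliding_hump.

Lemma pairing_indic (a b : R) (A : set LT) (f : R -> R) : measurable A ->
  A `<=` `[a, b]%classic -> pairing a b \1_A f = \int[leb]_(x in A) f x.
Proof.
move=> mA AD; rewrite -[in RHS](setIidr AD) Rintegral_mkcondr /pairing.
apply: eq_Rintegral => x _; rewrite patchE indicE.
by case: ifPn => _; rewrite ?mulr1 ?mulr0.
Qed.

(** Weak neighbourhoods given by finitely many pairings with indicators are what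
    [setwise_clustering] tests. *)
Theorem rel_weakly_compact_countably_additive (a b : R) (phi m : R -> R)
    (S : (R -> R) -> Prop) : a <= b -> young_pair phi m ->
  rel_weakly_compact a b phi S ->
  uniformly_countably_additive leb (`[a, b]%classic : set LT) (S : set (LT -> R)).
Proof.
move=> ab ym [SH [QH Qc]]; pose D : set LT := `[a, b]%classic.
have mD : measurable D by exact: measurable_itv_LT.
have Hint f : in_Hphi a b phi f -> leb.-integrable D (EFin \o f).
  exact: (in_Hphi_integrable ab ym).
apply: (clustering_countably_additive mD) => [s Ss|s Ss]; first exact/Hint/SH.
have Qs n : weak_closure a b phi S (s n).
  split; first exact: SH (Ss n).
  move=> Ls eps e0 LsD; exists (s n); split; first exact: Ss.
  split; first exact: SH (Ss n).
  apply/Forall_forall => L _; apply/RltP; rewrite RabsE RminusE subrr normr0.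
  exact/RltP.
have [f [Qf fcl]] := weak_compact_cluster (conj QH Qc) Qs.
exists f; split; first exact/Hint/QH.
move=> A n N e mA AD e0.
pose Ls := [seq pairing a b \1_(A i) | i <- iota 0 n].
have LsD : Forall (Hphi_dual a b phi) Ls.
  apply/Forall_forall => L /in_map_iff[i [<- _]].
  by apply: (pairing_dual ab ym); exact: bounded_mfun_indic.
have [k [Nk /Forall_forall kP]] := fcl Ls e N e0 LsD.
exists k; split => // i ni; rewrite -!(pairing_indic _ (mA i) (AD i)); apply: kP.
apply/in_map_iff; exists i; split => //.
have : i \in iota 0 n by rewrite mem_iota add0n.
elim: (iota 0 n) => [//|x l IH]; rewrite inE => /predU1P[->|/IH]; first by left.
by right.
Qed.

(** * Choice of the thresholds and uniform bounds on the modular *)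

Section uniform_modular.
Context (a b : R) (ab : a <= b) (S : (R -> R) -> Prop).
Notation D := (`[a, b]%classic : set LT).
Let mD : measurable D. Proof. exact: measurable_itv_LT. Qed.
Context (intS : forall s, S s -> leb.-integrable D (EFin \o s))
  (acS : uniformly_abs_continuous leb D (S : set (LT -> R))).

Lemma measurable_norm_ge (E : set LT) (f : R -> R) (c : R) : measurable E ->
  measurable_fun E f -> measurable (E `&` [set x | c <= `|f x|] : set LT).
Proof.
move=> mE mf; have mnf : measurable_fun E (fun x => `|f x|) by exact: measurableT_comp.
rewrite (_ : _ `&` _ = E `&` (fun x => `|f x|) @^-1` `[c, +oo[%classic).
  by apply: mnf => //; exact: measurable_itv.
by apply/seteqP; split=> x /=; rewrite !in_itv/= andbT.
Qed.

(** [a, b] is cut into pieces of length at most [del], on each of which the integral of [|s|] is at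
    most 1; the extra 1 comes from the degenerate interval that starts the induction. *)
Lemma abs_continuous_L1_bounded : exists C, 0 < C /\ forall s, S s ->
  \int[leb]_(x in D) `|s x| <= C.
Proof.
have [del [del0 acP]] := acS ltr01.
have key s (n : nat) c : S s -> a <= c -> c <= b -> c - a <= n%:R * del ->
    \int[leb]_(x in (`[a, c]%classic : set LT)) `|s x| <= n.+1%:R.
  move=> Ss; elim: n c => [|n IH] c ac cb cn.
    apply: (acP _ Ss); first exact: measurable_itv_LT.
      by apply: subset_itvl; rewrite bnd_simp.
    by rewrite [leLHS](leb_itvcc ac) lee_fin (le_trans cn)// mul0r ltW.
  pose c' := Num.max a (c - del).
  have ac' : a <= c' by rewrite le_max lexx.
  have c'c : c' <= c by rewrite ge_max ac gerBl ltW.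
  have c'n : c' - a <= n%:R * del.
    rewrite lerBlDr ge_max; apply/andP; split.
      by rewrite lerDr mulr_ge0// ltW.
    by rewrite -natr1 mulrDl mul1r in cn; lra.
  have mac : measurable (`[a, c]%classic : set LT) by exact: measurable_itv_LT.
  have mac' : measurable (`[a, c']%classic : set LT) by exact: measurable_itv_LT.
  have acD : (`[a, c] `<=` D)%classic by apply: subset_itvl; rewrite bnd_simp.
  have intac : leb.-integrable `[a, c] (EFin \o (fun x => `|s x|)).
    by apply: integrable_norm; exact: integrableS mD mac acD (intS Ss).
  rewrite (Rintegral_setD mac mac' intac) -natr1; apply: lerD.
    rewrite setIidr; last by apply: subset_itvl; rewrite bnd_simp.
    exact: IH ac' (le_trans c'c cb) c'n.
  apply: (acP _ Ss); first exact: measurableD.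
    by move=> x [/acD].
  have sub : (`[a, c] `\` `[a, c'] `<=` `]c', c])%classic.
    move=> x; rewrite /= !in_itv/= => -[/andP[ax xc] /negP]; rewrite ax/= -ltNge.
    by move=> ->; rewrite xc.
  apply: (@le_trans _ _ (leb `]c', c]%classic)).
    by apply: le_outer_measure.
  rewrite leb_itvoc// lee_fin lerBlDr -lerBlDl.
  by rewrite le_max lexx orbT.
exists (Num.bound ((b - a) / del)).+1%:R; split; first by rewrite ltr0n.
move=> s Ss; apply: key => //.
by rewrite -ler_pdivrMr// ltW// archi_boundP// divr_ge0 ?subr_ge0// ltW.
Qed.

(** Chebyshev: for [c' >= C / del] the set where [|s| >= c'] has measure at most [del], whatever
    [s]. Allowing every larger level lets the thresholds be raised to satisfy the fourth-power
    growth. *)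
Lemma abs_continuous_tail (e : R) : 0 < e -> exists c, forall c', c <= c' ->
  forall s, S s -> \int[leb]_(x in D `&` [set x | c' <= `|s x|]) `|s x| <= e.
Proof.
move=> e0; have [C [C0 CP]] := abs_continuous_L1_bounded.
have [del [del0 acP]] := acS e0.
exists (C / del) => c' cc' s Ss.
have c'0 : 0 < c' by apply: lt_le_trans cc'; rewrite divr_gt0.
have ms : measurable_fun D s by apply/measurable_EFinP; exact: measurable_int (intS Ss).
pose E : set LT := D `&` [set x | c' <= `|s x|].
have mE : measurable E by exact: measurable_norm_ge.
have ED : E `<=` D by move=> x [].
apply: (acP s Ss E mE ED).
have Efin : leb E \is a fin_num.
  by rewrite ge0_fin_numE; [exact: (@lout_itv_lty a b)|exact: measure_ge0].
apply: (@le_trans _ _ (fine (leb E))%:E); first by rewrite (fineK Efin).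
rewrite lee_fin; rewrite ler_pdivrMr// in cc'.
have intE := integrableS mD mE ED (integrable_norm (intS Ss)).
have h : c' * fine (leb E) <= C.
  apply: (le_trans _ (CP s Ss)).
  apply: (@le_trans _ _ (\int[leb]_(x in E) `|s x|)).
    rewrite -(Rintegral_cst leb mE c'); apply: le_Rintegral => //.
      apply: integrableS mD mE ED _.
      by apply: (@bounded_integrable_itv a b `|c'|); first exact: measurable_cst.
    by move=> x [].
  apply: le_Rintegral_subset => //; exact: integrable_norm (intS Ss).
rewrite -(ler_pM2l c'0); apply: (le_trans h).
exact: cc'.
Qed.

Lemma exists_thresholds : exists M : nat -> R, [/\ 2 <= M 0%N,
  forall n, M n ^+ 4 <= M n.+1 & forall n s, S s ->
  \int[leb]_(x in D `&` [set x | M n <= `|s x|]) `|s x| <= 1 / (2 ^ n)%:R].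
Proof.
have e2 n : 0 < 1 / (2 ^ n)%:R :> R by rewrite divr_gt0// ltr0n expn_gt0.
have [c cP] := choice (fun n => abs_continuous_tail (e2 n)).
pose M := fix M n := if n is n'.+1 then Num.max (M n' ^+ 4) (c n) else Num.max 2 (c 0%N).
exists M; split => [|n|n s Ss] /=.
- by rewrite le_max lexx.
- by rewrite le_max lexx.
- by apply: cP => //; case: n => [|n] /=; rewrite le_max lexx orbT.
Qed.

(** The modular is taken at scale 1 only; [young_dilation] carries smallness to every scale. *)
Definition uniformly_modular_continuous (phi : R -> R) (Q : (R -> R) -> Prop) :=
  [/\ forall s, Q s -> measurable_fun D s /\ leb.-integrable D (EFin \o (phi \o s)),
      exists C, forall s, Q s -> \int[leb]_(x in D) phi (s x) <= C &
      forall e, 0 < e -> exists del, 0 < del /\ forall s, Q s ->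
        forall E, measurable E -> E `<=` D -> (leb E <= del%:E)%E ->
        \int[leb]_(x in E) phi (s x) <= e].

Section slow_modular.
Context (M : nat -> R) (M0 : 2 <= M 0%N) (MS : forall n, M n ^+ 4 <= M n.+1).
Context (MP : forall n s, S s ->
  \int[leb]_(x in D `&` [set x | M n <= `|s x|]) `|s x| <= 1 / (2 ^ n)%:R).
Let ym := slow_phi_young_pair M0 MS.
Let phi := slow_phi M.

(** [phi s <= |s| * slow |s|], and [slow_count] bounds [slow] by [k + 1] plus the indicators of the
    tails beyond [M (k + i)], where the integrals [2^-(k+i)] of [|s|] sum to [2 / 2^k]. Extended
    reals are used because integrability of [phi s] is deduced from this bound. *)
Lemma slow_modular_le k s (E : set LT) : S s -> measurable E -> E `<=` D ->
  (\int[leb]_(x in E) (phi (s x))%:E <=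
    (k.+1%:R * \int[leb]_(x in E) `|s x| + 2 / (2 ^ k)%:R)%:E)%E.
Proof.
move=> Ss mE ED.
have msD : measurable_fun D s by apply/measurable_EFinP; exact: measurable_int (intS Ss).
have ms : measurable_fun E s by exact: measurable_funS mD ED msD.
have mas : measurable_fun E (fun x => `|s x|) by exact: measurableT_comp.
have intE := integrableS mD mE ED (integrable_norm (intS Ss)).
pose A i : set LT := E `&` [set x | M (k + i)%N <= `|s x|].
have mA i : measurable (A i).
  exact: measurable_norm_ge.
pose g i x := (`|s x| * \1_(A i) x)%:E : \bar R.
have g0 i x : (0 <= g i x)%E by rewrite lee_fin mulr_ge0.
have mg i : measurable_fun E (g i).
  by apply/measurable_EFinP; apply: measurable_funM => //; exact: measurable_indic.
have mk : measurable_fun E (fun x => (k.+1%:R * `|s x|)%:E : \bar R).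
  by apply/measurable_EFinP; apply: measurable_funM => //; exact: measurable_cst.
have k0 x : (0 <= (k.+1%:R * `|s x|)%:E :> \bar R)%E by rewrite lee_fin mulr_ge0.
have msum : measurable_fun E (fun x => \sum_(0 <= i <oo) g i x)%E.
  by apply: ge0_emeasurable_sum => [i x _ _|i _]; [exact: g0|exact: mg].
apply: (@le_trans _ _ (\int[leb]_(x in E) ((k.+1%:R * `|s x|)%:E + \sum_(0 <= i <oo) g i x))%E).
  apply: ge0_le_integral; first exact: mE.
  - by move=> x _; rewrite lee_fin (young_ge0 ym).
  - by apply/measurable_EFinP; exact: (young_measurable ym ms).
  - exact: emeasurable_funD.
  move=> x Ex; have s0 := normr_ge0 (s x).
  have [n sn] := thr_unbounded M0 MS `|s x|.
  have sn' : `|s x| <= M (k + n)%N.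
    by rewrite (le_trans (ltW sn))// thr_mono// leq_addl.
  apply: (@le_trans _ _ ((k.+1%:R * `|s x|)%:E + \sum_(0 <= i < n) g i x)%E).
    rewrite sumEFin -EFinD lee_fin -[phi (s x)](_ : phi `|s x| = _); last by case: ym.
    apply: (le_trans (young_le ym s0)).
    have := ler_wpM2l s0 (slow_count M0 MS (k := k) s0 sn'); move/le_trans; apply.
    rewrite mulrDr [X in X + _ <= _]mulrC lerD2l mulr_sumr; apply: ler_sum => i _.
    rewrite indicE; case: ifPn => Mi; rewrite ?mulr0 ?mulr_ge0// mem_set//.
  by rewrite leeD2l//; apply: nneseries_lim_ge => i *; exact: g0.
rewrite ge0_integralD//; last by move=> x _; exact: nneseries_ge0.
rewrite EFinD; apply: leeD.
  rewrite -(RintegralZl _ mE intE) /Rintegral fineK//.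
  by apply: integrable_fin_num => //; exact: (integrableZl mE k.+1%:R intE).
rewrite integral_nneseries => [|//|//|i x _]; last exact: g0.
apply: (@le_trans _ _ (\sum_(0 <= i <oo) (2 / (2 ^ k)%:R / (2 ^ i.+1)%:R)%:E)%E); last first.
  by apply: epsilon_trick0; rewrite divr_ge0.
apply: lee_nneseries => [i _ _|i _]; first by apply: integral_ge0 => x _; exact: g0.
have intg : leb.-integrable E (g i).
  apply: (le_integrable mE (mg i) _ intE) => x _; rewrite /g /= lee_fin normrM normr_id.
  by rewrite ler_piMr// indicE ger0_norm// lern1 leq_b1.
rewrite -(fineK (integrable_fin_num mE intg)) lee_fin.
rewrite (_ : 2 / (2 ^ k)%:R / (2 ^ i.+1)%:R = 1 / (2 ^ (k + i))%:R); last first.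
  by rewrite expnD expnS !natrM; field; rewrite !pnatr_eq0 !expn_eq0.
apply: le_trans (MP (k + i)%N Ss).
have AE : A i `<=` E by move=> x [].
rewrite [leLHS](_ : _ = \int[leb]_(x in A i) `|s x|); last first.
  rewrite -[in RHS](setIidr AE) Rintegral_mkcondr /Rintegral; congr fine.
  apply: eq_integral => x _; rewrite patchE /g indicE.
  by case: ifPn => _; rewrite ?mulr1 ?mulr0.
pose AD : set LT := D `&` [set x | M (k + i)%N <= `|s x|].
have mAD : measurable AD by exact: measurable_norm_ge mD msD.
have ADD : AD `<=` D by move=> x [].
have AAD : A i `<=` AD by move=> x [/ED].
have intAD := integrableS mD mAD ADD (integrable_norm (intS Ss)).
exact: (le_Rintegral_subset (mA i) mAD AAD intAD (fun x _ => normr_ge0 _)).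
Qed.

End slow_modular.
End uniform_modular.

(** First [k] makes the tail term [2 / 2^k] at most [e / 2], then [E] is taken small enough for the
    weight [k + 1]; the value [k = 0] gives integrability and the uniform bound. *)
Lemma slow_uniformly_modular_continuous (a b : R) (S : (R -> R) -> Prop) (M : nat -> R) :
  a <= b -> (forall s, S s -> leb.-integrable `[a, b] (EFin \o s)) ->
  uniformly_abs_continuous leb (`[a, b]%classic : set LT) (S : set (LT -> R)) ->
  2 <= M 0%N -> (forall n, M n ^+ 4 <= M n.+1) ->
  (forall n s, S s ->
    \int[leb]_(x in (`[a, b]%classic : set LT) `&` [set x | M n <= `|s x|]) `|s x| <=
    1 / (2 ^ n)%:R) ->
  uniformly_modular_continuous a b (slow_phi M) S.
Proof.
move=> ab intS acS M0 MS MP; have ym := slow_phi_young_pair M0 MS.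
pose D : set LT := `[a, b]%classic.
have mD : measurable D by exact: measurable_itv_LT.
have DD : D `<=` D by [].
have ms s : S s -> measurable_fun D s.
  by move=> Ss; apply/measurable_EFinP; exact: measurable_int (intS _ Ss).
have mphi s : S s -> measurable_fun D (slow_phi M \o s).
  by move=> Ss; exact: (young_measurable ym (ms s Ss)).
have intphi s : S s -> leb.-integrable D (EFin \o (slow_phi M \o s)).
  move=> Ss; apply/integrableP; split; first exact/measurable_EFinP/mphi.
  apply: (@le_lt_trans _ _ (\int[leb]_(x in D) (slow_phi M (s x))%:E)%E).
    apply: ge0_le_integral; first exact: mD.
    - by move=> x _; exact: abse_ge0.
    - by apply: measurableT_comp => //; exact/measurable_EFinP/mphi.
    - exact/measurable_EFinP/mphi.
    - by move=> x _ /=; rewrite ger0_norm// (young_ge0 ym).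
  apply: le_lt_trans (slow_modular_le intS M0 MS MP 0 Ss mD DD) _; exact: ltry.
have bnd k s E : S s -> measurable E -> E `<=` D ->
    \int[leb]_(x in E) slow_phi M (s x) <=
    k.+1%:R * \int[leb]_(x in E) `|s x| + 2 / (2 ^ k)%:R.
  move=> Ss mE ED; have intE := integrableS mD mE ED (intphi s Ss).
  rewrite -lee_fin /Rintegral (fineK (integrable_fin_num mE intE)).
  exact: (slow_modular_le intS M0 MS MP k Ss mE ED).
split.
- by move=> s Ss; split; [exact: ms|exact: intphi].
- have [C [C0 CP]] := abs_continuous_L1_bounded ab intS acS.
  exists (1 * C + 2) => s Ss; apply: (le_trans (bnd 0%N s D Ss mD DD)).
  by have := CP s Ss; rewrite expn0 divr1; lra.
move=> e e0; pose k := Num.bound (4 / e).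
have k2 : 2 / (2 ^ k)%:R <= e / 2.
  have h : 4 / e <= (2 ^ k)%:R.
    apply: (le_trans (ltW (archi_boundP _))); first by rewrite divr_ge0// ltW.
    by rewrite ler_nat ltnW// ltn_expl.
  rewrite ler_pdivrMr ?ltr0n ?expn_gt0//.
  move: h; rewrite ler_pdivrMr//; move: (2 ^ k)%:R => q h.
  rewrite (_ : e / 2 * q = q * e / 2); last by rewrite mulrAC (mulrC e).
  by rewrite ler_pdivlMr// -natrM.
have ek : 0 < e / 2 / k.+1%:R by rewrite !divr_gt0.
have [del [del0 acP]] := acS _ ek.
exists del; split => // s Ss E mE ED Edel; apply: (le_trans (bnd k s E Ss mE ED)).
have := acP s Ss E mE ED Edel; rewrite ler_pdivlMr// mulrC => h.
by rewrite [leRHS]splitr; exact: lerD.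
Qed.

(** * Functionals on H^phi and sets of small measure *)

Section weak_limits.
Context (a b : R) (ab : a <= b) (phi m : R -> R) (ym : young_pair phi m).
Context (dphi : Delta' phi).
Notation D := (`[a, b]%classic : set LT).
Implicit Types (f h w : R -> R) (L : (R -> R) -> R) (E : set LT) (Q : (R -> R) -> Prop).

Let mD : measurable D. Proof. exact: measurable_itv_LT. Qed.
Let phi0 : phi 0 = 0. Proof. by case: ym. Qed.

Notation "f \|_ E" := (fun x => f x * \1_E x) (at level 40).

Lemma modular_indicE lam f E x :
  phi (f x * \1_E x / lam) = phi (f x / lam) * \1_E x.
Proof.
rewrite indicE; case: (x \in E); first by rewrite !mulr1.
by rewrite mulr0 mul0r phi0 mulr0.
Qed.

Lemma Rintegral_indicE f E : measurable E -> E `<=` D ->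
  \int[leb]_(x in D) (f x * \1_E x) = \int[leb]_(x in E) f x.
Proof. exact: pairing_indic. Qed.

Lemma measurable_indic_mul f E : measurable_fun D f -> measurable E ->
  measurable_fun D (f \|_ E).
Proof. by move=> mf mE; apply: measurable_funM; [exact: mf|exact: measurable_indic]. Qed.

Lemma integrable_indic_mul f E : measurable E -> leb.-integrable D (EFin \o f) ->
  leb.-integrable D (EFin \o (f \|_ E)).
Proof.
move=> mE intf.
have := integrable_bounded_mul mD (bounded_mfun_indic _ D mE) intf.
by congr (_.-integrable _ _); apply/funext => t /=; rewrite mulrC.
Qed.

Lemma modular_integrable_indic lam f E : measurable E ->
  modular_integrable a b phi lam f -> modular_integrable a b phi lam (f \|_ E).
Proof.
move=> mE intf; have := integrable_indic_mul mE intf.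
congr (_.-integrable _ _); apply/funext => t /=.
by rewrite modular_indicE.
Qed.

Lemma in_Hphi_indic f E : measurable E -> in_Hphi a b phi f ->
  in_Hphi a b phi (f \|_ E).
Proof.
move=> mE /(in_HphiP ab ym)[mf [lam [lam0 intf]]]; apply/(in_HphiP ab ym).
split; first exact: measurable_indic_mul.
by exists lam; split => //; exact: modular_integrable_indic.
Qed.

Lemma bounded_modular_integrable lam h B : 0 < lam -> measurable_fun D h ->
  (forall x, D x -> `|h x| <= B) -> modular_integrable a b phi lam h /\
  modular a b phi lam h <= phi (B / lam) * (b - a).
Proof.
move=> lam0 mh hB.
have le x : D x -> phi (h x / lam) <= phi (B / lam).
  move=> Dx; apply: (young_norm_le ym); rewrite normrM (gtr0_norm (x := lam^-1)) ?invr_gt0//.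
  by rewrite ler_pM2r ?invr_gt0// hB.
have int : modular_integrable a b phi lam h.
  apply: (@bounded_integrable_itv a b (phi (B / lam))).
    exact: (measurable_modular ym lam mh).
  move=> x xab; rewrite ger0_norm ?(young_ge0 ym)//; apply: le.
  by rewrite /= in_itv.
split => //.
have intc : leb.-integrable D (EFin \o cst (phi (B / lam))).
  by apply: (@bounded_integrable_itv a b `|phi (B / lam)|); first exact: measurable_cst.
have := @le_Rintegral _ _ _ leb D _ _ mD int intc le.
by rewrite (Rintegral_cst leb mD) [fine _](congr1 fine (leb_itvcc ab)).
Qed.

Lemma bounded_in_Hphi h : bounded_mfun D h -> in_Hphi a b phi h.
Proof.
move=> [mh [B hB]]; apply/(in_HphiP ab ym); split => //; exists 1; split => //.
by case: (bounded_modular_integrable ltr01 mh hB).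
Qed.

(** Here Delta' turns a modular estimate into a norm estimate: after dilation, the integrals of
    [k * phi s] and of [k'] over [E] are each at most 1/2, so the restricted function has norm at
    most [lam]. *)
Lemma small_modular Q lam : uniformly_modular_continuous a b phi Q -> 0 < lam ->
  exists del, 0 < del /\ forall s, Q s -> forall E, measurable E -> E `<=` D ->
  (leb E <= del%:E)%E -> modular_integrable a b phi lam (s \|_ E) /\
  modular a b phi lam (s \|_ E) <= 1.
Proof.
move=> [Qint _ Qac] lam0; have [k [k' [k0 k'0 kk']]] := young_dilation ym dphi lam0.
have e0 : 0 < 1 / (2 * (k + 1)) :> R by rewrite divr_gt0// mulr_gt0// ltr_wpDl.
have [del [del0 delP]] := Qac _ e0.
have d0 : 0 < 1 / (2 * (k' + 1)) :> R by rewrite divr_gt0// mulr_gt0// ltr_wpDl.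
exists (Num.min del (1 / (2 * (k' + 1)))); split; first by rewrite lt_min del0.
move=> s Qs E mE ED Edel; have [ms ints] := Qint s Qs.
have Ef : leb E \is a fin_num.
  by rewrite ge0_fin_numE; [exact: lout_itv_lty ED|exact: measure_ge0].
have {Edel} [E1 E2] : (leb E <= del%:E)%E /\ fine (leb E) <= 1 / (2 * (k' + 1)).
  rewrite -(fineK Ef) !lee_fin in Edel *; move: Edel; rewrite le_min => /andP[-> ->].
  by [].
have intc : leb.-integrable D (EFin \o cst k').
  by apply: (@bounded_integrable_itv a b `|k'|); first exact: measurable_cst.
have intk : leb.-integrable D (EFin \o (fun x => k * phi (s x))).
  exact: (integrableZl mD k ints).
have intd : leb.-integrable D (EFin \o (fun x => k * phi (s x) + k')).
  exact: (integrableD mD intk intc).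
have int : modular_integrable a b phi lam s.
  apply: (le_integrable mD _ _ intd).
    exact/measurable_EFinP/(measurable_modular ym lam ms).
  move=> x _; rewrite /= lee_fin ger0_norm ?(young_ge0 ym)//.
  by apply: (le_trans (kk' (s x))); exact: ler_norm.
split; first exact: modular_integrable_indic.
have -> : modular a b phi lam (s \|_ E) = \int[leb]_(x in E) phi (s x / lam).
  rewrite -(Rintegral_indicE _ mE ED); apply: eq_Rintegral => x _.
  exact: modular_indicE.
have sE f : leb.-integrable D (EFin \o f) -> leb.-integrable E (EFin \o f).
  exact: integrableS mD mE ED.
apply: (@le_trans _ _ (\int[leb]_(x in E) (k * phi (s x) + k'))).
  apply: le_Rintegral; [exact: mE|exact: sE int|exact: sE intd|].
  by move=> x _; exact: kk'.
rewrite (RintegralD mE (sE _ intk) (sE _ intc)) (RintegralZl k mE (sE _ ints)).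
rewrite (Rintegral_cst leb mE).
have h1 : k * \int[leb]_(x in E) phi (s x) <= 1 / 2.
  apply: (@le_trans _ _ (k * (1 / (2 * (k + 1))))).
    by rewrite ler_wpM2l// delP.
  rewrite mulrA mulr1 ler_pdivrMr; last by rewrite mulr_gt0// ltr_wpDl.
  by lra.
have h2 : k' * fine (leb E) <= 1 / 2.
  apply: (@le_trans _ _ (k' * (1 / (2 * (k' + 1))))); first by rewrite ler_wpM2l.
  rewrite mulrA mulr1 ler_pdivrMr; last by rewrite mulr_gt0// ltr_wpDl.
  by lra.
by rewrite [leRHS]splitr; exact: lerD.
Qed.

Lemma dual_small Q L e : uniformly_modular_continuous a b phi Q ->
  Hphi_dual a b phi L -> 0 < e ->
  exists del, 0 < del /\ forall s, Q s -> forall E, measurable E -> E `<=` D ->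
  (leb E <= del%:E)%E -> `|L (s \|_ E)| <= e.
Proof.
move=> Qu LD e0; have [C [C0 CP]] := Hphi_dual_modular ab ym LD.
have [del [del0 delP]] := small_modular Qu (divr_gt0 e0 C0).
exists del; split => // s Qs E mE ED Edel.
have [int mod1] := delP s Qs E mE ED Edel.
have [Qint _ _] := Qu; have [ms _] := Qint s Qs.
have := CP _ _ (measurable_indic_mul ms mE) (divr_gt0 e0 C0) int mod1.
by rewrite mulrCA divff ?mulr1// gt_eqF.
Qed.

Lemma umc_singleton f : measurable_fun D f -> leb.-integrable D (EFin \o (phi \o f)) ->
  uniformly_modular_continuous a b phi (fun g => g = f).
Proof.
move=> mf intf; split => [s ->//||e e0].
  by exists (\int[leb]_(x in D) phi (f x)) => s ->.
have [del [del0 delP]] := integral_abs_continuous mD intf e0.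
exists del; split => // s -> E mE ED Edel.
apply: le_trans (delP E mE ED Edel); rewrite le_eqVlt; apply/orP; left; apply/eqP.
by apply: eq_Rintegral => x _; rewrite ger0_norm// (young_ge0 ym).
Qed.

Lemma umc_union Q Q' : uniformly_modular_continuous a b phi Q ->
  uniformly_modular_continuous a b phi Q' ->
  uniformly_modular_continuous a b phi (fun g => Q g \/ Q' g).
Proof.
move=> [h1 [C CP] h3] [h1' [C' CP'] h3']; split.
- by move=> s [/h1|/h1'].
- by exists (Num.max C C') => s [/CP|/CP'] h; rewrite le_max h ?orbT.
- move=> e e0; have [del [del0 delP]] := h3 e e0; have [del' [del'0 delP']] := h3' e e0.
  exists (Num.min del del'); split; first by rewrite lt_min del0.
  move=> s Qs E mE ED Edel; case: Qs => Qs.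
    apply: delP => //; apply: (le_trans Edel).
    by rewrite lee_fin ge_min lexx.
  apply: delP' => //; apply: (le_trans Edel).
  by rewrite lee_fin ge_min lexx orbT.
Qed.

(** [young_small] bounds the norm of a bounded function by a multiple of its sup bound; smallness on
    indicators is [dual_small] for the family reduced to the constant 1. *)
Lemma dual_abs_continuous_functional L : Hphi_dual a b phi L ->
  abs_continuous_functional leb D L.
Proof.
move=> LD; have [Ladd [Lhom _]] := LD; split.
- by move=> f h bf bh; apply: Ladd; exact: bounded_in_Hphi.
- by move=> k f bf; apply: Lhom; exact: bounded_in_Hphi.
- have [C [C0 CP]] := Hphi_dual_modular ab ym LD.
  have ba : 0 <= b - a by rewrite subr_ge0.
  have [t [t0 tP]] := young_small ym ba.
  exists (C / t) => h B mh hB; apply/ler_addgt0Pr => e e0.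
  have B0 : 0 <= B.
    by apply: le_trans (hB a _); rewrite //= in_itv/= lexx.
  (* [B] may be 0 but a scale must be positive; the slack is chosen to cost exactly [e]. *)
  pose B' := B + e * (t / C).
  have B'0 : 0 < B' by rewrite ltr_wpDl// mulr_gt0// divr_gt0.
  have hB' x : D x -> `|h x| <= B'.
    by move=> /hB/le_trans; apply; rewrite lerDl mulr_ge0 ?divr_ge0// ltW.
  have lam0 : 0 < B' / t by rewrite divr_gt0.
  have [int mod1] := bounded_modular_integrable lam0 mh hB'.
  have tE : B' / (B' / t) = t by rewrite invf_div mulrCA divff ?mulr1// gt_eqF.
  rewrite tE in mod1.
  have := CP h _ mh lam0 int (le_trans mod1 tP); rewrite /B'.
  rewrite (_ : C * ((B + e * (t / C)) / t) = C / t * B + e)//.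
  by field; rewrite !gt_eqF.
- move=> e e0.
  have u1 : uniformly_modular_continuous a b phi (fun g => g = cst 1).
    apply: umc_singleton; first exact: measurable_cst.
    by apply: (@bounded_integrable_itv a b `|phi 1| (cst (phi 1))); first exact: measurable_cst.
  have [del [del0 delP]] := dual_small u1 LD e0.
  exists del; split => // E mE ED Edel; have := delP _ erefl E mE ED Edel.
  by rewrite (_ : (fun x => _) = \1_E)//; apply/funext => x; rewrite mul1r.
Qed.

End weak_limits.

(** * Weak compactness *)

Lemma integrable_level_small (a b : R) (f : R -> R) (del : R) :
  leb.-integrable `[a, b] (EFin \o f) -> 0 < del ->
  exists c, 0 < c /\
    (leb (`[a, b] `&` [set x | (c <= `|f x|)%R])%classic <= del%:E)%E.
Proof.
move=> intf del0; pose D : set LT := `[a, b]%classic.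
have mD : measurable D by exact: measurable_itv_LT.
have mf : measurable_fun D f by apply/measurable_EFinP; exact: measurable_int intf.
pose C := \int[leb]_(x in D) `|f x|.
have C0 : 0 <= C by apply: Rintegral_ge0.
pose c := (C + 1) / del; have c0 : 0 < c by rewrite divr_gt0// ltr_wpDl.
exists c; split => //.
pose E : set LT := D `&` [set x | c <= `|f x|].
have mE : measurable E by exact: measurable_norm_ge.
have ED : E `<=` D by move=> x [].
have Ef : leb E \is a fin_num.
  by rewrite ge0_fin_numE; [exact: lout_itv_lty ED|exact: measure_ge0].
have intE := integrableS mD mE ED (integrable_norm intf).
have h : c * fine (leb E) <= C.
  apply: (@le_trans _ _ (\int[leb]_(x in E) `|f x|)).
    rewrite -(Rintegral_cst leb mE c); apply: le_Rintegral; [exact: mE| |exact: intE|].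
      apply: integrableS mD mE ED _.
      by apply: (@bounded_integrable_itv a b `|c|); first exact: measurable_cst.
    by move=> x [].
  exact: (le_Rintegral_subset mE mD ED (integrable_norm intf) (fun x _ => normr_ge0 _)).
apply: (@le_trans _ _ (fine (leb E))%:E); first by rewrite (fineK Ef).
rewrite lee_fin -(ler_pM2l c0) (le_trans h)// /c mulrC mulrCA divff ?gt_eqF//.
by rewrite mulr1 lerDl.
Qed.

Lemma mul_indicI (T : Type) (K : pzRingType) (f : T -> K) (A B : set T) (x : T) :
  f x * \1_B x * \1_A x = f x * \1_(A `&` B) x.
Proof.
rewrite !indicE in_setI -mulrA; case: (x \in A); case: (x \in B);
  by rewrite ?(mulr0, mulr1, mul0r).
Qed.

Lemma mul_indicC (T : Type) (K : pzRingType) (f : T -> K) (A : set T) (x : T) :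
  f x * \1_(~` A) x = f x - f x * \1_A x.
Proof.
by rewrite !indicE in_setC; case: (x \in A); rewrite ?mulr0 mulr1 ?subrr ?subr0.
Qed.

(** * Approximation of functionals by bounded densities *)

Section dual_approximation.
Context (a b : R) (ab : a <= b) (phi m : R -> R) (ym : young_pair phi m).
Context (dphi : Delta' phi).
Notation D := (`[a, b]%classic : set LT).
Implicit Types (f h w s : R -> R) (L : (R -> R) -> R) (E : set LT) (Q : (R -> R) -> Prop).
Let mD : measurable D. Proof. exact: measurable_itv_LT. Qed.
Notation "f \|_ E" := (fun x => f x * \1_E x) (at level 40).

Lemma umc_in_Hphi Q s : uniformly_modular_continuous a b phi Q -> Q s ->
  in_Hphi a b phi s.
Proof.
move=> [Qint _ _] Qs; apply/(in_HphiP ab ym); have [ms ints] := Qint s Qs.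
split => //; exists 1; split => //; move: ints; congr (_.-integrable _ _).
by apply/funext => t /=; rewrite divr1.
Qed.

Lemma umc_L1 Q : uniformly_modular_continuous a b phi Q ->
  exists C, 0 < C /\ forall s, Q s -> leb.-integrable D (EFin \o s) /\
  \int[leb]_(x in D) `|s x| <= C.
Proof.
move=> [Qint [C CP] _]; have [c [c0 cP]] := modular_integrable_L1 ab ym.
exists (`|C| + c); split; first by rewrite ltr_wpDl.
move=> s Qs; have [ms ints] := Qint s Qs.
have ints1 : modular_integrable a b phi 1 s.
  by move: ints; congr (_.-integrable _ _); apply/funext => t /=; rewrite divr1.
have [int sle] := cP s 1 ms ltr01 ints1; split => //.
apply: (le_trans sle); rewrite mul1r lerD2r.
apply: le_trans (ler_norm C); apply: le_trans (CP s Qs).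
by rewrite le_eqVlt; apply/orP; left; apply/eqP/eq_Rintegral => x _; rewrite divr1.
Qed.

Lemma umc_abs_continuous Q : uniformly_modular_continuous a b phi Q ->
  uniformly_abs_continuous leb D (Q : set (LT -> R)).
Proof.
move=> Qu e e0; have [c [c0 cP]] := modular_integrable_L1 ab ym.
have lam0 : 0 < e / (1 + c) by rewrite divr_gt0// addr_gt0.
have [del [del0 delP]] := small_modular ym dphi Qu lam0.
exists del; split => // s Qs E mE ED Edel.
have [int mod1] := delP s Qs E mE ED Edel.
have [Qint _ _] := Qu; have [ms _] := Qint s Qs.
have [_ sle] := cP _ _ (measurable_indic_mul ms mE) lam0 int.
rewrite -(Rintegral_indicE _ mE ED).
have -> : \int[leb]_(x in D) (`|s x| * \1_E x) = \int[leb]_(x in D) `|s x * \1_E x|.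
  by apply: eq_Rintegral => x _; rewrite normrM (ger0_norm (x := \1_E x)).
apply: (le_trans sle); rewrite -[leRHS](divfK (x := 1 + c)) ?gt_eqF ?addr_gt0//.
by rewrite ler_pM2l// lerD2r.
Qed.

(* If w is the density of L on bounded functions, then on {|w| < c} the functional
   L is integration against w, and {c <= |w|} contributes little, uniformly on Q. *)
Lemma dual_approx Q L e : uniformly_modular_continuous a b phi Q ->
  Hphi_dual a b phi L -> 0 < e -> exists w, bounded_mfun D w /\
  forall s, Q s -> `|L s - pairing a b w s| <= e.
Proof.
move=> Qu LD e0; have Lac := dual_abs_continuous_functional ab ym dphi LD.
have [w [intw wP]] := abs_continuous_functional_repr mD (leb_itvcc_lty a b) Lac.
have [del [del0 delP]] := dual_small ab ym dphi Qu LD e0.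
have [c [c0 cP]] := integrable_level_small intw del0.
pose E : set LT := D `&` [set x | c <= `|w x|].
have mw : measurable_fun D w by apply/measurable_EFinP; exact: measurable_int intw.
have mE : measurable E by exact: measurable_norm_ge.
have mCE : measurable (~` E) by exact: measurableC.
have ED : E `<=` D by move=> x [].
pose w' := w \|_ (~` E).
have w'c x : D x -> `|w' x| <= c.
  move=> Dx; rewrite /w' indicE; case: (boolP (x \in ~` E)); last first.
    by rewrite mulr0 normr0 ltW.
  rewrite inE mulr1 => nE; rewrite leNgt; apply/negP => cw; apply: nE; split => //=.
  exact: ltW.
have mw' : measurable_fun D w' by exact: measurable_indic_mul.
exists w'; split; first by split => //; exists c.
move=> s Qs; have sH := umc_in_Hphi Qu Qs; have [Ladd _] := LD.
have splitE (f : R -> R) (A : set LT) : f = (fun t => (f t * \1_(~` A) t + f t * \1_A t)%coqR).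
  apply/funext => t; rewrite RplusE !RmultE !indicE in_setC.
  by case: (t \in A); rewrite /= !(mulr1, mulr0) ?addr0 ?add0r.
have -> : L s = L (s \|_ (~` E)) + L (s \|_ E).
  rewrite {1}(splitE s E) Ladd//; exact: (in_Hphi_indic ab ym).
(* [w] represents [L] on bounded functions only, while [s] may be unbounded: dropping the set [E2]
   where [|s| >= c2] changes [L] and the pairing by at most [eta / 2] each, [|w'|] being at most
   [c]. *)
suff -> : L (s \|_ (~` E)) = pairing a b w' s.
  by rewrite addrAC subrr add0r; exact: delP.
have [Qint _ _] := Qu; have [ms intphi] := Qint s Qs.
have [C [_ Qs1]] := umc_L1 Qu; have [ints _] := Qs1 s Qs.
have us := umc_singleton ym ms intphi.
apply/eqP; rewrite -subr_eq0 -normr_le0; apply/ler_addgt0Pr => eta eta0; rewrite add0r.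
have eta2 : 0 < eta / 2 by rewrite divr_gt0.
have [d1 [d10 d1P]] := dual_small ab ym dphi us LD eta2.
have [d2 [d20 d2P]] := integral_abs_continuous mD ints (divr_gt0 eta2 c0).
have d0 : 0 < Num.min d1 d2 by rewrite lt_min d10.
have [c2 [c20 c2P]] := integrable_level_small ints d0.
pose E2 : set LT := D `&` [set x | c2 <= `|s x|].
have mE2 : measurable E2 by exact: measurable_norm_ge.
have mCE2 : measurable (~` E2) by exact: measurableC.
have E2D : E2 `<=` D by move=> x [].
have [E2d1 E2d2] : (leb E2 <= d1%:E)%E /\ (leb E2 <= d2%:E)%E.
  by split; apply: (le_trans c2P); rewrite lee_fin ge_min lexx ?orbT.
pose E3 : set LT := E2 `&` ~` E.
have mE3 : measurable E3 by exact: measurableI.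
have E3D : E3 `<=` D by move=> x [/E2D].
have E3d1 : (leb E3 <= d1%:E)%E.
  by apply: le_trans E2d1; apply: le_outer_measure => x [].
pose h := (s \|_ (~` E)) \|_ (~` E2).
have bh : bounded_mfun D h.
  split; first by apply: measurable_indic_mul => //; exact: measurable_indic_mul.
  exists c2 => x Dx; rewrite /h !indicE; case: (boolP (x \in ~` E2)); last first.
    by rewrite mulr0 normr0 ltW.
  rewrite inE mulr1 => nE; rewrite normrM; apply: (@le_trans _ _ `|s x|).
    by rewrite ler_piMr// ger0_norm// lern1 leq_b1.
  rewrite leNgt; apply/negP => cs; apply: nE; split => //=; exact: ltW.
have -> : L (s \|_ (~` E)) = L h + L (s \|_ E3).
  rewrite {1}(splitE (s \|_ (~` E)) E2) Ladd; last 2 first.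
  - by apply: (in_Hphi_indic ab ym) => //; exact: (in_Hphi_indic ab ym).
  - by apply: (in_Hphi_indic ab ym) => //; exact: (in_Hphi_indic ab ym).
  congr (_ + L _); apply/funext => t; rewrite -[RHS](mul_indicI s E2 (~` E)) //.
have bw' : bounded_mfun D w' by split => //; exists c.
have bsE2 := integrable_indic_mul mE2 ints.
have bsCE2 := integrable_indic_mul mCE2 ints.
have -> : pairing a b w' s = L h + \int[leb]_(x in D) (w' x * (s x * \1_E2 x)).
  rewrite wP// -RintegralD//; last 2 first.
  - exact: integrable_bounded_mul.
  - exact: integrable_bounded_mul.
  apply: eq_Rintegral => x _; rewrite /h /w' (mul_indicC (s \|_ (~` E)) E2) /=.
  by move: (\1_(~` E) x : R) (\1_E2 x : R) (s x) (w x) => ? ? ? ?; ring.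
rewrite opprD addrACA subrr add0r; apply: (le_trans (ler_normB _ _)).
rewrite [leRHS]splitr; apply: lerD; first exact: d1P.
apply: (le_trans (le_normr_Rintegral_mul mD mw' w'c bsE2)).
rewrite mulrC -ler_pdivlMr//; apply: le_trans (d2P E2 mE2 E2D E2d2).
rewrite -(Rintegral_indicE (fun x => `|s x|) mE2 E2D) le_eqVlt; apply/orP; left; apply/eqP.
by apply: eq_Rintegral => x _; rewrite normrM (ger0_norm (x := \1_E2 x)).
Qed.

End dual_approximation.

Lemma measurable_sg : measurable_fun setT (Num.sg : R -> R).
Proof.
apply: (@nondecreasing_measurable R) => // x y xy.
by case: (sgrP x) xy => hx; case: (sgrP y) => hy xy //; lra.
Qed.

Section young_derivative.
Context (phi m : R -> R) (ym : young_pair phi m).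

(** The even function [phi] has slope [m |u| * sg u] at [u]; the support lines extend to all reals
    because [sg u * v <= |v|]. *)
Lemma young_signed_support u v : phi u + m `|u| * Num.sg u * (v - u) <= phi v.
Proof.
have [_ supp phiN _] := ym.
have := supp _ _ (normr_ge0 u) (normr_ge0 v); rewrite !phiN; apply: le_trans.
rewrite lerD2l -mulrA ler_wpM2l ?(young_deriv_ge0 ym)//.
rewrite mulrBr -normrEsg lerD2r (le_trans (ler_norm _))// normrM.
by rewrite ler_piMl// normr_sg lern1 leq_b1.
Qed.

Lemma young_deriv_measurable d (T : measurableType d) (D : set T) (f : T -> R) :
  measurable_fun D f -> measurable_fun D (fun x => m `|f x|).
Proof.
move=> mf; have [[mm _ _] _ _ _] := ym.
have -> : (fun x => m `|f x|) = (fun x => m (Num.max x 0)) \o (fun x => `|f x|).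
  by apply/funext => x /=; rewrite max_l.
apply: measurableT_comp; last exact: measurableT_comp.
apply: (@nondecreasing_measurable R) => // x y xy.
by apply: mm; rewrite le_max lexx orbT/= ge_max !le_max xy lexx orbT.
Qed.

End young_derivative.

(** * Representation of pointwise limits of the family *)

Section limit_representation.
Context (a b : R) (ab : a <= b) (phi m : R -> R) (ym : young_pair phi m).
Context (dphi : Delta' phi).
Notation D := (`[a, b]%classic : set LT).
Implicit Types (f h w s : R -> R) (L : (R -> R) -> R) (E : set LT).
Let mD : measurable D. Proof. exact: measurable_itv_LT. Qed.
Notation "f \|_ E" := (fun x => f x * \1_E x) (at level 40).

(** A point of the closure of [S] for pointwise convergence on the dual: a candidate weak limit,
    given by its values on functionals before any function is known to represent it. *)
Definition pointwise_adherent (S : (R -> R) -> Prop) (l : ((R -> R) -> R) -> R) :=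
  forall Ls e, 0 < e -> Forall (Hphi_dual a b phi) Ls ->
  exists s, S s /\ Forall (fun L => `|L s - l L| < e) Ls.

(** One member of [S] close to [l] at all three functionals transfers the relation; the tolerance
    [e / (|k| + 2)] accounts for the weights [|k|], 1 and 1. *)
Lemma pointwise_adherent_linear S l k L1 L2 L3 : pointwise_adherent S l ->
  Hphi_dual a b phi L1 -> Hphi_dual a b phi L2 -> Hphi_dual a b phi L3 ->
  (forall s, S s -> L3 s = k * L1 s + L2 s) -> l L3 = k * l L1 + l L2.
Proof.
move=> Sl D1 D2 D3 h; apply/eqP; rewrite -subr_eq0 -normr_le0.
apply/ler_addgt0Pr => e e0; rewrite add0r.
have k0 : 0 < `|k| + 2 by rewrite ltr_wpDl.
have [s [Ss]] := Sl (L1 :: L2 :: L3 :: nil) _ (divr_gt0 e0 k0)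
  (Forall_cons _ D1 (Forall_cons _ D2 (Forall_cons _ D3 (Forall_nil _)))).
move=> sLs; have h1 := Forall_inv sLs; have h2 := Forall_inv (Forall_inv_tail sLs).
have h3 := Forall_inv (Forall_inv_tail (Forall_inv_tail sLs)).
rewrite (_ : _ - _ = k * (L1 s - l L1) + (L2 s - l L2) - (L3 s - l L3)); last first.
  by rewrite h//; ring.
rewrite (_ : e = `|k| * (e / (`|k| + 2)) + e / (`|k| + 2) + e / (`|k| + 2)); last first.
  by field; rewrite gt_eqF.
apply: (le_trans (ler_normB _ _)); apply: lerD; last exact: ltW.
apply: (le_trans (ler_normD _ _)); apply: lerD; last exact: ltW.
by rewrite normrM ler_wpM2l// ltW.
Qed.

Lemma pointwise_adherent_le S l L c : pointwise_adherent S l ->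
  Hphi_dual a b phi L -> (forall s, S s -> `|L s| <= c) -> `|l L| <= c.
Proof.
move=> Sl LD h; apply/ler_addgt0Pr => e e0.
have [s [Ss sLs]] := Sl (L :: nil) e e0 (Forall_cons _ LD (Forall_nil _)).
have sL := Forall_inv sLs.
rewrite (_ : l L = L s - (L s - l L)); last by ring.
by apply: (le_trans (ler_normB _ _)); apply: lerD; [exact: h|exact: ltW].
Qed.

Context (S : (R -> R) -> Prop) (l : ((R -> R) -> R) -> R).
Context (Su : uniformly_modular_continuous a b phi S).
Context (Sl : pointwise_adherent S l).

Lemma adherent_abs_continuous_functional :
  abs_continuous_functional leb D (fun h => l (pairing a b h)).
Proof.
have [C [C0 CP]] := umc_L1 ab ym Su.
have Sint s : S s -> leb.-integrable D (EFin \o s) by move=> /CP[].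
have Sinth s h : S s -> bounded_mfun D h -> leb.-integrable D (EFin \o (fun x => s x * h x)).
  move=> Ss bh; have := integrable_bounded_mul mD bh (Sint s Ss).
  by congr (_.-integrable _ _); apply/funext => t /=; rewrite mulrC.
have pd h : bounded_mfun D h -> Hphi_dual a b phi (pairing a b h).
  exact: (pairing_dual ab ym).
split.
- move=> f h bf bh.
  have bfh := bounded_mfunD bf bh.
  rewrite (pointwise_adherent_linear (k := 1) Sl (pd _ bf) (pd _ bh) (pd _ bfh)) ?mul1r//.
  move=> s Ss; rewrite mul1r /pairing -(RintegralD mD (Sinth _ _ Ss bf) (Sinth _ _ Ss bh)).
  by apply: eq_Rintegral => x _; rewrite mulrDr.
- move=> k h bh; have bkh := bounded_mfunZ k bh.
  (* Homogeneity is the case of two equal functionals: [(k - 1) * x + x = k * x]. *)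
  rewrite (pointwise_adherent_linear (k := k - 1) Sl (pd _ bh) (pd _ bh) (pd _ bkh)).
    by ring.
  move=> s Ss; rewrite (_ : (k - 1) * _ + _ = k * pairing a b h s); last by ring.
  rewrite /pairing -(RintegralZl k mD (Sinth _ _ Ss bh)).
  by apply: eq_Rintegral => x _; rewrite mulrCA.
- exists C => h B mh hB; have bh : bounded_mfun D h by split => //; exists B.
  apply: (pointwise_adherent_le Sl (pd _ bh)) => s Ss.
  have B0 : 0 <= B by apply: le_trans (hB a _) => //=; rewrite in_itv/= lexx.
  have [ints sC] := CP s Ss.
  rewrite /pairing (_ : \int[leb]_(x in D) _ = \int[leb]_(x in D) (h x * s x)); last first.
    by apply: eq_Rintegral => x _; rewrite mulrC.
  apply: (le_trans (le_normr_Rintegral_mul mD mh hB ints)).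
  by rewrite mulrC ler_wpM2r.
- move=> e e0; have [del [del0 delP]] := umc_abs_continuous ab ym dphi Su e0.
  exists del; split => // E mE ED Edel.
  apply: (pointwise_adherent_le Sl (pd _ (bounded_mfun_indic _ D mE))) => s Ss.
  rewrite pairing_indic//; apply: le_trans (delP s Ss E mE ED Edel).
  apply: le_normr_Rintegral; first exact: mE.
  exact: integrableS mD mE ED (Sint s Ss).
Qed.

Lemma adherent_density : exists f, leb.-integrable D (EFin \o f) /\
  forall h, bounded_mfun D h -> l (pairing a b h) = \int[leb]_(x in D) (h x * f x).
Proof.
exact: abs_continuous_functional_repr mD (leb_itvcc_lty a b)
  adherent_abs_continuous_functional.
Qed.

Section density.
Context (f : R -> R) (intf : leb.-integrable D (EFin \o f)).
Context (fP : forall h, bounded_mfun D h ->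
  l (pairing a b h) = \int[leb]_(x in D) (h x * f x)).
Let mf : measurable_fun D f.
Proof. by apply/measurable_EFinP; exact: measurable_int intf. Qed.

(* The Fenchel-Young support line of phi at f, cut off where f is large, is tested
   on members of S near l. *)
Lemma adherent_modular_le (C : R) E c : measurable E -> E `<=` D ->
  (forall x, D x -> ~ E x -> `|f x| <= c) ->
  (forall s, S s -> \int[leb]_(x in D) phi (s x) <= C) ->
  leb.-integrable D (EFin \o (fun x => phi (f x) * \1_(~` E) x)) /\
  \int[leb]_(x in D) (phi (f x) * \1_(~` E) x) <= C + 1.
Proof.
move=> mE ED fc SC; have [[mm _ _] _ _ _] := ym.
have mCE : measurable (~` E) by exact: measurableC.
(* Outside [E], [|f|] is at most [c], so this slope of [phi] at [f] is bounded and [fP] gives the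
   value of [l] at its pairing. *)
pose w := (fun x => m `|f x| * Num.sg (f x)) \|_ (~` E).
have mw : measurable_fun D w.
  apply: measurable_indic_mul => //; apply: measurable_funM.
    exact: (young_deriv_measurable ym mf).
  exact: measurableT_comp measurable_sg mf.
have bw : bounded_mfun D w.
  split => //; exists (m `|c|) => x Dx; rewrite /w indicE.
  have [/set_mem nE|_] := boolP (x \in ~` E); last first.
    by rewrite mulr0 normr0 (young_deriv_ge0 ym).
  rewrite mulr1 normrM (ger0_norm (young_deriv_ge0 ym _))//.
  apply: (@le_trans _ _ (m `|f x|)).
    by rewrite ler_piMr ?(young_deriv_ge0 ym)// normr_sg lern1 leq_b1.
  by apply: mm; rewrite normr_ge0/=; apply: le_trans (fc x Dx nE) (ler_norm _).
have bphi : bounded_mfun D (fun x => phi (f x) * \1_(~` E) x).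
  split; first by apply: measurable_indic_mul => //; exact: (young_measurable ym mf).
  exists (phi c) => x Dx; rewrite indicE.
  have [/set_mem nE|_] := boolP (x \in ~` E); last first.
    by rewrite mulr0 normr0 (young_ge0 ym).
  by rewrite mulr1 ger0_norm ?(young_ge0 ym)//; apply: (young_norm_le ym); exact: fc.
have [Sint _ _] := Su.
have intphi : leb.-integrable D (EFin \o (fun x => phi (f x) * \1_(~` E) x)).
  have [mphi [B BP]] := bphi.
  by apply: (@bounded_integrable_itv a b B); [exact: mphi|move=> x xab; exact: BP].
split => //.
(* The tolerance 1 is the source of [C + 1]: the integrated support line compares [phi f] outside
   [E] with [phi s]. *)
have [s [Ss sws]] :=
  Sl ltr01 (Forall_cons _ (pairing_dual ab ym bw) (Forall_nil _)).
have sw := Forall_inv sws.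
have [C' [_ CP']] := umc_L1 ab ym Su; have [ints _] := CP' s Ss.
have [_ intphis] := Sint s Ss.
have intws := integrable_bounded_mul mD bw ints.
have intwf := integrable_bounded_mul mD bw intf.
have : \int[leb]_(x in D) (phi (f x) * \1_(~` E) x + w x * s x) <=
    \int[leb]_(x in D) (phi (s x) + w x * f x).
  apply: le_Rintegral; first exact: mD.
  - exact: (integrableD mD intphi intws).
  - exact: (integrableD mD intphis intwf).
  move=> x _; rewrite /w indicE; case: (x \in ~` E).
    have := young_signed_support ym (f x) (s x); rewrite !mulr1.
    by rewrite mulrBr addrA lerBlDr.
  by rewrite !mulr0 !mul0r !addr0 (young_ge0 ym).
rewrite (RintegralD mD intphi intws) (RintegralD mD intphis intwf).
have := SC s Ss; rewrite -(fP bw).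
have pE : pairing a b w s = \int[leb]_(x in D) (w x * s x).
  by apply: eq_Rintegral => x _; rewrite mulrC.
move: sw; rewrite pE ltr_norml => /andP[h1 _] h2 h3.
have lin (p q r t k : R) : -1 < q - t -> r <= k -> p + q <= r + t -> p <= k + 1 by lra.
exact: lin h1 h2 h3.
Qed.

(** For each [n] the level is raised until the cut-off set [E] has measure at most [1 / (n + 1)];
    the truncation at [n] then has integral at most 1 over [E], whence the bound [C + 2] for every
    [n]. *)
Lemma adherent_modular_integrable : leb.-integrable D (EFin \o (phi \o f)).
Proof.
have [_ [C CP] _] := Su.
apply: (@ge0_integrable_truncations _ _ _ leb D (phi \o f) (C + 2) mD).
- exact: (young_measurable ym mf).
- by move=> x _; exact: (young_ge0 ym).
move=> n; have n0 : 0 < n.+1%:R^-1 :> R by rewrite invr_gt0.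
have [c [c0 cP]] := integrable_level_small intf n0.
pose E : set LT := D `&` [set x | c <= `|f x|].
have mE : measurable E by exact: measurable_norm_ge.
have ED : E `<=` D by move=> x [].
have fc x : D x -> ~ E x -> `|f x| <= c.
  by move=> Dx nE; rewrite leNgt; apply/negP => cf; apply: nE; split => //=; exact: ltW.
have [int1 le1] := adherent_modular_le mE ED fc CP.
have int2 : leb.-integrable D (EFin \o (fun x => n%:R * \1_E x)).
  apply: (@bounded_integrable_itv a b n%:R).
    by apply: measurable_funM; [exact: measurable_cst|exact: measurable_indic].
  move=> x _; rewrite normrM (ger0_norm (x := n%:R))// ler_piMr//.
  by rewrite indicE ger0_norm// lern1 leq_b1.
have int3 := integrableD mD int1 int2.
apply: (@le_trans _ _ (\int[leb]_(x in D)
    ((phi (f x) * \1_(~` E) x + n%:R * \1_E x)%:E))%E).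
  apply: ge0_le_integral; first exact: mD.
  - by move=> x _; rewrite lee_fin le_min (young_ge0 ym)/=.
  - apply/measurable_EFinP; apply: measurable_minr; last exact: measurable_cst.
    exact: (young_measurable ym mf).
  - exact: measurable_int int3.
  move=> x _; rewrite lee_fin !indicE in_setC; case: (x \in E) => /=.
    by rewrite mulr0 add0r mulr1 ge_min lexx orbT.
  by rewrite mulr0 addr0 mulr1 ge_min lexx.
have fin3 := integrable_fin_num mD int3.
rewrite -(fineK fin3) lee_fin -[leLHS]/(\int[leb]_(x in D) _).
rewrite (RintegralD mD int1 int2).
have -> : \int[leb]_(x in D) (n%:R * \1_E x) = n%:R * fine (leb E).
  rewrite -(Rintegral_cst leb mE) -(Rintegral_indicE (fun=> n%:R) mE ED) //.
have Ef : leb E \is a fin_num.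
  by rewrite ge0_fin_numE; [exact: lout_itv_lty ED|exact: measure_ge0].
have Ele : fine (leb E) <= n.+1%:R^-1.
  by rewrite -lee_fin; apply: le_trans cP; rewrite (fineK Ef).
rewrite (_ : C + 2 = C + 1 + 1); last by ring.
apply: lerD => //; apply: (@le_trans _ _ (n%:R * n.+1%:R^-1)).
  by rewrite ler_wpM2l.
by rewrite ler_pdivrMr// mul1r ler_nat.
Qed.

(** [f] is adjoined to [S] so that a single bounded [w] approximates [L] both on the family and at
    [f]; four errors of [e / 4] link [L f] to [l L]. *)
Lemma adherent_repr L : Hphi_dual a b phi L -> L f = l L.
Proof.
move=> LD.
have Qu := umc_union Su (umc_singleton ym mf adherent_modular_integrable).
apply/eqP; rewrite -subr_eq0 -normr_le0; apply/ler_addgt0Pr => e e0; rewrite add0r.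
have e4 : 0 < e / 4 by rewrite divr_gt0.
have [w [bw wP]] := dual_approx ab ym dphi Qu LD e4.
have [s [Ss sLs]] := Sl (e := e / 4) e4
  (Forall_cons _ LD (Forall_cons _ (pairing_dual ab ym bw) (Forall_nil _))).
have h1 := Forall_inv sLs; have h2 := Forall_inv (Forall_inv_tail sLs).
have h3 := wP s (or_introl Ss); have h4 := wP f (or_intror erefl).
have pE : pairing a b w f = l (pairing a b w).
  by rewrite fP//; apply: eq_Rintegral => x _; rewrite mulrC.
rewrite pE in h4.
rewrite (_ : _ - _ = (L f - l (pairing a b w)) - (pairing a b w s - l (pairing a b w)) -
  (L s - pairing a b w s) + (L s - l L)); last by ring.
rewrite (_ : e = e / 4 + e / 4 + e / 4 + e / 4); last by field.
apply: (le_trans (ler_normD _ _)); apply: lerD; last exact: ltW.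
apply: (le_trans (ler_normB _ _)); apply: lerD => //.
by apply: (le_trans (ler_normB _ _)); apply: lerD => //; exact: ltW.
Qed.

End density.

Lemma adherent_representable : exists f, in_Hphi a b phi f /\
  forall L, Hphi_dual a b phi L -> L f = l L.
Proof.
have [f [intf fP]] := adherent_density; exists f; split; last exact: (adherent_repr intf fP).
have mf : measurable_fun D f by apply/measurable_EFinP; exact: measurable_int intf.
have us := umc_singleton ym mf (adherent_modular_integrable intf fP).
by apply: (umc_in_Hphi ab ym us).
Qed.

End limit_representation.

(** * Compactness of the weak closure by ultrafilters *)

Section weak_compactness.
Context (a b : R) (ab : a <= b) (phi m : R -> R) (ym : young_pair phi m).
Context (dphi : Delta' phi).
Context (S : (R -> R) -> Prop) (Su : uniformly_modular_continuous a b phi S).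
Notation D := (`[a, b]%classic : set LT).
Notation Q := (weak_closure a b phi S).
Implicit Types (h : R -> R) (L : (R -> R) -> R).
Let mD : measurable D. Proof. exact: measurable_itv_LT. Qed.

(** [L] is within 1 of a bounded pairing on [S], and each value on the closure is within 1 of a
    value on [S]. *)
Lemma dual_bounded_weak_closure L : Hphi_dual a b phi L ->
  exists B, forall h, Q h -> `|L h| <= B.
Proof.
move=> LD; have [w [bw wP]] := dual_approx ab ym dphi Su LD ltr01.
have [mw [W wW]] := bw; have [C [C0 CP]] := umc_L1 ab ym Su.
exists (`|W| * C + 1 + 1) => h [hH hcl].
have [s [Ss [sH sLs]]] := hcl (L :: nil) 1 Rlt_0_1 (Forall_cons _ LD (Forall_nil _)).
have := Forall_inv sLs => /RltP; rewrite RabsE RminusE distrC => sL.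
have [ints sC] := CP s Ss.
have sw : `|pairing a b w s| <= `|W| * C.
  rewrite /pairing (_ : \int[leb]_(x in D) _ = \int[leb]_(x in D) (w x * s x)); last first.
    by apply: eq_Rintegral => x _; rewrite mulrC.
  have wW' x : D x -> `|w x| <= `|W|.
    by move=> Dx; apply: le_trans (wW x Dx) (ler_norm _).
  apply: (le_trans (le_normr_Rintegral_mul mD mw wW' ints)).
  by rewrite ler_wpM2l.
rewrite (_ : L h = (L h - L s) + ((L s - pairing a b w s) + pairing a b w s)); last by ring.
apply: (le_trans (ler_normD _ _)); rewrite [leRHS]addrC; apply: lerD; first exact: ltW.
apply: (le_trans (ler_normD _ _)); rewrite [leRHS]addrC; apply: lerD => //; exact: wP.
Qed.

(** The image of the ultrafilter lives on a compact interval, where it clusters; for an ultrafilter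
    a cluster point is a limit. *)
Lemma dual_ultra_limit (G : set_system (R -> R)) L : UltraFilter G -> G Q ->
  Hphi_dual a b phi L -> exists x, forall e, 0 < e -> G [set h | `|L h - x| < e].
Proof.
move=> GU GQ LD; have [B BP] := dual_bounded_weak_closure LD.
have [x [_ xcl]] : (`[- B, B]%classic : set R) `&` cluster (fmap L G) !=set0.
  have GP : ProperFilter G by exact: ultra_proper.
  apply: (@segment_compact R (- B) B (fmap L G) (fmap_proper_filter L GP)).
  have /filterS : Q `<=` L @^-1` `[- B, B].
    by move=> h /BP; rewrite /= in_itv/= ler_norml.
  exact.
exists x => e e0; have [//|nG] := in_ultra_setVsetC [set h | `|L h - x| < e] GU.
have [y [/= h1]] := xcl (~` [set y | `|y - x| < e]) (ball x e) nG (nbhsx_ballx x e e0).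
by rewrite /ball /= distrC => h2; case: h1.
Qed.

(** Without a finite subcover the complements of the open sets generate a filter on the closure. An
    ultrafilter above it has a limit on every functional, represented by some [f] in the closure,
    and the open set around [f] would belong to the ultrafilter together with its complement. *)
Theorem uniformly_modular_continuous_weakly_compact : rel_weakly_compact a b phi S.
Proof.
split; first by move=> s Ss; exact: (umc_in_Hphi ab ym Su Ss).
split=> [h []//|I U Uo Ucov].
apply: contrapT => nsub.
pose F : set_system (R -> R) := [set A | exists l : list I, forall h, Q h ->
  (forall i, In i l -> ~ U i h) -> A h].
have FF : ProperFilter F.
  split.
    move=> [l lP]; apply: nsub; exists l => h Qh; apply: contrapT => nU.
    by apply: (lP h Qh) => i il Uih; apply: nU; exists i.
  split.
  - by exists nil.
  - move=> A B [l lP] [l' l'P]; exists (app l l') => h Qh hl; split.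
      by apply: lP => // i il; apply: hl; apply: in_or_app; left.
    by apply: l'P => // i il; apply: hl; apply: in_or_app; right.
  - by move=> A B AB [l lP]; exists l => h Qh hl; apply: AB; exact: lP.
have [G [GU FG]] := ultraFilterLemma FF.
have GQ : G Q by apply: FG; exists nil.
have /choice[l lP] : forall L, exists x : R, Hphi_dual a b phi L ->
    forall e, 0 < e -> G [set h | `|L h - x| < e].
  move=> L; have [LD|nLD] := pselect (Hphi_dual a b phi L); last by exists 0.
  by have [x xP] := dual_ultra_limit GU GQ LD; exists x.
have GLs Ls e : 0 < e -> Forall (Hphi_dual a b phi) Ls ->
    G [set h | Forall (fun L => `|L h - l L| < e) Ls].
  move=> e0; elim: Ls => [|L Ls IH] LsD.
    by apply: (@filterS _ G _ Q) => // h _; exact: Forall_nil.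
  apply: (filterS _ (filterI (lP L (Forall_inv LsD) e e0) (IH (Forall_inv_tail LsD)))).
  by move=> h [h1 h2]; exact: Forall_cons.
(* The ultrafilter lives on the closure of [S]; one more approximation brings its limit next to
   members of [S] itself, where the uniform bounds hold. *)
have Sl : pointwise_adherent a b phi S l.
  move=> Ls e e0 LsD; have e2 : 0 < e / 2 by rewrite divr_gt0.
  have [h [hLs [hH hcl]]] := filter_ex (filterI (GLs Ls _ e2 LsD) GQ).
  have /RltP e2' := e2; have [s [Ss [_ sLs]]] := hcl Ls _ e2' LsD.
  exists s; split => //; apply: Forall_impl (Forall_and hLs sLs) => L [h1 /RltP].
  rewrite RabsE RminusE => h2; rewrite (_ : _ - _ = (L s - L h) + (L h - l L)); last by ring.
  by apply: (le_lt_trans (ler_normD _ _)); rewrite [ltRHS]splitr ltrD.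
have [f [fH fl]] := adherent_representable ab ym dphi Su Sl.
have Qf : Q f.
  split => // Ls e /RltP e0 LsD; have [s [Ss sLs]] := Sl Ls e e0 LsD.
  exists s; split => //; split; first exact: (umc_in_Hphi ab ym Su Ss).
  apply: Forall_impl (Forall_and LsD sLs) => L [LD h1].
  by apply/RltP; rewrite RabsE RminusE fl.
have [i Uif] := Ucov f Qf.
have [_ Uio] := Uo i; have [Ls [e [/RltP e0 [LsD eU]]]] := Uio f Uif.
have Gn : G [set h | ~ U i h].
  by apply: FG; exists (i :: nil) => h _; apply; left.
have [h [[hLs [hH _]] nU]] := filter_ex (filterI (filterI (GLs Ls e e0 LsD) GQ) Gn).
apply: nU; apply: eU; split => //.
apply: Forall_impl (Forall_and LsD hLs) => L [LD h1].
by apply/RltP; rewrite RabsE RminusE fl.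
Qed.

End weak_compactness.

(** * The Henstock-Dunford integral *)

Section henstock_dunford.
Context (X : Banach) (a b : R) (ab : a <= b) (g : R -> X).
Context (gI : HD_integrable X a b g).
Context (gE : forall E, lebesgue_measurable a b E ->
  HD_integrable X a b (fun t => bscal X (indicator E t) (g t))).
Notation D := (`[a, b]%classic : set LT).
Let mD : measurable D. Proof. exact: measurable_itv_LT. Qed.

Definition ball_compositions (h : R -> R) :=
  exists y, dual_ball X y /\ h = (fun t => y (g t)).

(** [Henstock_measurable] comes first: it makes the sign sets of [y g] measurable, and so admissible
    as [E]. *)
Lemma HD_dual_integrable (y : X -> R) : is_dual X y ->
  leb.-integrable D (EFin \o (fun t => y (g t))).
Proof.
move=> yD; have [gH _] := gI; have [A HA] := gH y yD.
apply: (Henstock_indic_integrable ab (Henstock_measurable ab HA)) => E /gE[EH _].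
have [B HB] := EH y yD; exists B; move: HB; congr Henstock_integral.
by apply/funext => t; have [_ [-> _]] := yD; rewrite !RmultE mulrC.
Qed.

Lemma HD_integral_onP (E : R -> Prop) (Phi : (X -> R) -> R) :
  lebesgue_measurable a b E -> is_HD_integral_on X a b g E Phi <->
  forall y, is_dual X y -> Phi y = \int[leb]_(t in (E : set LT)) y (g t).
Proof.
move=> /lebesgue_measurableP[ED mE].
have HE y : is_dual X y -> Henstock_integral (fun t => (y (g t) * indicator E t)%coqR) a b
    (\int[leb]_(t in (E : set LT)) y (g t)).
  move=> yD; have := Lebesgue_Henstock ab (integrable_indic_mul mE (HD_dual_integrable yD)).
  rewrite (Rintegral_indicE _ mE ED); congr Henstock_integral.
  by apply/funext => t; rewrite RmultE indicatorE.
split=> [EPhi y yD|EPhi y yD]; last by rewrite EPhi//; exact: HE.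
exact: Henstock_unique ab (EPhi y yD) (HE y yD).
Qed.

(** The candidates [Phin] and [PhiU] are arbitrary, but [HD_integral_onP] fixes their values on the
    dual as Lebesgue integrals; the norm estimate in the bidual is then uniformity over
    [ball_compositions]. *)
Lemma HD_countably_additiveP : HD_countably_additive X a b g <->
  uniformly_countably_additive leb D (ball_compositions : set (LT -> R)).
Proof.
have leb_bigcup (F : nat -> set LT) : (forall n, lebesgue_measurable a b (F n)) ->
    lebesgue_measurable a b (\bigcup_n F n).
  move=> mF; apply/lebesgue_measurableP; split.
    by move=> x [n _]; have /lebesgue_measurableP[h _] := mF n; exact: h.
  by apply: bigcup_measurable => n _; have /lebesgue_measurableP[] := mF n.
have bigcupE (F : nat -> set LT) : (fun x => exists n, F n x) = (\bigcup_n F n).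
  by apply/seteqP; split=> x; [move=> [n Fx]; exists n|move=> [n _ Fx]; exists n].
split=> [gca F mF FD tF e /RltP e0|uca En Phin PhiU mE dE PhinP PhiUP e /RltP e0].
- have lF n : lebesgue_measurable a b (F n) by apply/lebesgue_measurableP.
  have [|||N0 N0P] := gca F (fun n y => \int[leb]_(t in F n) y (g t))
    (fun y => \int[leb]_(t in \bigcup_n F n) y (g t)) lF _ _ _ e e0.
  + move=> n k x nk Fn Fk; apply: nk; apply: (tF n k) => //.
    by exists x.
  + by move=> n; apply/(HD_integral_onP _ (lF n)).
  + by rewrite bigcupE; apply/(HD_integral_onP _ (leb_bigcup F lF)).
  exists N0 => N N0N _ [y [yb ->]].
  have /ssrnat.leP N0N' := N0N; have /RleP := N0P N N0N' y yb.
  by rewrite RabsE RminusE sum_f_R0E.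
- have tE : trivIset setT (En : nat -> set LT).
    move=> n k _ _ [x [nx kx]]; apply: contrapT => nk; exact: dE nk nx kx.
  have [||N0 N0P] := uca En _ _ tE e e0.
  + by move=> n; have /lebesgue_measurableP[] := mE n.
  + by move=> n; have /lebesgue_measurableP[] := mE n.
  exists N0 => N /ssrnat.leP N0N y yb; have [yD _] := yb.
  apply/RleP; rewrite RabsE RminusE sum_f_R0E.
  rewrite bigcupE in PhiUP.
  rewrite ((HD_integral_onP _ (leb_bigcup En mE)).1 PhiUP y yD).
  have -> : \sum_(0 <= n < N.+1) Phin n y =
      \sum_(0 <= n < N.+1) \int[leb]_(t in (En n : set LT)) y (g t).
    by apply: eq_bigr => n _; exact: ((HD_integral_onP _ (mE n)).1 (PhinP n) y yD).
  by apply: (N0P N N0N); exists y.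
Qed.

End henstock_dunford.

Local Close Scope ring_scope.
Local Close Scope classical_set_scope.
Open Scope R_scope.
Theorem theorem3p1 (X : Banach) (a b : R) (g : R -> X) :
  a < b ->
  HD_integrable X a b g ->
  (forall E, lebesgue_measurable a b E ->
     HD_integrable X a b (fun t => bscal X (indicator E t) (g t))) ->
  (HD_countably_additive X a b g <->
   exists phi : R -> R, N_function phi /\ Delta' phi /\
     rel_weakly_compact a b phi
       (fun h => exists y, dual_ball X y /\ h = (fun t => y (g t)))).
Proof.
move=> /RltP/ltW ab gI gE; split=> [/(HD_countably_additiveP ab gI gE) uca|].
- have intS h : ball_compositions g h -> leb.-integrable `[a, b]%classic (EFin \o h).
    by move=> [y [[yD _] ->]]; exact: (HD_dual_integrable ab gI gE).
  have acS := countably_additive_abs_continuous (measurable_itv_LT _) intS uca.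
  have [M [M0 MS MP]] := exists_thresholds ab intS acS.
  exists (slow_phi M); split; first exact: slow_N_function M0 MS.
  split; first exact: slow_Delta' M0 MS.
  exact: (uniformly_modular_continuous_weakly_compact ab (slow_phi_young_pair M0 MS)
    (slow_Delta' M0 MS) (slow_uniformly_modular_continuous ab intS acS M0 MS MP)).
- move=> [phi [phiN [_ Sc]]]; apply/(HD_countably_additiveP ab gI gE).
  have [m ym] := N_function_young_pair phiN.
  exact: rel_weakly_compact_countably_additive ab ym Sc.
Qed.
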